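(* Let $f$ be any $n$-variate $m$-nomial whose Newton polytope $\mathrm{Newt}(f)$ is $n$-dimensional. Assume that $Z_+(\mathrm{Init}_w(f))$ is smooth for all $w\in\mathbb{R}^n\setminus\{0\}$. Then the number of non-compact connected components of $Z_+(f)$ is no more than $$\sum_{w}N_w,$$ where $w$ ranges over the unit inner facet normals of $\mathrm{Newt}(f)$ and $N_w$ denotes the number of connected components of $Z_+(\mathrm{Init}_w(f))$. In particular (for $n\ge2$), this bound is no larger than $$\sum_{Q\text{ a facet of }\mathrm{Newt}(f)}P(n-1,\#(\mathrm{Supp}(f)\cap Q)).$$ Finally, when $n=2$ and $Z_+(f)$ is smooth as well, the last upper bound can be simplified to $\lfloor m'/2\rfloor$, where $m'$ is the number of points of $\mathrm{Supp}(f)$ lying on the boundary of $\mathrm{Newt}(f)$; that is, $Z_+(f)$ has at most $\lfloor m'/2\rfloor$ non-compact connected components, and this bound is sharp (for every $m'\ge3$ it is attained by some such $f$).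
   Context: Let $\mathbb{R}^n_+=\{x\in\mathbb{R}^n: x_i>0\text{ for all }i\}$ and $x^a=x_1^{a_1}\cdots x_n^{a_n}$ for $a\in\mathbb{R}^n$ (real exponents allowed). An $n$-variate $m$-nomial is a function $f(x)=\sum_{a\in A}c_ax^a$ on $\mathbb{R}^n_+$ with exactly $m$ monomial terms (distinct exponent vectors in $\mathbb{R}^n$, nonzero real coefficients $c_a$); its support is $\mathrm{Supp}(f)=\{a: c_a\ne0\}$, and $\mathrm{Newt}(f)$ is the convex hull of $\mathrm{Supp}(f)$. $Z_+(f)$ is the zero set of $f$ in $\mathbb{R}^n_+$; it is smooth if the gradient of $f$ is nonzero at each of its points (so the empty set is smooth). For $w\in\mathbb{R}^n$ and a compact set $B\subset\mathbb{R}^n$, $B^w$ is the set of $x\in B$ minimizing the inner product $w\cdot x$; for a polytope $B$ this is the face with inner normal $w$. A facet of an $n$-dimensional polytope is a face of dimension $n-1$; a unit inner facet normal is a unit vector $w$ such that $\mathrm{Newt}(f)^w$ is a facet. The initial term polynomial is $\mathrm{Init}_w(f)=\sum_{a\in \mathrm{Supp}(f)^w}c_ax^a$. $P(n,m)$ denotes the maximum number of connected components of $Z_+(g)$ over all $n$-variate $m$-nomials $g$. *)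

(* Defs.v *)
From HB Require Import structures.
From mathcomp Require Import all_boot all_order all_algebra.
From mathcomp Require Import finmap.
From mathcomp Require Import all_classical all_reals all_analysis.
Set Implicit Arguments.
Unset Strict Implicit.
Unset Printing Implicit Defensive.
Import Order.TTheory GRing.Theory Num.Theory.
Import numFieldNormedType.Exports.
Local Open Scope fset_scope.
Local Open Scope classical_set_scope.
Local Open Scope ring_scope.

Section Polytopes.
Context {R : realType} {n : nat}.
Implicit Types (A B : set 'rV[R]_n) (w x y : 'rV[R]_n).

Definition dot x y : R := \sum_(i < n) x 0 i * y 0 i.

Definition convex_hull A : set 'rV[R]_n := smallest (@convex_set R 'rV[R]_n) A.

Definition affine_set A : Prop :=
  forall x y (t : R), A x -> A y -> A ((1 - t) *: x + t *: y).

Definition affine_hull A : set 'rV[R]_n := smallest affine_set A.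

(* The dimension of a nonempty set is that of the direction [U] of its affine
   hull [x0 + U]; the empty set has no dimension. *)
Definition has_dim A (d : nat) : Prop :=
  exists (x0 : 'rV[R]_n) (U : {vspace 'rV[R]_n}),
    affine_hull A = [set x0 + v | v in [set v | v \in U]] /\ \dim U = d.

Definition face B w : set 'rV[R]_n :=
  [set x | B x /\ forall y, B y -> dot w x <= dot w y].

(* Facets and facet normals of [B], for [B] a polytope of full dimension [n]. *)
Definition is_facet B (Q : set 'rV[R]_n) : Prop :=
  (exists w, Q = face B w) /\ has_dim Q n.-1.

(* [`|w|] would be the sup norm, hence the condition on [dot w w]. *)
Definition unit_facet_normal B w : Prop := dot w w = 1 /\ is_facet B (face B w).

Definition boundary A : set 'rV[R]_n := closure A `\` interior A.

End Polytopes.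

Section Components.
Context {T : topologicalType}.

Definition components (A : set T) : set (set T) := connected_component A @` A.

Definition noncompact_components (A : set T) : set (set T) :=
  [set C | components A C /\ ~ compact C].

End Components.

(* A generalized polynomial with real exponents: the coefficient of [x^a], as
   a finitely supported function of the exponent vector [a]. *)
Notation fewnomial R n := {fsfun 'rV[R]_n -> R with 0}.

Section Fewnomials.
Context {R : realType} {n : nat}.
Implicit Types (f : fewnomial R n) (w x a : 'rV[R]_n).

Definition nomial (m : nat) f : Prop := #|` finsupp f| = m.

Definition monomial a x : R := \prod_(i < n) x 0 i `^ a 0 i.

(* Meaningful on the open positive orthant only, because of [powR]. *)
Definition eval_at f x : R := \sum_(a <- finsupp f) f a * monomial a x.

Definition supp f : set 'rV[R]_n := [set a | a \in finsupp f].

Definition newton f : set 'rV[R]_n := convex_hull (supp f).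

Definition num_support_in f (Q : set 'rV[R]_n) : nat :=
  #|` [fset a in finsupp f | `[< Q a >]]|.

Definition init_term w f : fewnomial R n :=
  [fsfun a in [fset a in finsupp f | `[< face (supp f) w a >]] => f a].

Definition pos_zeros f : set 'rV[R]_n :=
  [set x : 'rV[R]_n | (forall i, 0 < x 0 i) /\ eval_at f x = 0].

Definition gradient f x : 'rV[R]_n := \row_i 'D_(delta_mx 0 i) (eval_at f) x.

Definition smooth_zeros f : Prop :=
  forall x, pos_zeros f x -> gradient f x != 0.

(* Numbers of components are extended reals, equal to [+oo] if infinite. *)
Definition num_components f : \bar R := counting (components (pos_zeros f)).

Definition num_noncompact_components f : \bar R :=
  counting (noncompact_components (pos_zeros f)).

End Fewnomials.

(* The maximum P(n, m), as a supremum of extended reals, so that it makes sense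
   prior to the fewnomial theorem, which says that it is finite (hence
   attained, being the supremum of a set of natural numbers). *)
Definition max_num_components (R : realType) (n m : nat) : \bar R :=
  ereal_sup [set num_components g | g in [set g : fewnomial R n | nomial m g]].

(* Main.v *)
(* In logarithmic coordinates [x = exp y], [f] becomes the exponential sum
   [F y = sum_a c_a exp (a . y)]. If [q] is a zero of the initial form of a facet
   with inner normal [w], then [exp (t h) F (x - t w)], with [h = w . a] on the
   facet, tends to this initial form with its derivatives as [t] tends to
   infinity, so that by smoothness the zeros of [F] in a thin tube around the ray
   [q - t w] form a connected graph. Hence a single component of the zero set is
   attached to [q], and it depends only on the component of [q]. Conversely, let
   [y] be a far away point of a noncompact component. The terms of [F] of largest
   order at [y] form a proper face of the Newton polytope, the zero set is a graph
   along the normal cone of this face, and following it in the direction of a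
   facet containing the face ends at such a [q]. This bounds the number of
   noncompact components by the number of pairs (facet, component of the zero set
   of its initial form), and the latter zero set is the product of a line with
   the zero set of a polynomial in one variable less.

   In the plane, every noncompact component has at least two ends. Otherwise a
   large trapezoid would meet it in a single point where [F] changes sign, but
   the sign changes of [F] due to one component along a closed curve cancel out.
   An edge with [k] support points has at most [k - 1] ends by Descartes' rule of
   signs, and these numbers add up to the number of boundary support points. The
   bound is attained by [y - (x - 1) ... (x - d)]. *)
Require Import Defs.
From HB Require Import structures.
From mathcomp Require Import all_boot all_order all_algebra.
From mathcomp Require Import finmap.
From mathcomp Require Import all_classical all_reals all_analysis.
From mathcomp Require Import ring lra.
From mathcomp Require Import separable.
Set Implicit Arguments.
Unset Strict Implicit.
Unset Printing Implicit Defensive.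
Import Order.TTheory GRing.Theory Num.Theory.
Import numFieldNormedType.Exports.
Local Open Scope classical_set_scope.
Local Open Scope ring_scope.

(** * Exponential sums and their zero sets as graphs *)

(** Smoothness is used in a quantitative form: near a zero [p] of an exponential sum with positive
    derivative along [v], every sum with nearby coefficients changes sign and increases strictly on
    a short segment parallel to [v]. Multiplying [f] by a constant and translating it brings its
    coefficients close to those of an initial form, so one estimate at [p] covers a whole unbounded
    tube. All initial forms have to be smooth, not only those of facets: the dominant terms at a far
    point may form a face of any dimension, and the graph over that face must exist before it can be
    followed towards a facet. Infinity is approached along an ultrafilter, so that the ratio of each
    term to the largest one has a limit; the dominant face consists of the terms with positive
    limit. Attachment to a point asks only for accumulation along a ray, which compactness provides,
    and connectedness of the graph turns it into uniqueness. The cancellation of sign changes in the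
    plane is proved on a grid so fine that no cell meets both the component and the other zeros. *)

Lemma cvg_rsum (R : realType) (I T : Type) (F : set_system T) (r : seq I)
    (f : I -> T -> R) (l : I -> R) : Filter F ->
  (forall i, f i @ F --> l i) ->
  (fun x => \sum_(i <- r) f i x) @ F --> \sum_(i <- r) l i.
Proof.
by move=> FF fl; apply: cvg_big => [|i _]; [exact: add_continuous|exact: fl].
Qed.

Section Dot.
Context {R : realType} {n : nat}.
Implicit Types (a b u v w x y : 'rV[R]_n) (t : R).

Lemma dotC x y : dot x y = dot y x.
Proof. by apply: eq_bigr => i _; rewrite mulrC. Qed.

Lemma dotDl x y v : dot (x + y) v = dot x v + dot y v.
Proof. by rewrite -big_split; apply: eq_bigr => i _; rewrite mxE mulrDl. Qed.

Lemma dotDr x y v : dot v (x + y) = dot v x + dot v y.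
Proof. by rewrite dotC dotDl !(dotC v). Qed.

Lemma dotZl t x y : dot (t *: x) y = t * dot x y.
Proof. by rewrite [RHS]mulr_sumr; apply: eq_bigr => i _; rewrite mxE mulrA. Qed.

Lemma dotZr t x y : dot x (t *: y) = t * dot x y.
Proof. by rewrite dotC dotZl dotC. Qed.

Lemma dotNl x y : dot (- x) y = - dot x y.
Proof. by rewrite -scaleN1r dotZl mulN1r. Qed.

Lemma dotNr x y : dot x (- y) = - dot x y.
Proof. by rewrite dotC dotNl dotC. Qed.

Lemma dotBl x y v : dot (x - y) v = dot x v - dot y v.
Proof. by rewrite dotDl dotNl. Qed.

Lemma dotBr x y v : dot v (x - y) = dot v x - dot v y.
Proof. by rewrite dotDr dotNr. Qed.

Lemma dot0l x : dot 0 x = 0.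
Proof. by rewrite -(scale0r 0) dotZl mul0r. Qed.

Lemma dot0r x : dot x 0 = 0.
Proof. by rewrite dotC dot0l. Qed.

Lemma dot_ge0 x : 0 <= dot x x.
Proof. by apply: sumr_ge0 => i _; rewrite -expr2 sqr_ge0. Qed.

Lemma dot_eq0 x : (dot x x == 0) = (x == 0).
Proof.
apply/eqP/eqP => [/eqP|->]; last by rewrite dot0l.
rewrite psumr_eq0 => [/allP h|i _]; last by rewrite -expr2 sqr_ge0.
apply/rowP => i; rewrite mxE; apply/eqP.
by have := h i (mem_index_enum _); rewrite /= mulf_eq0 orbb.
Qed.

Lemma dot_gt0 x : (0 < dot x x) = (x != 0).
Proof. by rewrite lt_def dot_ge0 andbT dot_eq0. Qed.

Lemma dot_delta a (i : 'I_n) : dot a (delta_mx 0 i) = a 0 i.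
Proof.
rewrite /dot (bigD1 i)//= big1 ?addr0 ?mxE ?eqxx ?mulr1// => j ji.
by rewrite mxE (negPf ji) mulr0.
Qed.

Lemma dot_mulmx x y : dot x y = (x *m y^T) 0 0.
Proof. by rewrite mxE; apply: eq_bigr => i _; rewrite mxE. Qed.

Lemma coord_le_norm x (i : 'I_n) : `|x 0 i| <= `|x|.
Proof.
rewrite [leRHS]/Num.norm/= mx_normrE; apply/bigmax_geP; right.
by exists (0, i).
Qed.

Lemma norm_dot_le x y : `|dot x y| <= (\sum_(i < n) `|x 0 i|) * `|y|.
Proof.
rewrite (le_trans (ler_norm_sum _ _ _))// mulr_suml ler_sum// => i _.
by rewrite normrM ler_wpM2l// coord_le_norm.
Qed.

Lemma dot_continuous a : continuous (dot a).
Proof.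
move=> x; apply: (@cvg_rsum _ _ _ (nbhs x)) => i.
by apply: cvgM; [exact: cvg_cst|exact: coord_continuous].
Qed.

End Dot.

Section ExpSum.
Context {R : realType} {n : nat}.
Implicit Types (S : seq 'rV[R]_n) (c d : 'rV[R]_n -> R).
Implicit Types (a u v w x y : 'rV[R]_n).

Definition expsum S c x : R := \sum_(a <- S) c a * expR (dot a x).

Definition expzeros S c : set 'rV[R]_n := [set x | expsum S c x = 0].

Lemma eq_expsum S c d x : {in S, c =1 d} -> expsum S c x = expsum S d x.
Proof. by move=> cd; rewrite /expsum !big_seq; apply: eq_bigr => a /cd ->. Qed.

Lemma expsumD S c x y :
  expsum S c (x + y) = expsum S (fun a => c a * expR (dot a y)) x.
Proof.
by apply: eq_bigr => a _; rewrite dotDr expRD -mulrA; congr (_ * _); rewrite mulrC.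
Qed.

Lemma expsumZ S c (k : R) x : expsum S (fun a => k * c a) x = k * expsum S c x.
Proof. by rewrite [RHS]mulr_sumr; apply: eq_bigr => a _; rewrite mulrA. Qed.

Lemma expsum_continuous S c : continuous (expsum S c).
Proof.
move=> x; rewrite /continuous_at /expsum.
apply: (@cvg_rsum _ _ _ (nbhs x)) => a.
apply: cvgM; first exact: cvg_cst.
apply: continuous_cvg; [exact: continuous_expR|exact: dot_continuous].
Qed.

Lemma expzeros_closed S c : closed (expzeros S c).
Proof.
rewrite (_ : expzeros S c = expsum S c @^-1` [set 0])//.
by apply: closed_comp => [x _|]; [exact: expsum_continuous|exact: closed_eq].
Qed.

Lemma is_derive_expsum_line S c x v (s : R) :
  is_derive s 1 (fun s => expsum S c (x + s *: v))
    (expsum S (fun a => c a * dot a v) (x + s *: v)).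
Proof.
elim: S => [|a S IH].
  rewrite /expsum big_nil (_ : (fun _ => _) = cst 0).
    exact: is_derive_cst.
  by apply/funext => t; rewrite big_nil.
rewrite /expsum big_cons (_ : (fun _ => _) =
   (fun t => c a * expR (dot a x) * expR (dot a v * t)) \+
   (fun t => expsum S c (x + t *: v))); last first.
  apply/funext => t; rewrite big_cons dotDr dotZr expRD /= mulrA.
  by rewrite [dot a v * t]mulrC.
apply: is_deriveD.
rewrite (_ : c a * dot a v * _ = c a * expR (dot a x) * (expR (dot a v * s) * dot a v));
  last first.
  by rewrite dotDr dotZr expRD [dot a v * s]mulrC; ring.
have lin : is_derive s 1 (fun t : R => dot a v * t) (dot a v).
  rewrite -[X in is_derive _ _ _ X]mulr1.
  exact: (@is_deriveZ R _ _ (@id R) (dot a v) s 1 1 (is_derive_id _ _)).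
have comp := @is_derive1_comp R _ _ _ _ _ (is_derive_expR _) lin.
exact: (@is_deriveZ R _ _ _ (c a * expR (dot a x)) s 1 _ comp).
Qed.

Lemma line_continuous S c x v : continuous (fun s : R => expsum S c (x + s *: v)).
Proof.
move=> s; apply: differentiable_continuous; apply/derivable1_diffP.
by have [] := is_derive_expsum_line S c x v s.
Qed.

Lemma expsum_line_incr S c x v (r : R) :
  (forall s, `|s| < r -> 0 < expsum S (fun a => c a * dot a v) (x + s *: v)) ->
  forall s t, - r <= s -> s < t -> t <= r ->
    expsum S c (x + s *: v) < expsum S c (x + t *: v).
Proof.
move=> pos s t rs st tr.
apply: (@gtr0_derive1_incr R (fun s => expsum S c (x + s *: v)) (- r) r) => //.
- by move=> z _; have [] := is_derive_expsum_line S c x v z.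
- move=> z; rewrite in_itv/= => zr; rewrite derive1E.
  by have [_ ->] := is_derive_expsum_line S c x v z; apply: pos; rewrite ltr_norml.
- by apply: continuous_subspaceT => z; exact: line_continuous.
Qed.

End ExpSum.

Lemma continuous_gt_ball (R : realType) (V : normedModType R) (f : V -> R) (p : V) (k : R) :
  continuous f -> k < f p ->
  exists2 r, 0 < r & forall x, `|x - p| < r -> k < f x.
Proof.
move=> cf kf; have : \forall x \near p, k < f x by exact: (cvgr_gt _ (cf p)).
move=> /nbhs_normP[r r0 h]; exists r => // x xp; apply: h.
by rewrite /= distrC.
Qed.

Section LocalGraph.
Context {R : realType} {n : nat}.
Implicit Types (S : seq 'rV[R]_n) (c d : 'rV[R]_n -> R).
Implicit Types (a u v w x y p : 'rV[R]_n).

(** The derivative along [v], taken term by term: again an exponential sum over [S], so that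
    continuity and perturbation estimates apply to it as well. *)
Definition expdir S c v : 'rV[R]_n -> R := expsum S (fun a => c a * dot a v).

(** Transversality in a form stable under small changes of [d] and [x]: the signs at the ends give a
    zero on the segment, strict increase makes it the only one. *)
Definition crossing S d v (e : R) x : Prop :=
  [/\ expsum S d (x - e *: v) < 0, 0 < expsum S d (x + e *: v)
    & forall s t, - e <= s -> s < t -> t <= e ->
        expsum S d (x + s *: v) < expsum S d (x + t *: v)].

Lemma expsum_shift_continuous S c v : continuous (fun x => expsum S c (x + v)).
Proof.
rewrite (_ : (fun x => _) = expsum S (fun a => c a * expR (dot a v))).
  exact: expsum_continuous.
by apply/funext => x; rewrite expsumD.
Qed.

Lemma expsum_perturb S c d (eta : R) x : (forall a, a \in S -> `|d a - c a| <= eta) ->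
  `|expsum S d x - expsum S c x| <= eta * expsum S (fun=> 1) x.
Proof.
move=> dc; rewrite /expsum mulr_sumr -sumrB (le_trans (ler_norm_sum _ _ _))//.
rewrite !big_seq; apply: ler_sum => a aS.
rewrite -mulrBl normrM mul1r (@ger0_norm _ (expR _)) ?expR_ge0//.
by rewrite ler_wpM2r ?expR_ge0// dc.
Qed.

(** The derivative along [v] exceeds [D / 2] near [p], and changing the coefficients by [eta]
    changes it by at most [eta * (V * K)], where [V] bounds the numbers [dot a v] and [K] the sum of
    the exponentials. Coefficients are perturbed because far out [f] agrees only approximately with
    an initial form. *)
Lemma local_graph S c p v (e0 : R) :
  expsum S c p = 0 -> 0 < expdir S c v p -> 0 < e0 ->
  exists e r eta : R, [/\ 0 < e <= e0, 0 < r, 0 < eta &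
    forall d x, (forall a, a \in S -> `|d a - c a| <= eta) -> `|x - p| <= r ->
      crossing S d v e x].
Proof.
move=> p0 D0 e00; set D := expdir S c v p in D0.
have [r1 r10 h1] : exists2 r, 0 < r & forall x, `|x - p| < r -> D / 2 < expdir S c v x.
  apply: (@continuous_gt_ball _ _ (expdir S c v)); first by move=> x; exact: expsum_continuous.
  by rewrite ltr_pdivrMr// mulr_natr mulr2n ltrDl.
pose E := expsum S (fun=> 1); pose K := E p + 1.
have E0 x : 0 <= E x by apply: sumr_ge0 => a _; rewrite mul1r expR_ge0.
have K0 : 0 < K by rewrite ltr_wpDl.
have [r2 r20 h2] : exists2 r, 0 < r & forall x, `|x - p| < r -> - K < - E x.
  apply: (@continuous_gt_ball _ _ (fun x => - E x)); last by rewrite ltrN2 ltrDl.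
  by move=> x; exact: (cvgN (@expsum_continuous R n S (fun=> 1) x)).
pose r0 := Num.min r1 r2.
have r00 : 0 < r0 by rewrite lt_min r10.
have H1 x : `|x - p| < r0 -> D / 2 < expdir S c v x.
  by move=> xp; apply: h1; rewrite (lt_le_trans xp)// ge_min lexx.
have H2 x : `|x - p| < r0 -> E x < K.
  by move=> xp; rewrite -ltrN2 h2// (lt_le_trans xp)// ge_min lexx orbT.
pose V := \sum_(a <- S) `|dot a v|.
have V0 : 0 <= V by apply: sumr_ge0.
have Va a : a \in S -> `|dot a v| <= V.
  by move=> aS; rewrite /V (big_rem a)//= lerDl sumr_ge0.
(* Half of [r0] is left to [x] and half to the segment, so that [x + s *: v] stays where both bounds
   hold. *)
pose e := Num.min e0 (r0 / (2 * (`|v| + 1))).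
have v1 : 0 < `|v| + 1 by rewrite ltr_wpDl.
have e_gt0 : 0 < e by rewrite lt_min e00 divr_gt0// mulr_gt0.
have ev : e * `|v| < r0 / 2.
  have : e * (`|v| + 1) <= r0 / 2.
    by rewrite -ler_pdivlMr// -mulrA -invfM ge_min lexx orbT.
  by apply: lt_le_trans; rewrite ltr_pM2l// ltrDl.
have inball x s : `|x - p| <= r0 / 2 -> `|s| <= e -> `|x + s *: v - p| < r0.
  move=> xp se; rewrite addrAC (le_lt_trans (ler_normD _ _))//.
  rewrite [ltRHS]splitr ler_ltD// normrZ (le_lt_trans _ ev)// ler_wpM2r//.
have incr d (eta : R) x : eta * (V * K) <= D / 2 -> 0 < eta ->
    (forall a, a \in S -> `|d a - c a| <= eta) ->
    `|x - p| <= r0 / 2 -> forall s t, - e <= s -> s < t -> t <= e ->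
        expsum S d (x + s *: v) < expsum S d (x + t *: v).
  move=> etaVK eta0 dc xp; apply: expsum_line_incr => s se.
  have xs := inball x s xp (ltW se).
  have dcV a : a \in S -> `|d a * dot a v - c a * dot a v| <= eta * V.
    by move=> aS; rewrite -mulrBl normrM ler_pM// ?Va// dc.
  have := expsum_perturb (x + s *: v) dcV.
  rewrite ler_norml -/E => /andP[+ _]; rewrite lerBrDl.
  apply: lt_le_trans; rewrite subr_gt0 (le_lt_trans _ (H1 _ xs))//.
  rewrite (le_trans _ etaVK)// -mulrA ler_wpM2l ?(ltW eta0)// ler_wpM2l// ltW//.
  exact: H2.
have cc : forall a, a \in S -> forall eta : R, 0 < eta -> `|c a - c a| <= eta.
  by move=> a _ eta ?; rewrite subrr normr0 ltW.
pose eta1 := D / (2 * (V * K + 1)).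
have eta1_gt0 : 0 < eta1 by rewrite divr_gt0// mulr_gt0// ltr_wpDl// mulr_ge0// ltW.
have eta1P : eta1 * (V * K) <= D / 2.
  have q0 : 0 <= V * K by rewrite mulr_ge0// ltW.
  rewrite (_ : eta1 * _ = D / 2 * ((V * K + 1)^-1 * (V * K))); last first.
    by rewrite /eta1 invfM; ring.
  rewrite ler_piMr ?divr_ge0 ?(ltW D0)//.
  by rewrite mulrC ler_pdivrMr ?mul1r ?lerDl// ltr_wpDl.
have pp : `|p - p| <= r0 / 2 by rewrite subrr normr0 divr_ge0// ltW.
have cincr := incr c eta1 p eta1P eta1_gt0 (fun a aS => cc a aS _ eta1_gt0) pp.
have up : 0 < expsum S c (p + e *: v).
  by have := cincr 0 e _ e_gt0 (lexx _); rewrite scale0r addr0 p0; apply; rewrite oppr_le0 ltW.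
have um : 0 < - expsum S c (p - e *: v).
  rewrite oppr_gt0; have := cincr (- e) 0 (lexx _) _ (ltW e_gt0).
  by rewrite scale0r addr0 p0 scaleNr; apply; rewrite oppr_lt0.
(* The margin of the signs at the two ends of the segment at [p]: moving [x] costs less than half of
   it, changing the coefficients at most the other half. *)
pose m := Num.min (expsum S c (p + e *: v)) (- expsum S c (p - e *: v)).
have m0 : 0 < m by rewrite lt_min up.
have [r3 r30 h3] : exists2 r, 0 < r & forall x, `|x - p| < r -> m / 2 < expsum S c (x + e
  *: v).
  apply: (@continuous_gt_ball _ _ (fun x => expsum S c (x + e *: v))).
    exact: expsum_shift_continuous.
  by rewrite ltr_pdivrMr// (@le_lt_trans _ _ (expsum S c (p + e *: v)))// ?ge_min ?lexx//
    mulr_natr mulr2n ltrDl.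
have [r4 r40 h4] : exists2 r, 0 < r & forall x, `|x - p| < r -> m / 2 < - expsum S c (x -
  e *: v).
  apply: (@continuous_gt_ball _ _ (fun x => - expsum S c (x - e *: v))).
    by move=> x; exact: (cvgN (@expsum_shift_continuous S c (- (e *: v)) x)).
  by rewrite ltr_pdivrMr// (@le_lt_trans _ _ (- expsum S c (p - e *: v)))//
    ?ge_min ?lexx ?orbT// mulr_natr mulr2n ltrDl.
pose eta := Num.min eta1 (m / (2 * K)).
exists e, (Num.min (r0 / 2) (Num.min r3 r4 / 2)), eta.
have eta_gt0 : 0 < eta by rewrite lt_min eta1_gt0 divr_gt0// mulr_gt0.
have etaK : eta * K <= m / 2.
  rewrite -ler_pdivlMr// -mulrA -invfM ge_min lexx orbT//.
split => //; first by rewrite e_gt0 ge_min lexx.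
  by rewrite lt_min !divr_gt0// lt_min r30.
move=> d x dc xr.
have xr0 : `|x - p| <= r0 / 2 by rewrite (le_trans xr)// ge_min lexx.
have xr34 : `|x - p| < Num.min r3 r4.
  rewrite (le_lt_trans xr)// (@le_lt_trans _ _ (Num.min r3 r4 / 2))//;
    first by rewrite ge_min lexx orbT.
  by rewrite ltr_pdivrMr// mulr_natr mulr2n ltrDl lt_min r30.
have [xr3 xr4] : `|x - p| < r3 /\ `|x - p| < r4 by apply/andP; rewrite -lt_min.
have ee : `|e| <= e by rewrite gtr0_norm.
have eN : `|- e| <= e by rewrite normrN gtr0_norm.
split.
- have := expsum_perturb (x - e *: v) dc; rewrite ler_norml => /andP[_].
  rewrite lerBlDr -scaleNr => /le_lt_trans; apply.
  rewrite -ltrBrDr sub0r -/E (@lt_le_trans _ _ (eta * K))//.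
    by rewrite ltr_pM2l// H2// inball.
  by rewrite (le_trans etaK)// scaleNr ltW// h4.
- have := expsum_perturb (x + e *: v) dc; rewrite ler_norml => /andP[+ _].
  rewrite lerBrDl; apply: lt_le_trans; rewrite subr_gt0 -/E.
  rewrite (@lt_le_trans _ _ (eta * K))//; first by rewrite ltr_pM2l// H2// inball.
  by rewrite (le_trans etaK)// ltW// h3.
- apply: (incr d eta) => //.
  rewrite (le_trans _ eta1P)// ler_wpM2r ?mulr_ge0 ?(ltW K0)//.
  by rewrite ge_min lexx.
Qed.

End LocalGraph.

Lemma convex_connected (R : realType) (V : normedModType R) (A : set V) :
  (forall x y t, A x -> A y -> 0 <= t <= 1 -> A (x + t *: (y - x))) -> connected A.
Proof.
move=> cA; have [->|/set0P[x Ax]] := eqVneq A set0; first exact: connected0.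
pose seg y : set V := (fun t => x + t *: (y - x)) @` `[0, 1].
rewrite (_ : A = \bigcup_(y in A) seg y); last first.
  apply/seteqP; split => [y Ay|z [y Ay [t t01 <-]]]; last exact: cA.
  exists y => //; exists 1; first by rewrite /= in_itv/= ler01 lexx.
  by rewrite scale1r addrC subrK.
apply: bigcup_connected.
  exists x => y Ay; exists 0; first by rewrite /= in_itv/= ler01 lexx.
  by rewrite scale0r addr0.
move=> y Ay; apply: connected_continuous_connected; first exact: segment_connected.
apply: continuous_subspaceT => t; apply: cvgD; first exact: cvg_cst.
by apply: cvgZr_tmp; exact: cvg_id.
Qed.

Section ZeroGraph.
Context {R : realType} {n : nat}.
Implicit Types (S : seq 'rV[R]_n) (c d : 'rV[R]_n -> R).
Implicit Types (a u v w x y p : 'rV[R]_n).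

Lemma crossing_zero S c v (e : R) x : 0 < e -> crossing S c v e x ->
  exists2 s, `|s| < e & expsum S c (x + s *: v) = 0.
Proof.
move=> e0 [xm xp incr].
have ee : - e <= e by rewrite (le_trans _ (ltW e0))// oppr_le0 ltW.
have [||s] := @IVT R (fun s => expsum S c (x + s *: v)) (- e) e 0 ee.
- by apply: continuous_subspaceT => s; exact: line_continuous.
- by rewrite scaleNr min_l ?max_r ?(ltW xm) ?(ltW xp)//; apply/ltW/(lt_trans xm).
rewrite in_itv/= => /andP[es se] s0; exists s => //.
rewrite ltr_norml !lt_neqAle es se !andbT; apply/andP; split.
  by apply: contraTneq xm => es'; rewrite -scaleNr es' s0 ltxx.
by apply: contraTneq xp => <-; rewrite s0 ltxx.
Qed.

(** [G] is the image of [D] under [x + phi x *: v], with [phi x] the unique zero on the segment, so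
    the point is the continuity of [phi]. The third clause, by which [G] catches every zero on these
    segments, later places given zeros in the component of the graph. *)
Lemma zero_graph_connected S c v (e : R) (D : set 'rV[R]_n) : 0 < e ->
  connected D -> (forall x, D x -> crossing S c v e x) ->
  exists G : set 'rV[R]_n, [/\ connected G, G `<=` expzeros S c,
    forall x s, D x -> `|s| <= e -> expsum S c (x + s *: v) = 0 -> G (x + s *: v)
    & forall x, D x -> exists2 s, `|s| < e & G (x + s *: v)].
Proof.
move=> e0 cD crD.
pose phi x := xget 0 [set s : R | `|s| < e /\ expsum S c (x + s *: v) = 0].
have phiP x : D x -> `|phi x| < e /\ expsum S c (x + phi x *: v) = 0.
  move=> /crD/(crossing_zero e0)[s se s0].
  by apply: (@xgetPex _ 0 [set s : R | `|s| < e /\ expsum S c (x + s *: v) = 0]); exists s.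
have phiU x s : D x -> `|s| <= e -> expsum S c (x + s *: v) = 0 -> s = phi x.
  move=> Dx; have [_ _ incr] := crD _ Dx; have [p1 p0] := phiP _ Dx.
  rewrite ler_norml => /andP[es se] s0.
  move: p1; rewrite ltr_norml => /andP[/ltW ep /ltW pe].
  have [sp|ps|//] := ltgtP s (phi x).
    by have := incr _ _ es sp pe; rewrite s0 p0 ltxx.
  by have := incr _ _ ep ps se; rewrite s0 p0 ltxx.
have cphi : {within D, continuous (fun x => x + phi x *: v)}.
  apply/subspace_continuousP => x Dx; apply: cvgD; first exact: cvg_within.
  apply: cvgZr_tmp; apply/cvgrPdist_le => eta eta0.
  have [p1 p0] := phiP _ Dx; have [_ _ incr] := crD _ Dx.
  (* The signs at [phi x - eta'] and [phi x + eta'] persist for [y] near [x] and trap [phi y] in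
     between; the second bound keeps both points inside the segment, where the sum increases. *)
  pose eta' := Num.min eta (e - `|phi x|).
  have eta'0 : 0 < eta' by rewrite lt_min eta0 subr_gt0.
  have eta'e : `|phi x| + eta' <= e by rewrite addrC -lerBrDr ge_min lexx orbT.
  have [pe1 pe2] : - e <= phi x - eta' /\ phi x + eta' <= e.
    move: eta'e; rewrite -lerBrDr ler_norml => /andP[h1 h2].
    by move: h1 h2; clear; split; lra.
  have pp : expsum S c (x + phi x *: v + eta' *: v) > 0.
    rewrite -p0 -addrA -scalerDl; by apply: incr; move: pe1 pe2 eta'0; clear; lra.
  have pm : 0 < - expsum S c (x + phi x *: v - eta' *: v).
    rewrite -[ltLHS]oppr0 ltrN2 -p0 -addrA -scalerBl; by apply: incr;
      move: pe1 pe2 eta'0; clear; lra.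
  rewrite -addrA in pp; rewrite -addrA in pm.
  have [r1 r10 h1] := continuous_gt_ball (@expsum_shift_continuous _ _ S c _) pp.
  have ctsN : continuous (fun y => - expsum S c (y + (phi x *: v - eta' *: v))).
    by move=> y; exact: (cvgN (@expsum_shift_continuous _ _ S c _ y)).
  have [r2 r20 h2] := continuous_gt_ball ctsN pm.
  rewrite /prop_near1/= nbhs_nearE near_withinE; near=> y => Dy.
  have [q1 q0] := phiP _ Dy; have [_ _ incry] := crD _ Dy.
  have {h1} : 0 < expsum S c (y + (phi x *: v + eta' *: v)).
    by apply: h1; rewrite distrC; near: y; exact: cvgr_dist_lt.
  have {h2} : 0 < - expsum S c (y + (phi x *: v - eta' *: v)).
    by apply: h2; rewrite distrC; near: y; exact: cvgr_dist_lt.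
  rewrite -scalerDl -scalerBl oppr_gt0 => ym yp.
  move: q1; rewrite ltr_norml => /andP[/ltW eq /ltW qe].
  have eta'_le : eta' <= eta by rewrite ge_min lexx.
  have ub : phi y <= phi x + eta'.
    have lo : - e <= phi x + eta' by move: pe1 eta'0; clear; lra.
    rewrite leNgt; apply/negP => lt; have := incry _ _ lo lt qe.
    by rewrite q0 => /(lt_trans yp); rewrite ltxx.
  have lb : phi x - eta' <= phi y.
    have hi : phi x - eta' <= e by move: pe2 eta'0; clear; lra.
    rewrite leNgt; apply/negP => lt; have := incry _ _ eq lt hi.
    by rewrite q0 => /lt_trans/(_ ym); rewrite ltxx.
  by move: ub lb eta'_le; rewrite ler_norml; clear; lra.
exists ((fun x => x + phi x *: v) @` D); split.
- exact: connected_continuous_connected.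
- by move=> _ [x Dx <-]; have [] := phiP _ Dx.
- by move=> x s Dx se s0; exists x => //; rewrite -(phiU x s).
- by move=> x Dx; exists (phi x); [have [] := phiP _ Dx|exists x].
Unshelve. all: by end_near. Qed.

(** A positive factor and a translation affect neither signs nor monotonicity: a crossing near [p]
    for normalized coefficients is a crossing of the original sum far away. *)
Lemma crossing_shift S c d v u (k e : R) x : 0 < k ->
  {in S, forall a, d a = k * (c a * expR (dot a u))} ->
  crossing S d v e x -> crossing S c v e (x + u).
Proof.
move=> k0 dE.
have E y : expsum S d y = k * expsum S c (y + u).
  by rewrite expsumD -expsumZ; exact: eq_expsum.
move=> [xm xp incr]; split.
- by move: xm; rewrite E pmulr_rlt0// addrAC.
- by move: xp; rewrite E pmulr_rgt0// addrAC.
move=> s t es st te; have := incr _ _ es st te.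
by rewrite !E ltr_pM2l// ![x + _ + u]addrAC.
Qed.

End ZeroGraph.

(** * Counting components, and logarithmic coordinates *)

Section Counting.
Context {R : realType}.
Local Open Scope ereal_scope.

(** With counts written as sums of ones, comparing sums along an injection compares numbers of
    components, infinite ones included. *)
Lemma counting_esum (T : choiceType) (A : set T) :
  @counting T R A = \esum_(x in A) 1.
Proof.
rewrite /counting; case: ifPn => /asboolP finA.
  rewrite esum_fset// fsbig_finite//= sumEFin; congr EFin.
  by rewrite big_const_seq count_predT iter_addr_0.
apply/esym/eqyP => M M0.
have [B BA Bm] := infinite_set_fset (Num.bound M) finA.
apply: esum_ge; exists [set` B]; first by split => //; exact: finite_fset.
rewrite fsbig_finite//= set_fsetK sumEFin lee_fin big_const_seq count_predT.
by rewrite iter_addr_0 (le_trans (ltW (archi_boundP (ltW M0))))// ler_nat.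
Qed.

Lemma le_esum_subset (T : choiceType) (P Q : set T) (a : T -> \bar R) :
  P `<=` Q -> \esum_(x in P) a x <= \esum_(x in Q) a x.
Proof.
move=> PQ; apply: ge_ereal_sup => _ [X [finX XP] <-].
by apply: ereal_sup_ubound; exists X => //; split => // x /XP/PQ.
Qed.

Lemma le_esum_inj (T U : choiceType) (P : set T) (Q : set U) (e : T -> U) a b :
  set_inj P e -> (forall x, P x -> Q (e x)) ->
  (forall x, P x -> a x <= b (e x)) ->
  \esum_(x in P) a x <= \esum_(y in Q) (b y : \bar R).
Proof.
move=> inj PQ ab; apply: (@le_trans _ _ (\esum_(y in e @` P) b y)).
  by rewrite esum_image//; apply: le_esum.
by apply: le_esum_subset => _ [x /PQ ? <-].
Qed.

Lemma le_counting_inj (T U : choiceType) (P : set T) (Q : set U) (e : T -> U) :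
  set_inj P e -> (forall x, P x -> Q (e x)) ->
  @counting T R P <= @counting U R Q.
Proof. by move=> inj PQ; rewrite !counting_esum; exact: (le_esum_inj inj). Qed.

Lemma counting_image (T U : choiceType) (P : set T) (e : T -> U) :
  set_inj P e -> @counting U R (e @` P) = @counting T R P.
Proof. by move=> inj; rewrite !counting_esum esum_image. Qed.

Lemma le_counting_esum (T U V : choiceType) (A : set T) (W : set U)
    (B : U -> set V) (e : T -> U * V) :
  set_inj A e -> (forall x, A x -> W (e x).1 /\ B (e x).1 (e x).2) ->
  @counting T R A <= \esum_(w in W) counting (B w).
Proof.
move=> inj AW; under [leRHS]eq_esum do rewrite counting_esum.
rewrite esum_esum// counting_esum.
by apply: (le_esum_inj inj).
Qed.

Lemma counting_le (T : choiceType) (A : set T) (m : nat) :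
  (forall s : seq T, uniq s -> (forall x, x \in s -> A x) -> (size s <= m)%N) ->
  @counting T R A <= m%:R%:E.
Proof.
move=> h; have finA : finite_set A.
  apply: contrapT => /(infinite_set_fset m.+1)[B BA].
  by apply/negP; rewrite -ltnNge ltnS h ?fset_uniq.
rewrite /counting asboolT// lee_fin ler_nat; apply: h; first exact: fset_uniq.
by move=> x; rewrite in_fset_set// inE.
Qed.

Lemma counting_ge (T : choiceType) (A : set T) (s : seq T) :
  uniq s -> (forall x, x \in s -> A x) -> (size s)%:R%:E <= @counting T R A.
Proof.
move=> us sA; rewrite /counting; case: ifPn => [/asboolP finA|_]; last exact: leey.
rewrite lee_fin ler_nat; apply: uniq_leq_size => // x /sA Ax.
by rewrite in_fset_set// inE.
Qed.

End Counting.

(** * Transport of components by homeomorphisms *)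

Section Homeo.
Context {T U : topologicalType}.
Variables (h : T -> U) (g : U -> T) (A : set T).
Hypothesis hK : forall x, A x -> g (h x) = x.
Hypothesis ch : {within A, continuous h}.
Hypothesis cg : {within h @` A, continuous g}.

Lemma homeo_component x : A x ->
  connected_component (h @` A) (h x) = h @` connected_component A x.
Proof.
move=> Ax; apply/seteqP; split; last first.
  apply: connected_component_max.
  - by exists x => //; exact: connected_component_refl.
  - by apply: image_subset; exact: connected_component_sub.
  apply: connected_continuous_connected; first exact: component_connected.
  by apply: continuous_subspaceW ch; exact: connected_component_sub.
set K := connected_component _ _.
have KA : K `<=` h @` A by exact: connected_component_sub.
have sub : g @` K `<=` connected_component A x.
  apply: connected_component_max.
  - exists (h x); last by rewrite hK.
    by apply: connected_component_refl; exists x.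
  - by move=> _ [y /KA[z Az <-] <-]; rewrite hK.
  apply: connected_continuous_connected; first exact: component_connected.
  exact: continuous_subspaceW cg.
move=> y Ky; have [z Az zy] := KA _ Ky; exists (g y); first by apply: sub; exists y.
by rewrite -zy hK.
Qed.

Lemma homeo_components : components (h @` A) = [set h @` C | C in components A].
Proof.
apply/seteqP; split => [_ [_ [x Ax <-] <-]|_ [_ [x Ax <-] <-]].
  by exists (connected_component A x); [exists x|rewrite homeo_component].
by exists (h x); [exists x|rewrite homeo_component].
Qed.

Lemma homeo_compact C : C `<=` A -> compact (h @` C) <-> compact C.
Proof.
move=> CA; split => cC; last first.
  by apply: continuous_compact => //; exact: continuous_subspaceW ch.
rewrite (_ : C = g @` (h @` C)).
  apply: continuous_compact => //; apply: continuous_subspaceW cg.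
  exact: image_subset.
apply/seteqP; split => [x Cx|_ [_ [x Cx <-] <-]]; last by rewrite hK//; exact: CA.
by exists (h x); [exists x|rewrite hK//; exact: CA].
Qed.

Lemma homeo_noncompact_components :
  noncompact_components (h @` A) = [set h @` C | C in noncompact_components A].
Proof.
apply/seteqP; split.
  move=> D [+ ncD]; rewrite homeo_components => -[C cC CD].
  exists C => //; split => // cptC; apply: ncD; rewrite -CD.
  by apply/homeo_compact => //; case: cC => x _ <-; exact: connected_component_sub.
move=> _ [C [cC ncC] <-]; split; first by rewrite homeo_components; exists C.
move/homeo_compact => h'; apply/ncC/h'.
by case: cC => x _ <-; exact: connected_component_sub.
Qed.

Lemma homeo_inj : set_inj (components A) (fun C => h @` C).
Proof.
have sub C D : components A C -> components A D -> h @` C = h @` D -> C `<=` D.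
  move=> [x _ <-] [y _ <-] e z Cz.
  have : (h @` connected_component A x) (h z) by exists z.
  rewrite e => -[t Dt /(congr1 g)].
  by rewrite !hK; [move=> <-|exact: connected_component_sub Cz|
    exact: connected_component_sub Dt].
move=> C D /set_mem cC /set_mem cD e; apply/seteqP; split; exact: sub.
Qed.

Lemma counting_components (R : realType) :
  @counting _ R (components (h @` A)) = counting (components A).
Proof. by rewrite homeo_components counting_image//; exact: homeo_inj. Qed.

Lemma counting_noncompact_components (R : realType) :
  @counting _ R (noncompact_components (h @` A)) = counting (noncompact_components A).
Proof.
rewrite homeo_noncompact_components counting_image//.
move=> C D /set_mem[cC _] /set_mem[cD _]; apply: homeo_inj; exact/mem_set.
Qed.

End Homeo.

Section LogCoordinates.
Context {R : realType} {n : nat}.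
Implicit Types (f : fewnomial R n) (a y : 'rV[R]_n).

Definition expm y : 'rV[R]_n := map_mx (@expR R) y.
Definition lnm y : 'rV[R]_n := map_mx (@ln R) y.

Lemma expmK : cancel expm lnm.
Proof. by move=> y; apply/rowP => i; rewrite !mxE expRK. Qed.

Lemma lnmK y : (forall i, 0 < y 0 i) -> expm (lnm y) = y.
Proof. by move=> y0; apply/rowP => i; rewrite !mxE lnK ?posrE. Qed.

Lemma monomial_expm a y : monomial a (expm y) = expR (dot a y).
Proof.
rewrite /monomial /dot expR_sum; apply: eq_bigr => i _.
by rewrite mxE -expRM mulrC.
Qed.

Definition logzeros f := expzeros (finsupp f) f.

Lemma eval_expm f y : eval_at f (expm y) = expsum (finsupp f) f y.
Proof. by apply: eq_bigr => a _; rewrite monomial_expm. Qed.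

Lemma pos_zerosE f : pos_zeros f = expm @` logzeros f.
Proof.
apply/seteqP; split => [x [x0 fx]|_ [y fy <-]].
  exists (lnm x); last exact: lnmK.
  by rewrite /logzeros /expzeros/= -eval_expm lnmK.
by split; [move=> i; rewrite mxE expR_gt0|rewrite eval_expm].
Qed.

Lemma map_mx_continuous (k : R -> R) y : (forall i, {for y 0 i, continuous k}) ->
  {for y, continuous (fun y : 'rV[R]_n => map_mx k y)}.
Proof.
move=> ck; apply: (iffRL (@cvgrPdist_lt _ _ _ (nbhs y) (nbhs_filter y) _ _)) => e e0.
have : \forall z \near y, forall j, `|k (y 0 j) - k ((z : 'rV[R]_n) 0 j)| < e.
  apply: (@filter_forall _ _ _ (nbhs y) (nbhs_filter y)) => j.
  have := ck j; rewrite /continuous_at => /cvgrPdist_lt/(_ _ e0).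
  exact: (@coord_continuous R 1 n 0 j y).
apply: filterS => z zy; rewrite [ltLHS]/Num.norm/= mx_normrE.
by apply/bigmax_ltP; split => // -[i j] _; rewrite !mxE [i]ord1.
Qed.

Lemma expm_continuous f : {within logzeros f, continuous expm}.
Proof.
apply: continuous_subspaceT => y; apply: map_mx_continuous => i.
exact: continuous_expR.
Qed.

Lemma lnm_continuous f : {within expm @` logzeros f, continuous lnm}.
Proof.
apply/subspace_continuousP => _ [y _ <-].
apply: cvg_within_filter; apply: map_mx_continuous => i.
by apply: continuous_ln; rewrite mxE expR_gt0.
Qed.

Lemma num_componentsE f : num_components f = counting (components (logzeros f)).
Proof.
rewrite /num_components pos_zerosE (counting_components (g := lnm))//.
- by move=> y _; exact: expmK.
- exact: expm_continuous.
- exact: lnm_continuous.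
Qed.

Lemma num_noncompact_componentsE f :
  num_noncompact_components f = counting (noncompact_components (logzeros f)).
Proof.
rewrite /num_noncompact_components pos_zerosE (counting_noncompact_components (g := lnm))//.
- by move=> y _; exact: expmK.
- exact: expm_continuous.
- exact: lnm_continuous.
Qed.

End LogCoordinates.

(** * Smoothness and initial forms in logarithmic coordinates *)

Section Gradient.
Context {R : realType} {n : nat}.
Implicit Types (f : fewnomial R n) (a v y : 'rV[R]_n).

Lemma derive_line (V : normedModType R) (f : V -> R) (x v : V) :
  'D_v f x = 'D_1 (fun h : R => f (x + h *: v)) 0.
Proof.
rewrite /derive; apply: (congr1 (fun k : R -> R => lim (k @ 0^'))); apply/funext => h /=.
by rewrite addr0 scale0r addr0 [h *: 1]mulr1 [h *: v + x]addrC.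
Qed.

(** Moving one positive coordinate moves one logarithmic coordinate; by the chain rule a partial
    derivative of [f] becomes a derivative of the exponential sum along a line. *)
Lemma expm_line y (i : 'I_n) (h : R) : 0 < expR (y 0 i) + h ->
  expm y + h *: delta_mx 0 i =
  expm (y + (ln (expR (y 0 i) + h) - y 0 i) *: delta_mx 0 i).
Proof.
move=> h0; apply/rowP => j; rewrite !mxE eqxx/=.
have [->|ji] := eqVneq j i; last by rewrite !mulr0 !addr0.
by rewrite !mulr1 [y 0 i + _]addrC subrK lnK ?posrE.
Qed.

Lemma gradient_expm f y (i : 'I_n) :
  gradient f (expm y) 0 i = expdir (finsupp f) f (delta_mx 0 i) y / expR (y 0 i).
Proof.
rewrite mxE derive_line.
have y0 := expR_gt0 (y 0 i).
pose tau h := ln (expR (y 0 i) + h) - y 0 i.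
have dtau : is_derive (0 : R) (1 : R) tau (expR (y 0 i))^-1.
  rewrite -[X in is_derive _ _ _ X]subr0; apply: is_deriveB.
  rewrite -[X in is_derive _ _ _ X]mulr1.
  apply: (@is_derive1_comp R (@ln R) (fun h => expR (y 0 i) + h)).
    by rewrite addr0; apply: is_derive1_ln.
  by rewrite -[X in is_derive _ _ _ X]add0r; apply: is_deriveD.
have tau0 : tau 0 = 0 by rewrite /tau addr0 expRK subrr.
have := is_derive_expsum_line (finsupp f) f y (delta_mx 0 i) (tau 0).
rewrite [in X in is_derive _ _ _ X]tau0 scale0r addr0 => dline.
have := is_derive1_comp dline dtau; rewrite -/(expdir _ _ _ _) => dc.
apply: derive_val; apply: near_eq_is_derive dc.
near=> h; rewrite /= expm_line ?eval_expm//.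
rewrite -ltrBlDl sub0r; near: h; apply: lt_nbhsr; rewrite oppr_lt0//.
Unshelve. all: by end_near. Qed.

Lemma smooth_expdir f y : smooth_zeros f -> logzeros f y ->
  exists v, 0 < expdir (finsupp f) f v y.
Proof.
move=> sm fy; have : gradient f (expm y) != 0.
  by apply: sm; rewrite pos_zerosE; exists y.
case/rV0Pn => i; rewrite gradient_expm mulf_eq0 negb_or => /andP[d0 _].
have [d1|d1] := ltP 0 (expdir (finsupp f) f (delta_mx 0 i) y).
  by exists (delta_mx 0 i).
exists (- delta_mx 0 i); rewrite (_ : expdir _ _ _ _ =
  - expdir (finsupp f) f (delta_mx 0 i) y); first by rewrite oppr_gt0 lt_neqAle d0.
rewrite -mulN1r -expsumZ; apply: eq_expsum => a _.
by rewrite dotNr mulN1r mulrN.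
Qed.

End Gradient.

Section InitialTerms.
Context {R : realType} {n : nat}.
Implicit Types (f : fewnomial R n) (a b v w x y p : 'rV[R]_n).

(** Extending the coefficients by zero makes [f] and its initial form sums over the same list, to be
    compared as perturbations of each other. *)
Definition initc f w a : R := if `[< face (supp f) w a >] then f a else 0.

Lemma face_supp f w a : face (supp f) w a -> a \in finsupp f.
Proof. by case. Qed.

Lemma init_termE f w a : init_term w f a = initc f w a.
Proof.
rewrite /init_term fsfun_ffun /initc; case: insubP => [u + eu|nPa] /=.
  by rewrite !inE eu => /andP[_ ->].
case: ifPn => // /asboolP fa; exfalso; move/negP: nPa; apply.
by rewrite !inE (face_supp fa); apply/asboolP.
Qed.

Lemma finsupp_init f w a :
  (a \in finsupp (init_term w f)) = `[< face (supp f) w a >].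
Proof.
rewrite mem_finsupp init_termE /initc; case: ifPn => [/asboolP/face_supp|];
  last by rewrite eqxx.
by rewrite mem_finsupp.
Qed.

(** The weight [g] covers the value, with [g = 1], and the derivative along [v], with
    [g a = dot a v]. *)
Lemma expsum_init f w (g : 'rV[R]_n -> R) x :
  expsum (finsupp (init_term w f)) (fun a => init_term w f a * g a) x =
  expsum (finsupp f) (fun a => initc f w a * g a) x.
Proof.
rewrite /expsum; under [LHS]eq_bigr do rewrite init_termE.
rewrite [RHS](bigID (mem (finsupp (init_term w f))))/= [X in _ + X]big1 ?addr0; last first.
  by move=> a; rewrite -[_ \in _]/(_ \in finsupp _) finsupp_init /initc => /negPf ->;
    rewrite !mul0r.
rewrite -[RHS]big_filter; apply: perm_big; apply: uniq_perm.
- exact: fset_uniq.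
- by rewrite filter_uniq// fset_uniq.
move=> a; rewrite mem_filter; apply/idP/idP => [afw|/andP[]//].
rewrite -[_ \in _]/(_ \in finsupp _) afw /=; move: afw.
by rewrite finsupp_init => /asboolP/face_supp.
Qed.

Lemma logzeros_init f w : logzeros (init_term w f) = expzeros (finsupp f) (initc f w).
Proof.
apply/funext => x; rewrite /logzeros /expzeros/=; congr (_ = _).
have := expsum_init f w (fun=> 1) x.
by rewrite /expsum; under eq_bigr do rewrite mulr1; under [RHS]eq_bigr do rewrite mulr1.
Qed.

Lemma smooth_init f w y : smooth_zeros (init_term w f) ->
  expsum (finsupp f) (initc f w) y = 0 -> exists v, 0 < expdir (finsupp f) (initc f w) v y.
Proof.
move=> sm fy; have [|v] := smooth_expdir sm (_ : logzeros _ y).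
  by rewrite logzeros_init.
by rewrite /expdir expsum_init; exists v.
Qed.

Lemma face_val f w a b : face (supp f) w a -> face (supp f) w b -> dot w a = dot w b.
Proof. by move=> [Sa ha] [Sb hb]; apply/eqP; rewrite eq_le ha ?hb. Qed.

Lemma face_exists f w : (exists a, a \in finsupp f) -> exists a, face (supp f) w a.
Proof.
move=> [a0 fa0]; pose a := [arg min_(b < [` fa0]%fset) dot w (val b)]%O.
exists (val a); split; first exact: fsvalP.
move=> b bf; rewrite /a; case: arg_minP => // c _ /(_ [` bf]%fset); exact.
Qed.

End InitialTerms.

(** * Faces and facets of the Newton polytope *)

Section AffineHull.
Context {R : realType} {n : nat}.
Implicit Types (A : set 'rV[R]_n) (S : seq 'rV[R]_n) (a b v w x y : 'rV[R]_n).

Lemma affine_hull_sub A B : affine_set B -> A `<=` B -> affine_hull A `<=` B.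
Proof. by move=> affB AB x; apply. Qed.

Lemma sub_affine_hull A : A `<=` affine_hull A.
Proof. by move=> x Ax B [_]; apply. Qed.

Lemma affine_hull_affine A : affine_set (affine_hull A).
Proof. by move=> x y t Ax Ay B [affB AB]; apply: (affB); [apply: (Ax B)|apply: (Ay B)]. Qed.

Lemma affine_set_sum A m a (d : 'I_m -> 'rV[R]_n) (k : 'I_m -> R) :
  affine_set A -> A a -> (forall i, A (a + d i)) -> A (a + \sum_i k i *: d i).
Proof.
move=> affA Aa Ad.
have scal t v : A (a + v) -> A (a + t *: v).
  move=> /(affA _ _ t Aa); congr (A _).
  by rewrite scalerDr addrA -scalerDl subrK scale1r.
have add u v : A (a + u) -> A (a + v) -> A (a + (u + v)).
  (* The midpoint of [a + u] and [a + v], scaled by two from [a]. *)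
  move=> Au Av; have := affA _ _ 2^-1 Au Av.
  rewrite (_ : (1 - _) *: _ + _ = a + 2^-1 *: (u + v)).
    by move/(scal 2 _); rewrite scalerA mulfV ?scale1r// pnatr_eq0.
  rewrite (_ : 1 - 2^-1 = 2^-1 :> R); last by lra.
  rewrite !scalerDr addrACA -scalerDl.
  by rewrite (_ : 2^-1 + 2^-1 = 1 :> R) ?scale1r//; lra.
elim/big_ind : _ => [|u v|i _]; [by rewrite addr0|exact: add|].
by apply: scal; exact: Ad.
Qed.

(* The double orthogonal complement of the directions of [S] is their span. *)
Lemma affine_hull_orth A S a x : A a -> (forall b, b \in S -> A b) ->
  (forall v, (forall b, b \in S -> dot v (b - a) = 0) -> dot v (x - a) = 0) ->
  affine_hull A x.
Proof.
move=> Aa SA orth.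
pose B := \matrix_(i < size S) (nth 0 S i - a).
have /submxP[D xD] : (x - a <= B)%MS.
  rewrite submxE; apply/eqP/rowP => j; rewrite [RHS]mxE.
  pose v : 'rV[R]_n := (col j (cokermx B))^T.
  have dotv y : dot v y = (y *m cokermx B) 0 j.
    by rewrite dotC dot_mulmx trmxK !mxE; apply: eq_bigr => k _; rewrite mxE.
  rewrite -dotv; apply: orth => b bS; rewrite dotv.
  have ltb : (index b S < size S)%N by rewrite index_mem.
  have -> : b - a = row (Ordinal ltb) B by rewrite rowK/= nth_index.
  by rewrite -row_mul mulmx_coker !mxE.
rewrite -(subrK a x) addrC xD mulmx_sum_row.
apply: affine_set_sum; [exact: affine_hull_affine|exact: sub_affine_hull|].
move=> i; rewrite rowK addrC subrK; apply: sub_affine_hull; apply: SA.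
by rewrite mem_nth.
Qed.

(** [U] meets the line of [w] only in zero, so [U + <[w]>] has one dimension more than [U]; when
    [\dim U = n.-1] it is the whole space. *)
Lemma dimv_orth w (U : {vspace 'rV[R]_n}) : w != 0 ->
  (forall u, u \in U -> dot w u = 0) -> (\dim U <= n.-1)%N /\
  (\dim U = n.-1 -> forall u, dot w u = 0 -> u \in U).
Proof.
move=> w0 Uw.
have disj : (U :&: <[w]> = 0)%VS.
  apply/eqP; rewrite -subv0; apply/subvP => x; rewrite memv_cap => /andP[/Uw xw].
  move=> /vlineP[k xk]; move: xw; rewrite xk dotZr => /eqP.
  by rewrite mulf_eq0 dot_eq0 (negPf w0) orbF => /eqP ->; rewrite scale0r mem0v.
have dimn : \dim {: 'rV[R]_n} = n by rewrite dimvf; exact: mul1n.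
have dimUw : \dim (U + <[w]>) = (\dim U).+1.
  by rewrite dimv_disjoint_sum// dim_vline w0 addn1.
have n0 : (0 < n)%N.
  by rewrite -dimn (leq_trans _ (dimvS (subvf <[w]>)))// dim_vline w0.
split.
  by rewrite -ltnS prednK// -dimUw -[leqRHS]dimn dimvS// subvf.
move=> dimU u wu; have : u \in (U + <[w]>)%VS.
  have /eqP -> : (U + <[w]> == fullv)%VS; last exact: memvf.
  by rewrite eqEdim subvf/= dimn dimUw dimU prednK.
case/memv_addP => x Ux [_ /vlineP[k ->] uE].
move: wu; rewrite uE dotDr Uw// add0r dotZr => /eqP.
by rewrite mulf_eq0 dot_eq0 (negPf w0) orbF => /eqP ->; rewrite scale0r addr0.
Qed.

End AffineHull.

Lemma seq_pos_lbound (R : realDomainType) (T : eqType) (s : seq T) (g : T -> R) :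
  (forall b, b \in s -> 0 < g b) -> exists2 k, 0 < k & forall b, b \in s -> k <= g b.
Proof.
elim: s => [_|a s IH h]; first by exists 1.
have [|k k0 kg] := IH; first by move=> b bs; rewrite h// inE bs orbT.
exists (Num.min (g a) k); first by rewrite lt_min k0 h// mem_head.
move=> b; rewrite inE => /orP[/eqP->|/kg]; rewrite ge_min ?lexx// => ->.
by rewrite orbT.
Qed.

Lemma seq_argmin (R : realDomainType) (T : eqType) (s : seq T) (g : T -> R) :
  (exists b, b \in s) -> exists2 b, b \in s & forall c, c \in s -> g b <= g c.
Proof.
elim: s => [[]//|a s IH _]; have [->|/IH[b bs bmin]] : s = [::] \/ exists b, b \in s.
- by case: s {IH} => [|b s]; [left|right; exists b; rewrite mem_head].
- by exists a; [exact: mem_head|move=> c; rewrite inE => /eqP ->].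
have [ab|ba] := leP (g a) (g b).
  exists a; first exact: mem_head.
  by move=> c; rewrite inE => /orP[/eqP ->//|/bmin]; exact: le_trans.
exists b; first by rewrite inE bs orbT.
by move=> c; rewrite inE => /orP[/eqP ->|/bmin//]; exact: ltW.
Qed.

Section Facets.
Context {R : realType} {n : nat}.
Implicit Types (f : fewnomial R n) (a b v w x y : 'rV[R]_n).

(** Full dimension in dual form, by linear forms constant on the support. [facet_dir] expresses
    codimension one in the same way, and no dimension has to be computed while faces are
    enlarged. *)
Definition spanning f := (exists a, a \in finsupp f) /\
  forall v, (forall a b, a \in finsupp f -> b \in finsupp f -> dot v a = dot v b) -> v = 0.

Definition facet_dir f w := forall v,
  (forall a b, face (supp f) w a -> face (supp f) w b -> dot v a = dot v b) ->
  exists k, v = k *: w.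

Lemma halfspace_convex w (h : R) :
  @convex_set R 'rV[R]_n [set x | h <= dot w x].
Proof.
move=> x y t; rewrite !inE/= => hx hy; rewrite /conv/= dotDr !dotZr.
have t0 : 0 <= t%:num by exact: ge0.
have t1 : 0 <= 1 - t%:num by rewrite subr_ge0; exact: le1.
rewrite -[h](_ : t%:num * h + (1 - t%:num) * h = _); last by ring.
by rewrite lerD// ler_wpM2l.
Qed.

Lemma newton_halfspace f w (h : R) : (forall a, a \in finsupp f -> h <= dot w a) ->
  forall x, newton f x -> h <= dot w x.
Proof. by move=> hf x /(_ [set x | h <= dot w x]); apply; split => //;
  exact: halfspace_convex. Qed.

Lemma supp_newton f a : a \in finsupp f -> newton f a.
Proof. by move=> fa B [_]; apply. Qed.

Lemma face_newton_supp f w a : a \in finsupp f ->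
  face (newton f) w a <-> face (supp f) w a.
Proof.
move=> fa; split => -[_ h]; split => //.
- by move=> b fb; apply: h; exact: supp_newton.
- exact: supp_newton.
- exact: newton_halfspace.
Qed.

Lemma newton_supp f x : newton f x -> exists a, a \in finsupp f.
Proof.
move=> fx; apply: contrapT => f0.
apply: (fx set0); split => [? ? ?|a fa]; first by rewrite inE.
by apply: f0; exists a.
Qed.

(* Perturbing [w] by small multiples of [v] in both directions. *)
Lemma face_newton_const f w v c : (forall a, face (supp f) w a -> dot v a = c) ->
  forall x, face (newton f) w x -> dot v x = c.
Proof.
move=> vc x [fx wx].
have [a [fa wa]] := face_exists w (newton_supp fx).
have xw : dot w x = dot w a.
  by apply/eqP; rewrite eq_le wx ?(newton_halfspace wa)//; exact: supp_newton.
have key v' c' : (forall a, face (supp f) w a -> dot v' a = c') -> c' <= dot v' x.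
  move=> vc'.
  have [k k0 hk] : exists2 k : R, 0 < k & forall b, b \in finsupp f ->
      dot w a + k * c' <= dot w b + k * dot v' b.
    pose gap b := (dot w b - dot w a) / (`|dot v' b - c'| + 1).
    have gap0 b : 0 < `|dot v' b - c'| + 1 by rewrite ltr_wpDl.
    have [k k0 kg] : exists2 k, 0 < k &
        forall b, b \in [seq b <- finsupp f | dot w a < dot w b] -> k <= gap b.
      apply: seq_pos_lbound => b; rewrite mem_filter => /andP[ab _].
      by rewrite divr_gt0// subr_gt0.
    exists k => // b fb; have := wa _ fb; rewrite le_eqVlt => /orP[/eqP e|ab].
      by rewrite e vc'// ; split => // b' fb'; rewrite -e wa.
    have := kg b; rewrite mem_filter ab fb => /(_ isT) {kg}.
    rewrite ler_pdivlMr// mulrDr mulr1 => kg.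
    have : k * (c' - dot v' b) <= k * `|dot v' b - c'|.
      by rewrite ler_wpM2l ?(ltW k0)// distrC ler_norm.
    move: kg k0; clear; rewrite mulrBr; lra.
  have := @newton_halfspace f (w + k *: v') (dot w a + k * c') _ x fx.
  rewrite dotDl dotZl xw lerD2l ler_pM2l//; apply => b fb.
  by rewrite dotDl dotZl hk.
apply/eqP; rewrite eq_le key// andbT -lerN2 -dotNl key// => b /vc.
by rewrite dotNl => ->.
Qed.

Lemma affine_hull_exists (A : set 'rV[R]_n) x : affine_hull A x -> exists y, A y.
Proof.
move=> Ax; apply: contrapT => A0; apply: (Ax set0); split; first by move=> ? ? ? [].
by move=> y Ay; apply: A0; exists y.
Qed.

Lemma has_dim_spanning f : has_dim (newton f) n -> spanning f.
Proof.
move=> [x0 [U [hull dimU]]].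
have f0 : exists a, a \in finsupp f.
  have [|y /newton_supp//] := @affine_hull_exists (newton f) x0.
  by rewrite hull; exists 0; rewrite ?addr0//= mem0v.
split=> // v vc; apply/eqP; rewrite -dot_eq0; have [a fa] := f0.
have full : U = fullv.
  apply/eqP; rewrite eqEdim subvf dimU dimvf; exact: eq_leq (mul1n _).
have hullT x : affine_hull (newton f) x.
  rewrite hull; exists (x - x0); rewrite /= ?full ?memvf//.
  by rewrite addrC subrK.
have vconst x : dot v x = dot v a.
  apply: (affine_hull_sub (B := [set x | dot v x = dot v a]) _ _ (hullT x)) => [y z t|y fy] /=.
    by rewrite dotDr !dotZr => -> ->; ring.
  apply/eqP; rewrite eq_le; apply/andP; split.
    rewrite -lerN2 -!dotNl; apply: newton_halfspace fy => b fb.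
    by rewrite !dotNl lerN2 (vc a b).
  by apply: newton_halfspace fy => b fb; rewrite (vc a b).
by rewrite (vconst v) -(vconst 0) dot0r.
Qed.

(** The direction [U] of the facet is orthogonal to [w] and has dimension [n.-1], so it is the whole
    orthogonal complement. A form [v] constant on the facet vanishes on [U], so its part [z]
    orthogonal to [w] is orthogonal to itself. *)
Lemma unit_facet_dir f w : unit_facet_normal (newton f) w -> facet_dir f w.
Proof.
move=> [w1 [_ [x0 [U [hull dimU]]]]] v vc.
have w0 : w != 0 by rewrite -dot_eq0 w1 oner_eq0.
have const z c : (forall x, face (newton f) w x -> dot z x = c) ->
    forall u, u \in U -> dot z u = 0.
  move=> zc u Uu.
  have zhull x : affine_hull (face (newton f) w) x -> dot z x = c.
    apply: (affine_hull_sub (B := [set x | dot z x = c])) => [y y' t|]//=.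
    by rewrite dotDr !dotZr => -> ->; ring.
  have := zhull (x0 + u); rewrite hull dotDr.
  have -> : dot z x0 = c.
    by apply: zhull; rewrite hull; exists 0; rewrite ?addr0//= mem0v.
  by move=> /(_ _)/(canRL (addKr _))->; [rewrite addNr|exists u].
have [a wa] : exists a, face (supp f) w a.
  apply: face_exists; have [|y [/newton_supp//]] := @affine_hull_exists (face (newton f) w) x0.
  by rewrite hull; exists 0; rewrite ?addr0//= mem0v.
have Uw : forall u, u \in U -> dot w u = 0.
  apply: (const w (dot w a)); apply: face_newton_const => b wb; exact: face_val wb wa.
have Uv : forall u, u \in U -> dot v u = 0.
  by apply: (const v (dot v a)); apply: face_newton_const => b wb; exact: vc.
have [_ /(_ dimU) Uorth] := dimv_orth w0 Uw.
exists (dot v w); apply/eqP; rewrite -subr_eq0 -dot_eq0.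
set z := v - _; have wz : dot w z = 0 by rewrite /z dotBr dotZr w1 mulr1 dotC subrr.
by rewrite {1}/z dotBl dotZl wz mulr0 subr0 Uv// Uorth.
Qed.

Lemma facet_dir_unit f w : dot w w = 1 -> (exists a, a \in finsupp f) ->
  facet_dir f w -> unit_facet_normal (newton f) w.
Proof.
move=> w1 f0 fw; split => //; split; first by exists w.
have w0 : w != 0 by rewrite -dot_eq0 w1 oner_eq0.
have [a wa] := face_exists w f0.
(* The direction of the hull is the kernel of [dot w], with dimension given by the rank formula;
   that the hull fills it follows from [fw] by double orthogonality. *)
pose phi := linfun (mulmxr w^T : 'rV[R]_n -> 'rV[R]_1).
have memU u : (u \in lker phi) = (dot w u == 0).
  rewrite memv_ker lfunE/= dotC dot_mulmx; apply/eqP/eqP => [->|h]; first by rewrite mxE.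
  by apply/rowP => i; rewrite [i]ord1 h mxE.
have [|dimle _] := @dimv_orth _ _ w (lker phi) w0.
  by move=> u; rewrite memU => /eqP.
exists a, (lker phi); split; last first.
  apply/eqP; rewrite eqn_leq dimle/=.
  have := limg_ker_dim phi fullv; rewrite capfv => /esym dimE.
  have : (\dim (phi @: fullv) <= 1)%N.
    by rewrite (leq_trans (dimvS (subvf _)))// dimvf.
  move: dimE; rewrite [X in X = _]dimvf [X in X = _]mul1n => dimE im1.
  by rewrite -subn1 leq_subLR addnC (leq_trans (eq_leq dimE))// leq_add2l.
apply/seteqP; split => [x|_ [u + <-]].
  move=> hx; exists (x - a); last by rewrite addrC subrK.
  rewrite /= memU dotBr subr_eq0; apply/eqP; move: x hx.
  apply: (affine_hull_sub (B := [set x | dot w x = dot w a])) => [y z t|] /=.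
    by rewrite dotDr !dotZr => -> ->; ring.
  by apply: face_newton_const => b wb; exact: face_val wb wa.
rewrite /= memU => /eqP wu.
apply: (@affine_hull_orth _ _ _ [seq b <- finsupp f | `[< face (supp f) w b >]] a).
- by apply/face_newton_supp; [exact: face_supp wa|].
- move=> b; rewrite mem_filter => /andP[/asboolP wb _].
  by apply/face_newton_supp; [exact: face_supp wb|].
move=> v orth; have eqa b : face (supp f) w b -> dot v b = dot v a.
  move=> wb; apply/eqP; rewrite -subr_eq0 -dotBr orth// mem_filter.
  by rewrite (face_supp wb) andbT; apply/asboolP.
have [|k ->] := fw v; first by move=> b c /eqa -> /eqa ->.
by rewrite addrC addKr dotZl wu mulr0.
Qed.

(** Turns a sum over normals into a sum over facets. Unit normals of one facet are proportional, so
    equal or opposite; opposite ones would make [w1] constant on the support. *)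
Lemma facet_inj f : spanning f ->
  set_inj (unit_facet_normal (newton f)) (face (newton f)).
Proof.
move=> [f0 sp] w1 w2 /set_mem u1 /set_mem u2 e.
have [w11 _] := u1; have [w21 _] := u2.
have e' a : face (supp f) w1 a <-> face (supp f) w2 a.
  split=> h; have fa := face_supp h.
    by apply/face_newton_supp => //; rewrite -e; apply/face_newton_supp.
  by apply/face_newton_supp => //; rewrite e; apply/face_newton_supp.
have [|k wk] := unit_facet_dir u1 (v := w2).
  by move=> a b /e' ha /e' hb; exact: face_val ha hb.
have : k ^+ 2 = 1 by move: w21; rewrite wk dotZl dotZr w11 mulr1.
move=> /eqP; rewrite sqrf_eq1 => /orP[/eqP k1|/eqP k1]; first by rewrite wk k1 scale1r.
have [a [fa ha]] := face_exists w1 f0.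
have [_ hb] : face (supp f) w2 a by apply/e'; split.
suff w10 : w1 = 0 by move: w11; rewrite w10 dot0l => /eqP; rewrite eq_sym oner_eq0.
have const b : b \in finsupp f -> dot w1 b = dot w1 a.
  move=> fb; apply/eqP; rewrite eq_le ha// andbT.
  by have := hb _ fb; rewrite wk k1 scaleN1r !dotNl lerN2.
by apply: sp => b c fb fc; rewrite !const.
Qed.

Lemma face_scale f w (k : R) : 0 < k -> face (supp f) (k *: w) = face (supp f) w.
Proof.
move=> k0; apply/seteqP; split => a [fa h]; split => // b fb; have := h b fb;
  by rewrite !dotZl ler_pM2l.
Qed.

(** Tilting: [v] is constant on the face but no multiple of [w], and [w + k *: v] is followed from
    [k = 0] until the face gains a point. The stopping value is the least ratio [g b], at which [b]
    comes level with the face. *)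
Lemma face_enlarge f w : spanning f -> w != 0 -> ~ facet_dir f w ->
  exists u b, [/\ u != 0, face (supp f) w `<=` face (supp f) u,
    face (supp f) u b & ~ face (supp f) w b].
Proof.
move=> [f0 sp] w0 /existsNP[v /not_implyP[vc nvw]].
have [a wa] := face_exists w f0.
(* The tilt stops only if some support point comes down. One of [v] and [- v] has such a point,
   since otherwise [v] is constant on the support, hence zero. *)
wlog [b0 [fb0 vb0]] : v vc nvw / exists b, b \in finsupp f /\ dot v b < dot v a.
  move=> wl; have [[b [fb vb]]|nb] := pselect (exists b, b \in finsupp f /\ dot v b < dot v a).
    by apply: (wl v) => //; exists b.
  have [[b [fb vb]]|nb'] := pselect (exists b, b \in finsupp f /\ dot v a < dot v b).
    apply: (wl (- v)); first by move=> c d wc wd; rewrite !dotNl (vc c d).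
      by move=> [k vk]; apply: nvw; exists (- k); rewrite scaleNr -vk opprK.
    by exists b; rewrite !dotNl ltrN2.
  case: nvw; exists 0; rewrite scale0r; apply: sp.
  have va b : b \in finsupp f -> dot v b = dot v a.
    by move=> fb; apply/eqP; rewrite eq_le !leNgt; apply/andP; split;
      apply/negP => h; [apply: nb'|apply: nb]; exists b.
  by move=> b c /va -> /va ->.
pose s := [seq b <- finsupp f | dot v b < dot v a].
have sP b : b \in s -> b \in finsupp f /\ dot v b < dot v a.
  by rewrite mem_filter => /andP[].
pose g b := (dot w b - dot w a) / (dot v a - dot v b).
have [b bs bmin] : exists2 b, b \in s & forall c, c \in s -> g b <= g c.
  by apply: seq_argmin; exists b0; rewrite mem_filter vb0.
have [fb vb] := sP _ bs.
have nwb : ~ face (supp f) w b by move=> /(vc _ _ wa) e; rewrite e ltxx in vb.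
have wab : dot w a < dot w b.
  rewrite lt_neqAle (proj2 wa)// andbT; apply/eqP => e; apply: nwb.
  by split => // c fc; rewrite -e; exact: (proj2 wa).
have g0 : 0 < g b by rewrite divr_gt0// subr_gt0.
have ub c : c \in finsupp f -> dot (w + g b *: v) a <= dot (w + g b *: v) c.
  move=> fc; rewrite !dotDl !dotZl; have wac := proj2 wa _ fc.
  have [vca|vac] := ltP (dot v c) (dot v a); last first.
    by rewrite lerD// ler_pM2l.
  have := bmin c; rewrite mem_filter vca fc => /(_ isT).
  rewrite [leRHS]/g ler_pdivlMr ?subr_gt0// mulrBr; clear; lra.
have ua c : c \in finsupp f -> dot (w + g b *: v) c = dot (w + g b *: v) a ->
    face (supp f) (w + g b *: v) c.
  by move=> fc e; split => // d fd; rewrite e ub.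
exists (w + g b *: v), b; split => //.
- apply/eqP => uw0; apply: nvw; exists (- (g b)^-1).
  have /(congr1 (fun x => (g b)^-1 *: x)) := uw0.
  rewrite scalerDr scalerA mulVf ?gt_eqF// scale1r scaler0 => /eqP.
  by rewrite addrC addr_eq0 scaleNr => /eqP.
- move=> c wc; apply: ua; first exact: face_supp wc.
  by rewrite !dotDl !dotZl (face_val wc wa) (vc _ _ wc wa).
- apply: ua => //; rewrite !dotDl !dotZl.
  have : g b * (dot v a - dot v b) = dot w b - dot w a.
    by rewrite /g divfK// gt_eqF// subr_gt0.
  by rewrite mulrBr; clear; lra.
Qed.

(** Each enlargement lowers the number of support points off the face; the final normal is rescaled
    to Euclidean length one. *)
Lemma facet_above f w : spanning f -> w != 0 ->
  exists u, [/\ dot u u = 1, facet_dir f u & face (supp f) w `<=` face (supp f) u].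
Proof.
move=> sp; have [m] := ubnP (count (fun b => ~~ `[< face (supp f) w b >]) (finsupp f)).
elim: m w => // m IH w wm w0.
have [fw|nfw] := pselect (facet_dir f w).
  have s0 : 0 < Num.sqrt (dot w w) by rewrite sqrtr_gt0 dot_gt0.
  exists ((Num.sqrt (dot w w))^-1 *: w); split.
  - rewrite dotZl dotZr mulrA -expr2 exprVn sqr_sqrtr ?dot_ge0//.
    by rewrite mulVf// dot_eq0.
  - move=> v; rewrite face_scale ?invr_gt0// => /fw[k ->].
    by exists (k * Num.sqrt (dot w w)); rewrite scalerA mulfK// gt_eqF.
  - by rewrite face_scale ?invr_gt0.
have [u [b [u0 wu ub nwb]]] := face_enlarge sp w0 nfw.
have [|u' [u1 fu' uu']] := IH u _ u0; last by exists u'; split => // a /wu/uu'.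
rewrite ltnS in wm; apply: leq_trans wm.
rewrite -!size_filter -(@size_rcons _ _ b); apply: uniq_leq_size.
  rewrite rcons_uniq filter_uniq ?fset_uniq// andbT mem_filter negb_and negbK.
  by apply/orP; left; apply/asboolP.
move=> c; rewrite mem_rcons inE !mem_filter => /orP[/eqP ->|/andP[nc ->]].
  by rewrite (face_supp ub) andbT; apply/negP => /asboolP.
by rewrite andbT; apply: contraNN nc => /asboolP/wu ?; apply/asboolP.
Qed.

End Facets.

(** * Components attached to zeros of initial forms *)

Lemma components_eq (T : topologicalType) (A C D : set T) x :
  components A C -> components A D -> C x -> D x -> C = D.
Proof.
move=> [y _ <-] [z _ <-] Cx Dx.
by rewrite (same_connected_component Cx) (same_connected_component Dx).
Qed.

Lemma component_sub (T : topologicalType) (A C : set T) : components A C -> C `<=` A.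
Proof. by move=> [x _ <-]; exact: connected_component_sub. Qed.

Lemma component_max (T : topologicalType) (A C G : set T) x :
  components A C -> C x -> G x -> connected G -> G `<=` A -> G `<=` C.
Proof.
move=> [y _ <-] Cx Gx cG GA; rewrite (same_connected_component Cx).
exact: connected_component_max.
Qed.

Lemma connected_locally_constant (R : realType) (V : normedModType R) (K P : set V) :
  connected K ->
  (forall p, K p -> exists2 r, 0 < r & forall q, K q -> `|q - p| < r -> (P p <-> P q)) ->
  forall p q, K p -> K q -> P p -> P q.
Proof.
move=> cK loc p q Kp Kq Pp.
pose U (Q : set V) := \bigcup_(z in [set z : V * R | [/\ K z.1, Q z.1, 0 < z.2 &
  forall q, K q -> `|q - z.1| < z.2 -> (P z.1 <-> P q)]]) ball z.1 z.2.
have oU Q : open (U Q) by apply: bigcup_open => z _; exact: ball_open.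
have inU Q z : K z -> Q z -> U Q z.
  move=> Kz Qz; have [r r0 h] := loc _ Kz; exists (z, r) => //.
  exact: ballxx.
have KU z : K z -> U P z -> P z.
  move=> Kz [[p' r] [/= _ Pp' _ h]]; rewrite -ball_normE/= distrC => zp.
  exact/(h z).
have KU' z : K z -> U (~` P) z -> ~ P z.
  by move=> Kz [[p' r] [/= _ Pp' _ h]]; rewrite -ball_normE/= distrC => zp /(h z Kz zp).
have : K `&` P = K.
  apply: cK; first by exists p.
  - exists (U P) => //; apply/seteqP; split => z [Kz]; first by move=> Pz; split => //;
      exact: inU.
    by move/(KU _ Kz).
  exists (~` U (~` P)); first exact: open_closedC.
  apply/seteqP; split => z [Kz].
    by move=> Pz; split => // /(KU' _ Kz).
  by move=> nU; split => //; apply: contrapT => nP; apply: nU; exact: inU.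
by move=> KP; have [] : (K `&` P) q by rewrite KP.
Qed.

Section Attached.
Context {R : realType} {n : nat}.
Variable f : fewnomial R n.
Implicit Types (a b u v w x y p q : 'rV[R]_n) (C : set 'rV[R]_n) (t : R).

Local Notation S := (finsupp f).
Local Notation initsum w := (expsum (finsupp f) (initc f w)).

(** As [L <= expR L], smallness follows from a condition linear in the gap [L], which is easy to
    maintain under translations. *)
Lemma exp_decay (k eta L : R) : 0 < eta -> `|k| <= eta * L -> `|k * expR (- L)| <= eta.
Proof.
move=> eta0 kL; rewrite normrM (ger0_norm (expR_ge0 _)) expRN ler_pdivrMr ?expR_gt0//.
rewrite (le_trans kL)// ler_wpM2l ?(ltW eta0)//.
by rewrite (le_trans _ (expR_ge1Dx _))// lerDr ler01.
Qed.

(** The factor restores the coefficients on the face while the other terms decay. The translation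
    [u] may be other than a multiple of [w]: it is [t *: w] along a ray, and [u y + t *: w'] when a
    component is followed towards a facet. *)
Lemma initc_perturb w u a0 (eta : R) : 0 < eta -> face (supp f) w a0 ->
  (forall a, face (supp f) w a -> dot u a = dot u a0) ->
  (forall a, a \in S -> ~ face (supp f) w a -> `|f a| <= eta * (dot u a - dot u a0)) ->
  forall a, a \in S ->
  `|expR (dot u a0) * (f a * expR (dot a (- u))) - initc f w a| <= eta.
Proof.
move=> eta0 wa0 ueq ugap a fa; rewrite mulrCA -expRD dotNr (dotC a u).
rewrite (_ : dot u a0 - dot u a = - (dot u a - dot u a0)); last by rewrite opprB.
rewrite /initc; case: asboolP => wa.
  by rewrite (ueq _ wa) subrr oppr0 expR0 mulr1 subrr normr0 ltW.
by rewrite subr0; apply: exp_decay => //; exact: ugap.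
Qed.

Lemma init_crossing w p v (e0 : R) :
  initsum w p = 0 -> 0 < expdir S (initc f w) v p -> 0 < e0 ->
  exists e r eta : R, [/\ 0 < e <= e0, 0 < r, 0 < eta &
    forall u a0 x, face (supp f) w a0 ->
      (forall a, face (supp f) w a -> dot u a = dot u a0) ->
      (forall a, a \in S -> ~ face (supp f) w a ->
         `|f a| <= eta * (dot u a - dot u a0)) ->
      `|x - p| <= r -> crossing S f v e (x - u)].
Proof.
move=> p0 D0 e00; have [e [r [eta [ee0 r0 eta0 h]]]] := local_graph p0 D0 e00.
exists e, r, eta; split => // u a0 x wa0 ueq ugap xr.
apply: (@crossing_shift _ _ S f (fun a => expR (dot u a0) * (f a * expR (dot a (- u))))
   v (- u) (expR (dot u a0))) => //; first exact: expR_gt0.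
by apply: h => // a fa; apply: initc_perturb.
Qed.

Lemma gap_threshold w a0 (eta : R) : face (supp f) w a0 -> 0 < eta ->
  exists2 T, 0 < T & forall t, T <= t -> forall a, a \in S -> ~ face (supp f) w a ->
    `|f a| <= eta * (dot (t *: w) a - dot (t *: w) a0).
Proof.
move=> wa0 eta0.
have [|k k0 hk] := @seq_pos_lbound _ _ [seq a <- S | ~~ `[< face (supp f) w a >]]
    (fun a => eta * (dot w a - dot w a0) / (`|f a| + 1)).
  move=> a; rewrite mem_filter => /andP[/asboolP nwa fa].
  apply: divr_gt0; last by rewrite ltr_wpDl.
  apply: mulr_gt0 => //; rewrite subr_gt0 lt_neqAle (proj2 wa0)// andbT.
  apply/eqP => e; apply: nwa; split => // b fb; rewrite -e; exact: (proj2 wa0).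
exists k^-1; first by rewrite invr_gt0.
move=> t kt a fa nwa.
have t0 : 0 < t by rewrite (lt_le_trans _ kt)// invr_gt0.
have : k <= eta * (dot w a - dot w a0) / (`|f a| + 1).
  by apply: hk; rewrite mem_filter fa andbT; apply/asboolP.
rewrite ler_pdivlMr ?ltr_wpDl// !dotZl -mulrBr mulrCA => h.
rewrite (@le_trans _ _ (`|f a| + 1)) ?lerDl//.
rewrite (@le_trans _ _ (t * (k * (`|f a| + 1))))//; last by rewrite ler_pM2l.
by rewrite mulrA ler_peMl ?addr_ge0// -ler_pdivrMr// div1r.
Qed.

(** A half-cylinder around a ray, convex and hence connected. For [w = 0] it is a closed ball. *)
Definition tube p w (r T : R) : set 'rV[R]_n :=
  [set y | exists x t, [/\ `|x - p| <= r, T <= t & y = x - t *: w]].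

Lemma tube_connected p w (r T : R) : connected (tube p w r T).
Proof.
apply: convex_connected => _ _ s [x [t [xr Tt ->]]] [x' [t' [xr' Tt' ->]]] /andP[s0 s1].
have s1' : 0 <= 1 - s by rewrite subr_ge0.
exists (x + s *: (x' - x)), (t + s * (t' - t)); split.
- rewrite (_ : _ - p = (1 - s) *: (x - p) + s *: (x' - p)); last first.
    by apply/rowP => i; rewrite !mxE; ring.
  rewrite (le_trans (ler_normD _ _))// !normrZ !ger0_norm//.
  rewrite -[leRHS](_ : (1 - s) * r + s * r = _); last by ring.
  by rewrite lerD// ler_wpM2l.
- rewrite -[leLHS](_ : (1 - s) * T + s * T = _); last by ring.
  rewrite (_ : t + _ = (1 - s) * t + s * t'); last by ring.
  by rewrite lerD// ler_wpM2l.
- by apply/rowP => i; rewrite !mxE; ring.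
Qed.

Lemma tube_crossing w p v (e0 : R) : w != 0 -> (exists a, a \in S) ->
  initsum w p = 0 -> 0 < expdir S (initc f w) v p -> 0 < e0 ->
  exists e r T : R, [/\ 0 < e <= e0, 0 < r &
    forall y, tube p w r T y -> crossing S f v e y].
Proof.
move=> w0 f0 p0 D0 e00; have [e [r [eta [ee0 r0 eta0 h]]]] := init_crossing p0 D0 e00.
have [a0 wa0] := face_exists w f0.
have [T T0 hT] := gap_threshold wa0 eta0.
exists e, r, T; split => // _ [x [t [xr Tt ->]]].
apply: (h _ a0) => //; last exact: hT.
by move=> a wa; rewrite !dotZl (face_val wa wa0).
Qed.

(** Accumulation along the ray is all that is asked, since compactness provides it; as the zeros in
    a thin tube belong to one component, it already determines [C]. *)
Definition attached C w p := forall r T : R, 0 < r ->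
  exists x t, [/\ `|x - p| < r, T <= t & C (x - t *: w)].

(** The tube carries a single connected graph. The third clause yields uniqueness of the attached
    component, the fourth its local constancy in [p]. *)
Lemma attach_exists w p : w != 0 -> (exists a, a \in S) ->
  smooth_zeros (init_term w f) -> initsum w p = 0 ->
  exists r T C, [/\ 0 < r, components (logzeros f) C,
    forall y, tube p w r T y -> logzeros f y -> C y &
    forall p', initsum w p' = 0 -> `|p' - p| < r -> attached C w p'].
Proof.
move=> w0 f0 sm p0.
have [v v0] := smooth_init sm p0.
have [e [r [T [/andP[e0 _] r0 cr]]]] := tube_crossing w0 f0 p0 v0 ltr01.
have [G [cG GZ Gz Gex]] := zero_graph_connected e0 (@tube_connected p w r T) cr.
have [s se Gs] : exists2 s, `|s| < e & G (p - T *: w + s *: v).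
  by apply: Gex; exists p, T; rewrite subrr normr0 (ltW r0).
pose C := connected_component (logzeros f) (p - T *: w + s *: v).
have cC : components (logzeros f) C by exists (p - T *: w + s *: v) => //; exact: GZ.
have GC : G `<=` C by exact: connected_component_max.
have tubeC y : tube p w r T y -> logzeros f y -> C y.
  move=> ty zy; apply: GC; have := Gz y 0 ty; rewrite scale0r addr0 normr0.
  by apply => //; exact: ltW.
exists r, T, C; split => // p' p'0 p'r r2 T2 r20.
have [v' v'0] := smooth_init sm p'0.
(* The zero found over [p'] is less than [d] away from the ray of [p']: within [r2] of it, as
   attachment asks, and still within [r] of the ray of [p]. *)
pose d := Num.min r2 (r - `|p' - p|).
have d0 : 0 < d by rewrite lt_min r20 subr_gt0.
have v1 : 0 < `|v'| + 1 by rewrite ltr_wpDl.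
have [e' [r' [T' [/andP[e'0 e'd] r'0 cr']]]] := tube_crossing w0 f0 p'0 v'0 (divr_gt0 d0 v1).
pose t := Num.max (Num.max T T') T2.
have [s' s'e z'] : exists2 s, `|s| < e' & logzeros f (p' - t *: w + s *: v').
  have [|s'] := crossing_zero e'0 (cr' (p' - t *: w) _); last by exists s'.
  by exists p', t; rewrite subrr normr0 (ltW r'0); split=> //; rewrite !le_max lexx orbT.
have sd : `|s' *: v'| < d.
  rewrite normrZ (@le_lt_trans _ _ (e' * `|v'|))//; first by rewrite ler_wpM2r// ltW.
  rewrite (@lt_le_trans _ _ (e' * (`|v'| + 1)))//; first by rewrite ltr_pM2l// ltrDl.
  by rewrite -ler_pdivlMr.
exists (p' + s' *: v'), t; split.
- by rewrite addrAC subrr add0r (lt_le_trans sd)// ge_min lexx.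
- by rewrite le_max lexx orbT.
rewrite addrAC; apply: tubeC => //; exists (p' + s' *: v'), t; split.
- rewrite addrAC (le_trans (ler_normD _ _))// -lerBrDl ltW// (lt_le_trans sd)//.
  by rewrite ge_min lexx orbT.
- by rewrite !le_max lexx.
- by rewrite addrAC.
Qed.

Lemma attached_unique w p C C' : w != 0 -> (exists a, a \in S) ->
  smooth_zeros (init_term w f) -> initsum w p = 0 ->
  components (logzeros f) C -> components (logzeros f) C' ->
  attached C w p -> attached C' w p -> C = C'.
Proof.
move=> w0 f0 sm p0 cC cC' aC aC'.
have [r [T [D [r0 cD tD _]]]] := attach_exists w0 f0 sm p0.
have key E : components (logzeros f) E -> attached E w p -> E = D.
  move=> cE /(_ r T r0)[x [t [xr Tt Ey]]].
  apply: (components_eq cE cD Ey); apply: tD; last exact: component_sub Ey.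
  by exists x, t; rewrite (ltW xr).
by rewrite (key C)// (key C').
Qed.

(** Attachment is an open and closed condition on [K], so that it depends only on the component of
    the zero of the initial form. *)
Lemma attached_connected w C (K : set 'rV[R]_n) : w != 0 -> (exists a, a \in S) ->
  smooth_zeros (init_term w f) -> components (logzeros f) C ->
  connected K -> (forall p, K p -> initsum w p = 0) ->
  forall p q, K p -> K q -> attached C w p -> attached C w q.
Proof.
move=> w0 f0 sm cC cK K0; apply: connected_locally_constant => // p Kp.
have [r [T [D [r0 cD tD aD]]]] := attach_exists w0 f0 sm (K0 _ Kp).
have ap : attached D w p by apply: aD; rewrite ?K0// subrr normr0.
exists r => // q Kq qr; have aq := aD _ (K0 _ Kq) qr; split => a.
  by rewrite (attached_unique w0 f0 sm (K0 _ Kp) cC cD).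
by rewrite (attached_unique w0 f0 sm (K0 _ Kq) cC cD).
Qed.

(** After rescaling, [f] is within [eta * E x] of its initial form. Zeros of [f] far out and close
    to the ray of [q] thus make the initial form arbitrarily small near [q]. *)
Lemma attached_init w q : (exists a, a \in S) -> attached (logzeros f) w q -> initsum w q = 0.
Proof.
move=> f0 aq; apply: contrapT => /eqP q0; have [a0 wa0] := face_exists w f0.
pose E := expsum S (fun=> (1 : R)).
have m0 : 0 < `|initsum w q| by rewrite normr_gt0.
have [r1 r10 h1] : exists2 r, 0 < r &
    forall x, `|x - q| < r -> `|initsum w q| / 2 < `|initsum w x|.
  apply: (@continuous_gt_ball _ _ (fun x => `|initsum w x|)).
    by move=> x; exact: (cvg_norm (@expsum_continuous _ _ S (initc f w) x)).
  by rewrite ltr_pdivrMr// mulr_natr mulr2n ltrDl.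
have [r2 r20 h2] : exists2 r, 0 < r & forall x, `|x - q| < r -> - (E q + 1) < - E x.
  apply: (@continuous_gt_ball _ _ (fun x => - E x)); last by rewrite ltrN2 ltrDl.
  by move=> x; exact: (cvgN (@expsum_continuous _ _ S (fun=> 1) x)).
have E0 x : 0 <= E x by apply: sumr_ge0 => a _; rewrite mul1r expR_ge0.
have E1 : 0 < E q + 1 by rewrite ltr_wpDl.
pose eta := `|initsum w q| / 2 / (E q + 1).
have eta0 : 0 < eta by rewrite !divr_gt0.
have [T T0 hT] := gap_threshold wa0 eta0.
have [|x [t [xr Tt zx]]] := aq (Num.min r1 r2) T; first by rewrite lt_min r10.
have [xr1 xr2] : `|x - q| < r1 /\ `|x - q| < r2 by apply/andP; rewrite -lt_min.
have near_init a : a \in S ->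
    `|expR (dot (t *: w) a0) * (f a * expR (dot a (- (t *: w)))) - initc f w a| <= eta.
  apply: initc_perturb => //; last exact: hT.
  by move=> b wb; rewrite !dotZl (face_val wb wa0).
have := expsum_perturb x near_init.
rewrite expsumZ -expsumD zx mulr0 sub0r normrN.
rewrite leNgt => /negP; apply; rewrite (le_lt_trans _ (h1 _ xr1))//.
rewrite (@le_trans _ _ (eta * (E q + 1)))//.
  by rewrite ler_wpM2l ?(ltW eta0)// -lerN2 ltW// h2.
by rewrite /eta divfK// gt_eqF.
Qed.

End Attached.

(** * Noncompact components *)

Lemma fmap_ultra (T U : Type) (G : set_system T) (h : T -> U) :
  UltraFilter G -> UltraFilter (h @ G).
Proof.
move=> UG; split; first exact: fmap_proper_filter.
move=> H HF GH; apply/seteqP; split => B HB; last exact: GH.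
have [//|nB] := in_ultra_setVsetC (h @^-1` B) UG.
have HnB : H (~` B) by apply: GH.
by have [y []] := filter_ex (filterI HB HnB).
Qed.

(** Pigeonhole along an ultrafilter, in place of passing to a subsequence. *)
Lemma ultra_seq (T : Type) (I : eqType) (G : set_system T) (s : seq I) (P : I -> set T) :
  UltraFilter G -> G [set y | exists2 b, b \in s & P b y] -> exists2 b, b \in s & G (P b).
Proof.
move=> UG; elim: s => [|a s IH] Gs.
  by have [y []] := filter_ex Gs.
have [Ga|nGa] := in_ultra_setVsetC (P a) UG; first by exists a; rewrite ?mem_head.
have [|b bs Gb] := IH; last by exists b; rewrite // inE bs orbT.
apply: filterS2 nGa Gs => y na [b]; rewrite inE => /orP[/eqP-> //|bs Pb].
by exists b.
Qed.

Lemma filter_all_seq (T : Type) (I : eqType) (G : set_system T) (s : seq I) (P : I -> set T) :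
  Filter G -> (forall b, b \in s -> G (P b)) -> G [set y | forall b, b \in s -> P b y].
Proof.
move=> FG; elim: s => [|a s IH] h; first by apply: filterE.
have Ga := h a (mem_head _ _).
have Gs : G [set y | forall b, b \in s -> P b y].
  by apply: IH => b bs; apply: h; rewrite inE bs orbT.
apply: filterS2 Ga Gs => y Pa Ps b; rewrite inE => /orP[/eqP->//|]; exact: Ps.
Qed.

(** Plays the part of a sequence going to infinity in [A], with the advantage that every bounded
    real function has a limit along it. *)
Lemma unbounded_ultra (R : realType) (V : normedModType R) (A : set V) :
  (forall r : R, exists2 y, A y & r < `|y|) ->
  exists G : set_system V, [/\ UltraFilter G, G A & forall r : R, G [set y | r < `|y|]].
Proof.
move=> unb; pose F := filter_from setT (fun r : R => A `&` [set y | r < `|y|]).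
have FF : ProperFilter F.
  apply: filter_from_proper; last by move=> r _; have [y Ay ry] := unb r; exists y.
  apply: filter_from_filter; first by exists 0.
  move=> r r' _ _; exists (Num.max r r') => // y [Ay]; rewrite /= gt_max => /andP[].
  by [].
have [G [UG FG]] := ultraFilterLemma FF.
exists G; split => //; first by apply: FG; exists 0 => // y [].
by move=> r; apply: FG; exists r => // y [].
Qed.

Lemma cvg_row (R : realType) (T : Type) (n : nat) (F : set_system T) (h : T -> 'rV[R]_n)
    (l : 'rV[R]_n) : Filter F ->
  (forall i, (fun y => h y 0 i) @ F --> l 0 i) -> h @ F --> l.
Proof.
move=> FF hl; apply/cvgrPdist_lt => e e0.
have : \forall y \near F, forall j, `|l 0 j - h y 0 j| < e.
  by apply: filter_forall => j; move: e e0; apply/cvgrPdist_lt.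
apply: filterS => z zy; rewrite [ltLHS]/Num.norm/= mx_normrE.
by apply/bigmax_ltP; split => // -[i j] _; rewrite !mxE [i]ord1.
Qed.

Section LimitFace.
Context {R : realType} {n : nat}.
Variable f : fewnomial R n.
Implicit Types (a b u v w x y p q : 'rV[R]_n) (C : set 'rV[R]_n) (t : R).

Local Notation S := (finsupp f).
Local Notation initsum w := (expsum (finsupp f) (initc f w)).

(* The face of the terms which remain comparable to the largest one along [G];
   [u y] is the component of [- y] orthogonal to that face. *)
Lemma limit_face (G : set_system 'rV[R]_n) : spanning f -> UltraFilter G ->
  G (logzeros f) -> (forall r : R, G [set y | r < `|y|]) ->
  exists w p (u : 'rV[R]_n -> 'rV[R]_n) a0,
    [/\ w != 0 /\ face (supp f) w a0, initsum w p = 0,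
      (fun y => y + u y) @ G --> p,
      forall y a, face (supp f) w a -> dot (u y) a = dot (u y) a0 &
      forall a, a \in S -> ~ face (supp f) w a -> forall M : R,
        G [set y | M <= dot (u y) a - dot (u y) a0]].
Proof.
move=> [f0 sp] UG GZ Gunb.
(* One term has the largest exponential along [G]; the ratios [rho a] of the others to it lie
   between 0 and 1 and therefore converge. *)
have [b0 fb0 Gb0] : exists2 b0, b0 \in S & G [set y | forall a, a \in S -> dot a y <= dot
  b0 y].
  apply: ultra_seq; apply: filterE => y.
  have [b bs bmax] := @seq_argmin _ _ S (fun b => - dot b y) f0.
  by exists b => // a /bmax; rewrite lerN2.
pose rho a y := expR (dot (a - b0) y).
have rhocvg a : exists l : R, a \in S -> rho a @ G --> l.
  have [fa|] := boolP (a \in S); last by exists 0.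
  have : compact `[0 : R, 1]%classic by exact: segment_compact.
  rewrite compact_ultra => /(_ (rho a @ G) (fmap_ultra (rho a) UG))[].
    apply: (@filterS _ G _ _ _ _ Gb0) => y /(_ a fa) ab.
    by rewrite /= in_itv/= /rho expR_ge0/= -(expR0 R) ler_expR dotBl subr_le0.
  by move=> l [_ rl]; exists l.
have [l lP] := choice rhocvg.
have l_ge0 a : a \in S -> 0 <= l a.
  move=> fa; rewrite leNgt; apply/negP => la0.
  have [y] := filter_ex (cvgr_lt _ (lP _ fa) _ la0).
  by rewrite /rho /= ltNge expR_ge0.
pose Gam := [seq a <- S | 0 < l a].
have rhob0 : rho b0 = cst 1 by apply/funext => y; rewrite /rho subrr dot0l expR0.
have lb0 : l b0 = 1.
  have := lP _ fb0; rewrite rhob0 => h; exact: (norm_cvg_unique h (cvg_cst _)).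
have Gamb0 : b0 \in Gam by rewrite mem_filter lb0 ltr01.
have GamP a : a \in Gam -> (a \in S) /\ 0 < l a by rewrite mem_filter => /andP[].
have dotcvg a : a \in Gam -> dot (a - b0) @ G --> ln (l a).
  move=> /GamP[fa la]; rewrite (_ : dot (a - b0) = @ln R \o rho a).
    apply: continuous_cvg; [exact: continuous_ln|exact: lP].
  by apply/funext => y; rewrite /= expRK.
pose M := \matrix_(i < n, j < size Gam) (nth 0 Gam j - b0) 0 i.
have yM y j : (y *m M) 0 j = dot (nth 0 Gam j - b0) y.
  by rewrite mxE dotC; apply: eq_bigr => i _; rewrite mxE.
(* [lo y] depends on [y] only through the numbers [dot (a - b0) y] with [a] in [Gam], which
   converge, and it has the same numbers as [y]. *)
pose P := pinvmx M.
pose lo y := y *m M *m P.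
pose u y := lo y - y.
have loM y a : a \in Gam -> dot (a - b0) (lo y) = dot (a - b0) y.
  move=> aG; have ia : (index a Gam < size Gam)%N by rewrite index_mem.
  have := congr1 (fun A : 'rV[R]_(size Gam) => A 0 (Ordinal ia)) (mulmxKpV (submxMl y M)).
  by rewrite !yM/= nth_index.
have ueq y a : a \in Gam -> dot (u y) a = dot (u y) b0.
  by move=> aG; apply/eqP; rewrite -subr_eq0 -dotBr dotC dotBr loM// subrr.
pose p := (\row_j ln (l (nth 0 Gam j))) *m P.
have locvg : lo @ G --> p.
  apply: cvg_row => i; rewrite (_ : (fun y => _) =
      fun y => \sum_(j < size Gam) dot (nth 0 Gam j - b0) y * P j i); last first.
    by apply/funext => y; rewrite mxE; apply: eq_bigr => j _; rewrite yM.
  rewrite mxE; apply: cvg_rsum => j; apply: cvgM; last exact: cvg_cst.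
  by rewrite mxE; apply: dotcvg; rewrite mem_nth.
have dotp a : a \in Gam -> dot (a - b0) p = ln (l a).
  move=> aG; apply: norm_cvg_unique (dotcvg a aG).
  have e : dot (a - b0) \o lo = dot (a - b0) by apply/funext => y; rewrite /= loM.
  by rewrite -[X in fmap X]e; apply: continuous_cvg locvg; exact: dot_continuous.
have uinf a : a \in S -> a \notin Gam -> forall m : R,
    G [set y | m <= dot (u y) a - dot (u y) b0].
  move=> fa; rewrite mem_filter fa andbT -leNgt => la0 m.
  have la : l a = 0 by apply/eqP; rewrite eq_le la0 l_ge0.
  have c1 : dot (a - b0) \o lo @ G --> dot (a - b0) p.
    by apply: continuous_cvg locvg; exact: dot_continuous.
  have G1 : \forall y \near G, dot (a - b0) p - 1 < dot (a - b0) (lo y).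
    by apply: (cvgr_gt _ c1); rewrite ltrBlDr ltrDl.
  have c2 : rho a @ G --> 0 by rewrite -la; exact: lP.
  have G2 : \forall y \near G, rho a y < expR (dot (a - b0) p - 1 - m).
    by apply: (cvgr_lt _ c2); exact: expR_gt0.
  apply: filterS2 G1 G2 => y; rewrite ltr_expR => h1 h2.
  rewrite /= -dotBr dotC /u dotBr; move: h1 h2; clear; lra.
(* A single far point provides the normal [u y0]. Gaps of at least 1 make its face exactly [Gam]; it
   is nonzero because [lo y0] is within 1 of [p] while [y0] is not. *)
have [y0 [y0b y0h]] : exists y0, `|p| + 1 < `|y0| /\ `|p - lo y0| < 1 /\
    (forall a, a \in [seq a <- S | a \notin Gam] -> 1 <= dot (u y0) a - dot (u y0) b0).
  have G3 : G [set y | forall a, a \in [seq a <- S | a \notin Gam] ->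
      1 <= dot (u y) a - dot (u y) b0].
    by apply: filter_all_seq => a; rewrite mem_filter => /andP[nG fa]; exact: uinf.
  have G4 : \forall y \near G, `|p - lo y| < 1.
    by move/cvgrPdist_lt : locvg; apply.
  have [y [[h1 h2] h3]] := filter_ex (filterI (filterI (Gunb (`|p| + 1)) G4) G3).
  by exists y.
have [y0p y0g] := y0h.
have faceE a : face (supp f) (u y0) a <-> a \in Gam.
  split=> [[fa ha]|aG].
    apply: contrapT => /negP nG; have := ha _ fb0.
    have := y0g a; rewrite mem_filter nG fa => /(_ isT).
    by clear; lra.
  split; first by have [] := GamP _ aG.
  move=> c fc; rewrite (ueq _ _ aG).
  have [/ueq ->//|nG] := boolP (c \in Gam).
  have := y0g c; rewrite mem_filter nG fc => /(_ isT); by clear; lra.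
have w0 : u y0 != 0.
  apply/eqP => u0; have all a : a \in S -> a \in Gam.
    move=> fa; apply: contrapT => /negP nG.
    have := y0g a; rewrite mem_filter nG fa => /(_ isT).
    by rewrite u0 !dot0l subrr ler10.
  have : lo y0 = y0 by apply/eqP; rewrite -subr_eq0; apply/eqP.
  move=> loy; move: y0p; rewrite loy => py.
  move: y0b; rewrite ltNge => /negP; apply.
  rewrite -[y0](subKr p) (le_trans (ler_normB _ _))// lerD2l ltW//.
exists (u y0), p, u, b0; split => //.
- by split => //; apply/faceE.
(* Divide the equation [expsum S f y = 0] by the largest exponential and pass to the limit. *)
- have sum0 : \sum_(a <- S) f a * l a = 0.
    have c1 : (fun y => \sum_(a <- S) f a * rho a y) @ G --> \sum_(a <- S) f a * l a.
      rewrite big_seq (_ : (fun y => _) =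
        (fun y => \sum_(a <- S | a \in S) f a * rho a y)); last first.
        by apply/funext => y; rewrite big_seq.
      apply: cvg_big => [|a fa]; first exact: add_continuous.
      by apply: cvgM; [exact: cvg_cst|exact: lP].
    apply: (norm_cvg_unique c1); apply: cvg_near_cst.
    apply: filterS GZ => y zy.
    rewrite (_ : \sum_(a <- S) _ = expR (- dot b0 y) * expsum S f y); last first.
      rewrite mulr_sumr; apply: eq_bigr => a _.
      by rewrite /rho dotBl expRD; ring.
    by rewrite zy mulr0.
  rewrite (_ : expsum _ _ _ = expR (dot b0 p) * \sum_(a <- S) f a * l a).
    by rewrite sum0 mulr0.
  rewrite mulr_sumr [LHS]big_seq [RHS]big_seq; apply: eq_bigr => a fa; rewrite /initc.
  case: asboolP => [/faceE aG|/faceE/negP nG].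
    have la : l a = expR (dot (a - b0) p) by rewrite dotp// lnK// posrE; have [] := GamP _ aG.
    by rewrite la mulrCA -expRD dotBl addrC subrK.
  suff -> : l a = 0 by rewrite mulr0 mulr0 mul0r.
  apply/eqP; rewrite eq_le l_ge0// andbT leNgt.
  by move: nG; rewrite mem_filter fa andbT.
- by rewrite (_ : (fun y => _) = lo)//; apply/funext => y; rewrite /u addrC subrK.
- by move=> y a /faceE; exact: ueq.
- by move=> a fa /faceE/negP nG m; exact: uinf.
Qed.

End LimitFace.

Lemma noncompact_unbounded (R : realType) (n : nat) (A : set 'rV[R]_n) :
  closed A -> ~ compact A -> forall r : R, exists2 y, A y & r < `|y|.
Proof.
move=> clA ncA r; apply: contrapT => bd; apply: ncA; apply: bounded_closed_compact => //.
exists r; split; first exact: num_real.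
move=> M rM y Ay; apply/ltW/(le_lt_trans _ rM); rewrite leNgt; apply/negP => ry.
by apply: bd; exists y.
Qed.

Section FacetEnds.
Context {R : realType} {n : nat}.
Variable f : fewnomial R n.
Implicit Types (a b u v w x y p q : 'rV[R]_n) (C : set 'rV[R]_n) (t : R).

Local Notation S := (finsupp f).
Local Notation initsum w := (expsum (finsupp f) (initc f w)).

Hypothesis smooth_init_terms : forall w, w != 0 -> smooth_zeros (init_term w f).
Hypothesis span_f : spanning f.

Lemma component_logzeros_closed C : components (logzeros f) C -> closed C.
Proof. by move=> [x _ <-]; apply: component_closed; exact: expzeros_closed. Qed.

(* Far out on [C], a zero lies close to the face of its dominant terms; following
   [C] in the direction of a facet containing this face preserves dominance. *)
Lemma attach_facet C : components (logzeros f) C -> ~ compact C ->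
  exists w q, [/\ dot w w = 1, facet_dir f w, initsum w q = 0 & attached C w q].
Proof.
move=> cC ncC; have [f0 _] := span_f.
have [G [UG GC Gunb]] :=
  unbounded_ultra (noncompact_unbounded (component_logzeros_closed cC) ncC).
have GZ : G (logzeros f) by apply: filterS GC; exact: component_sub.
have [w [p [u [a0 [[w0 wa0] p0 ucvg ueq uinf]]]]] := limit_face span_f UG GZ Gunb.
have [v v0] := smooth_init (smooth_init_terms w0) p0.
have [e [r [eta [/andP[e0 _] r0 eta0 cr]]]] := init_crossing p0 v0 ltr01.
have [w' [w'1 fw' ww']] := facet_above span_f w0.
have [y [[Cy yr] yu]] : exists y, (C y /\ `|p - (y + u y)| <= r) /\
    forall a, a \in [seq a <- S | ~~ `[< face (supp f) w a >]] ->
      `|f a| <= eta * (dot (u y) a - dot (u y) a0).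
  apply: (@filter_ex _ G); apply: filterI; first apply: filterI => //.
    by move/cvgrPdist_le : ucvg; apply.
  apply: filter_all_seq => a; rewrite mem_filter => /andP[/asboolP nwa fa].
  apply: filterS (uinf a fa nwa (`|f a| / eta)) => y.
  by rewrite /= ler_pdivrMr// mulrC.
(* As [t] starts at 0, the tube contains [y] itself, which is therefore on the graph. *)
pose D := tube (p - u y) w' r 0.
have cD : connected D by exact: tube_connected.
have crD z : D z -> crossing S f v e z.
  move=> [x [t [xr t0 zx]]].
  have -> : z = (x + u y) - (u y + t *: w') by rewrite opprD addrA addrK.
  have eqf a : face (supp f) w a -> dot (u y + t *: w') a = dot (u y + t *: w') a0.
    by move=> wa; rewrite !dotDl !dotZl (ueq y a wa) (face_val (ww' _ wa) (ww' _ wa0)).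
  apply: (cr _ a0) => //; last by move: xr; rewrite opprB addrA.
  move=> a fa nwa.
  have : `|f a| <= eta * (dot (u y) a - dot (u y) a0).
    by apply: yu; rewrite mem_filter fa andbT; apply/asboolP.
  (* [w'] attains its minimum on the face of [w], so adding [t *: w'] can only widen the gaps. *)
  move/le_trans; apply; rewrite ler_pM2l// !dotDl !dotZl opprD addrACA lerDl.
  by rewrite -mulrBr mulr_ge0// subr_ge0; exact: (proj2 (ww' _ wa0)).
have [Gr [cGr GrZ Grz Grex]] := zero_graph_connected e0 cD crD.
have GrC : Gr `<=` C.
  apply: (component_max cC Cy) => //.
  have := Grz y 0; rewrite scale0r addr0 normr0; apply; last exact: (component_sub cC Cy).
    by exists y, 0; rewrite scale0r subr0 opprB addrA distrC.
  exact: ltW.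
(* Zeros on [C] over the central ray, one for each [t]. Their offsets stay in a compact interval,
   and a cluster value for large [t] gives the point of attachment. *)
have sP t : exists s, 0 <= t -> `|s| <= e /\ C (p - u y - t *: w' + s *: v).
  have [t0|t0] := leP 0 t; last by exists 0.
  have [|s se Gs] := Grex (p - u y - t *: w'); last by exists s => _; split;
    [exact: ltW|exact: GrC].
  by exists (p - u y), t; rewrite subrr normr0 ltW.
have [s {}sP] := choice sP.
have [s1 [_ s1cl]] : `[- e, e]%classic `&` cluster (s @ +oo%R) !=set0.
  apply: (@segment_compact R (- e) e).
  have : \forall t \near (+oo%R : set_system R), 0 <= t by apply: nbhs_pinfty_ge;
    exact: num_real.
  apply: (@filterS _ (nbhs +oo%R)) => t /sP[se _].
  by rewrite /= in_itv/= -ler_norml.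
have att : attached C w' (p - u y + s1 *: v).
  move=> r2 T2 r20.
  have v1 : 0 < `|v| + 1 by rewrite ltr_wpDl.
  have [||z [[t tT zt] sz]] := s1cl (s @` [set t | Num.max 0 T2 <= t]) (ball s1 (r2 /
    (`|v| + 1))).
  - have : \forall t \near (+oo%R : set_system R), Num.max 0 T2 <= t by apply:
      nbhs_pinfty_ge; exact: num_real.
    by apply: filterS => t tT; exists t.
  - exact: (nbhsx_ballx s1 _ (divr_gt0 r20 v1)).
  rewrite -zt in sz; move: tT; rewrite /= ge_max => /andP[t0 T2t].
  have [_ Ct] := sP t t0.
  exists (p - u y + s t *: v), t; split => //; last by rewrite addrAC.
  rewrite opprD addrACA subrr add0r -scalerBl normrZ.
  move: sz; rewrite -ball_normE/= distrC => sz.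
  rewrite (@le_lt_trans _ _ (`|s t - s1| * (`|v| + 1)))//; first by rewrite ler_wpM2l// lerDl.
  by rewrite -ltr_pdivlMr.
exists w', (p - u y + s1 *: v); split => //.
apply: attached_init => // r2 T2 /att-/(_ T2)[x [t [xr Tt Cx]]].
by exists x, t; split => //; exact: (component_sub cC Cx).
Qed.

(** Two components sent to the same normal and the same component of its initial zero set are
    attached at a common point, hence equal. *)
Lemma num_noncompact_le :
  (num_noncompact_components f <=
   \esum_(w in unit_facet_normal (newton f)) num_components (init_term w f))%E.
Proof.
have [f0 _] := span_f.
rewrite num_noncompact_componentsE.
under [leRHS]eq_esum do rewrite num_componentsE.
have ex C : exists z : 'rV[R]_n * set 'rV[R]_n, noncompact_components (logzeros f) C ->
    [/\ unit_facet_normal (newton f) z.1, components (logzeros (init_term z.1 f)) z.2 &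
     exists2 q, z.2 q & attached C z.1 q].
  have [[cC ncC]|nC] := pselect (noncompact_components (logzeros f) C); last first.
    by exists (0, set0) => /nC.
  have [w [q [w1 fw q0 aq]]] := attach_facet cC ncC.
  have zq : logzeros (init_term w f) q by rewrite logzeros_init.
  exists (w, connected_component (logzeros (init_term w f)) q) => _; split => /=.
  - exact: facet_dir_unit.
  - by exists q.
  - by exists q => //; exact: connected_component_refl.
have [e eP] := choice ex.
apply: (@le_counting_esum _ _ _ _ _ _ (fun w => components (logzeros (init_term w f))) e).
  move=> C C' /set_mem NC /set_mem NC' ee.
  have [u cK [q Kq aq]] := eP _ NC.
  have [_ _ [q' Kq' aq']] := eP _ NC'; rewrite -ee in Kq' aq'.
  have w0 : (e C).1 != 0 by rewrite -dot_eq0 (proj1 u) oner_eq0.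
  have K0 p : (e C).2 p -> initsum (e C).1 p = 0.
    by move=> /(component_sub cK); rewrite logzeros_init.
  have connK : connected (e C).2 by case: cK => x _ <-; exact: component_connected.
  have sm := smooth_init_terms w0.
  have aqq := attached_connected w0 f0 sm (proj1 NC) connK K0 Kq Kq' aq.
  exact: (attached_unique w0 f0 sm (K0 _ Kq') (proj1 NC) (proj1 NC') aqq aq').
by move=> C NC; have [] := eP _ NC.
Qed.

End FacetEnds.

(** * Initial forms of facets in one variable less *)

Section DropCoordinate.
Context {R : realType} {n : nat}.
Variables (f : fewnomial R n.+1) (w : 'rV[R]_n.+1) (i : 'I_n.+1).
Hypothesis wi : w 0 i != 0.
Implicit Types (a y : 'rV[R]_n.+1) (b z : 'rV[R]_n).

Local Notation T := (finsupp (init_term w f)).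

(** Each coefficient is a sum with a single term: [dot w] is constant on the face and [w 0 i != 0],
    so dropping coordinate [i] is injective there. *)
Definition drop_nomial : fewnomial R n :=
  [fsfun b in [fset col' i a | a in T]%fset =>
     \sum_(a <- T | col' i a == b) init_term w f a].

Definition insert0 z : 'rV[R]_n.+1 := \row_j oapp (z 0) 0 (unlift i j).

(** Slides [y] along [w] to the hyperplane where coordinate [i] vanishes, which [insert0]
    parametrizes. *)
Definition project y : 'rV[R]_n := col' i (y - (y 0 i / w 0 i) *: w).

Lemma face_init a : a \in T -> face (supp f) w a.
Proof. by rewrite finsupp_init => /asboolP. Qed.

Lemma drop_inj : {in T &, injective (col' i)}.
Proof.
move=> a a' /face_init wa /face_init wa' e; have := face_val wa wa'.
have lft j : a 0 (lift i j) = a' 0 (lift i j).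
  by have := congr1 (fun b : 'rV[R]_n => b 0 j) e; rewrite !mxE.
rewrite /dot !(bigD1_ord i)//=.
under eq_bigr do rewrite lft; move/addIr/(mulfI wi) => ai.
by apply/rowP => j; have [k ->|->//] := unliftP i j.
Qed.

Lemma drop_nomialE a : a \in T -> drop_nomial (col' i a) = init_term w f a.
Proof.
move=> Ta; rewrite fsfunE; case: ifPn => [_|]; last first.
  by rewrite in_imfset.
rewrite (big_rem a)//= eqxx big1_seq ?addr0// => a' /andP[/eqP e].
rewrite (mem_rem_uniq _ (fset_uniq _)) inE => /andP[aa' Ta'].
by rewrite (drop_inj Ta' Ta e) eqxx in aa'.
Qed.

Lemma finsupp_drop : finsupp drop_nomial = [fset col' i a | a in T]%fset.
Proof.
apply/fsetP => b; apply/idP/idP => [|/imfsetP[a /= Ta ->]].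
  by rewrite mem_finsupp fsfunE; case: ifPn => //; rewrite eqxx.
by rewrite mem_finsupp drop_nomialE// -mem_finsupp.
Qed.

Lemma expsum_drop z :
  expsum (finsupp drop_nomial) drop_nomial z = expsum T (init_term w f) (insert0 z).
Proof.
rewrite /expsum finsupp_drop big_imfset/=; last exact: drop_inj.
rewrite !big_seq; apply: eq_bigr => a Ta; rewrite drop_nomialE//; congr (_ * expR _).
rewrite [RHS](bigD1_ord i)//= !mxE unlift_none/= mulr0 add0r.
by apply: eq_bigr => j _; rewrite !mxE liftK.
Qed.

Lemma insert0_project y : insert0 (project y) = y - (y 0 i / w 0 i) *: w.
Proof.
apply/rowP => j; rewrite mxE; have [k ->|->] := unliftP i j; rewrite /= !mxE//.
by rewrite divfK// subrr.
Qed.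

Lemma insert0_continuous : continuous insert0.
Proof.
move=> z; apply: (@cvg_row _ _ _ (nbhs z)) => j.
rewrite (_ : (fun b => _) = fun b => oapp (b 0) 0 (unlift i j)); last first.
  by apply/funext => b; rewrite mxE.
rewrite mxE; case: (unlift i j) => [k|] /=; first exact: coord_continuous.
exact: cvg_cst.
Qed.

Lemma expsum_init_line : exists h, forall y t,
  expsum T (init_term w f) (y + t *: w) = expR (t * h) * expsum T (init_term w f) y.
Proof.
have [h hP] : exists h, forall a, a \in T -> dot w a = h.
  have [[a0 wa0]|nf] := pselect (exists a, face (supp f) w a).
    by exists (dot w a0) => a /face_init wa; exact: face_val wa wa0.
  by exists 0 => a /face_init wa; case: nf; exists a.
exists h => y t; rewrite expsumD -expsumZ; apply: eq_expsum => a Ta.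
by rewrite mulrC dotZr dotC hP.
Qed.

(** The zero set is invariant under translation along [w], so each [x] is joined to
    [insert0 (project x)] by a line of zeros. Hence points whose projections share a component share
    one themselves. *)
Lemma num_components_drop_le :
  (num_components (init_term w f) <= num_components drop_nomial)%E.
Proof.
have [h hP] := expsum_init_line.
have lineZ y t : logzeros (init_term w f) y -> logzeros (init_term w f) (y + t *: w).
  by rewrite /logzeros /expzeros/= hP => ->; rewrite mulr0.
have projZ y : logzeros (init_term w f) y -> logzeros drop_nomial (project y).
  by move=> /lineZ lz; rewrite /logzeros /expzeros/= expsum_drop insert0_project
    -scaleNr; exact: lz.
have comm y (z : 'rV[R]_n.+1) : logzeros (init_term w f) y -> logzeros (init_term w f) z ->
    connected_component (logzeros drop_nomial) (project y) (project z) ->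
    connected_component (logzeros (init_term w f)) y z.
  have to_sec x : logzeros (init_term w f) x ->
      connected_component (logzeros (init_term w f)) x (insert0 (project x)).
    move=> zx; exists ((fun t : R => x + t *: w) @` setT); last first.
      by exists (- (x 0 i / w 0 i)) => //; rewrite insert0_project scaleNr.
    split; first by exists 0 => //; rewrite scale0r addr0.
      by move=> _ [t _ <-]; exact: lineZ.
    apply: connected_continuous_connected.
      by apply/connected_intervalP => ? ? _ _ ? _.
    apply: continuous_subspaceT => t; apply: cvgD; first exact: cvg_cst.
    by apply: cvgZr_tmp; exact: cvg_id.
  move=> zy zz cyz; apply: connected_component_trans (to_sec _ zy) _.
  apply: connected_component_sym; apply: connected_component_trans (to_sec _ zz) _.
  apply: connected_component_sym; case: cyz => B [By BZ cB] Bz.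
  exists (insert0 @` B); last by exists (project z).
  split; first by exists (project y).
    by move=> _ [x /BZ Zx <-]; move: Zx; rewrite /logzeros /expzeros/= expsum_drop.
  apply: connected_continuous_connected => //.
  by apply: continuous_subspaceT; exact: insert0_continuous.
have ex K : exists y, components (logzeros (init_term w f)) K ->
    logzeros (init_term w f) y /\ K = connected_component (logzeros (init_term w f)) y.
  have [[y Zy <-]|nK] := pselect (components (logzeros (init_term w f)) K).
    by exists y.
  by exists 0.
have [y yP] := choice ex.
rewrite !num_componentsE.
apply: (@le_counting_inj _ _ _ _ _
  (fun K => connected_component (logzeros drop_nomial) (project (y K)))).
  move=> K K' /set_mem cK /set_mem cK' e.
  have [[Z KE] [Z' KE']] := (yP _ cK, yP _ cK').
  rewrite KE KE'; apply: same_connected_component; apply: comm => //.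
  by rewrite e; apply: connected_component_refl; exact: projZ.
move=> K /yP[Z _]; exists (project (y K)) => //; exact: projZ.
Qed.

Lemma card_drop : #|` finsupp drop_nomial| = num_support_in f (face (newton f) w).
Proof.
rewrite finsupp_drop card_in_imfset/=; last exact: drop_inj.
rewrite /num_support_in; congr (#|` _ |); apply/fsetP => a.
rewrite finsupp_init !inE; apply/idP/idP => [/asboolP wa|/andP[fa /asboolP wa]].
  by rewrite (face_supp wa); apply/asboolP/face_newton_supp => //; exact: face_supp wa.
by apply/asboolP/face_newton_supp.
Qed.

End DropCoordinate.

Lemma num_components_init_le (R : realType) (n : nat) (f : fewnomial R n)
    (w : 'rV[R]_n) : w != 0 ->
  (num_components (init_term w f) <=
   max_num_components R n.-1 (num_support_in f (face (newton f) w)))%E.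
Proof.
case: n f w => [f w|n f w]; first by rewrite (thinmx0 w) eqxx.
case/rV0Pn => i wi; apply: le_trans (num_components_drop_le f wi) _.
apply: ereal_sup_ubound; exists (drop_nomial f w i) => //=.
exact: card_drop.
Qed.

Lemma esum_facets_le (R : realType) (n : nat) (f : fewnomial R n) : spanning f ->
  (\esum_(w in unit_facet_normal (newton f)) num_components (init_term w f) <=
   \esum_(Q in is_facet (newton f)) max_num_components R n.-1 (num_support_in f Q))%E.
Proof.
move=> sp; apply: (le_esum_inj (facet_inj sp)) => w [w1 fw]//.
by apply: num_components_init_le; rewrite -dot_eq0 w1 oner_eq0.
Qed.

(** * Sign changes along the boundary of a square *)

Section SquareCrossing.
Context {R : realType}.
Variables (G : R * R -> R) (A B : set (R * R)).
Hypothesis contG : continuous G.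
Hypothesis closedA : closed A.
Hypothesis closedB : closed B.
Hypothesis disjAB : forall p, A p -> B p -> False.
Hypothesis zeroG : forall p, G p = 0 -> A p \/ B p.
Implicit Types (p q : R * R).

Let seg p q (t : R) : R * R := (p.1 + t * (q.1 - p.1), p.2 + t * (q.2 - p.2)).
Let sg p : int := if 0 <= G p then 1 else 0.

(* The sign change of [G] between the endpoints, counted only on the segments
   which meet [A]; it is a cocycle on sufficiently small squares. *)
Let chi p q : int :=
  if `[< exists2 t : R, 0 <= t <= 1 & A (seg p q t) >] then sg q - sg p else 0.

Lemma chi_eq0 p q : (forall t, 0 <= t <= 1 -> ~ A (seg p q t)) -> chi p q = 0.
Proof. by move=> nA; rewrite /chi asboolF// => -[t t01 /(nA t t01)]. Qed.

Let seg_continuous p q : continuous (fun t => G (seg p q t)).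
Proof.
have aff (a b : R) : continuous (fun t : R => a + t * b).
  move=> t; apply: (@cvgD _ _ _ (nbhs t)); first exact: cvg_cst.
  by apply: cvgM; [exact: cvg_id|exact: cvg_cst].
move=> t; apply: (@continuous_comp _ _ _ (seg p q) G); last exact: contG.
exact: (cvg_pair (aff _ _ t) (aff _ _ t)).
Qed.

(** If the segment misses [A] as well, it carries no zero of [G], and the signs agree by the
    intermediate value theorem. *)
Lemma chi_sign p q : (forall t, 0 <= t <= 1 -> ~ B (seg p q t)) -> chi p q = sg q - sg p.
Proof.
move=> nB; rewrite /chi; case: ifPn => // /asboolP nA.
suff -> : sg q = sg p by rewrite subrr.
have seg0 : seg p q 0 = p by rewrite /seg !mul0r !addr0; case: p {nA nB}.
have seg1 : seg p q 1 = q by rewrite /seg !mul1r !(addrC p.1) !(addrC p.2) !subrK;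
  case: q {nA nB seg0}.
rewrite /sg.
have nz t : 0 <= t <= 1 -> G (seg p q t) != 0.
  move=> t01; apply/eqP => /zeroG[Ap|Bp]; last exact: nB Bp.
  by apply: nA; exists t.
have key : ~~ (Num.min (G (seg p q 0)) (G (seg p q 1)) <= 0 <=
     Num.max (G (seg p q 0)) (G (seg p q 1))).
  apply/negP => h; have [|t] := @IVT R (fun t => G (seg p q t)) 0 1 0 ler01 _ h.
    by apply: continuous_subspaceT => t; exact: seg_continuous.
  by rewrite in_itv/= => /nz/eqP.
move: key; rewrite seg0 seg1 ge_min le_max.
have [q0|q0] := leP 0 (G q); have [p0|p0] := leP 0 (G p) => //=.
  by rewrite (ltW p0).
by rewrite (ltW q0) orbT.
Qed.

(** A Lebesgue number for the cover of the square by the complements of [A] and [B]. *)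
Lemma square_lebesgue : exists2 d : R, 0 < d & forall p,
  0 <= p.1 <= 1 -> 0 <= p.2 <= 1 ->
  (forall q, ball p d q -> ~ A q) \/ (forall q, ball p d q -> ~ B q).
Proof.
have cK : compact (`[0 : R, 1] `*` `[0 : R, 1])%classic.
  by apply: compact_setX; exact: segment_compact.
pose P (d : R) p := (forall q, ball p d q -> ~ A q) \/ (forall q, ball p d q -> ~ B q).
have locP : forall p, (`[0, 1] `*` `[0, 1])%classic p ->
    \forall p' \near p & d \near 0^'+, P d p'.
  move=> p _.
  have loc (E : set (R * R)) : closed E -> ~ E p ->
      \forall p' \near p & d \near 0^'+, forall q, ball p' d q -> ~ E q.
    move=> cE nEp.
    have : nbhs p (~` E) by apply: open_nbhs_nbhs; split => //; exact: closed_openC.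
    move=> /nbhs_ballP[e e0 eE].
    have e2 : 0 < e / 2 by rewrite divr_gt0.
    exists (ball p (e / 2), [set d : R | d < e / 2]) => /=.
      split; first exact: nbhsx_ballx.
      exact: nbhs_right_lt.
    move=> [p' d] /= [pp' de] q p'q; apply: eE.
    rewrite [e]splitr; apply: (ball_triangle pp').
    by apply: le_ball p'q; exact: ltW.
  have [Ap|nAp] := pselect (A p).
    have [[U V] /= [Up V0] UV] := loc B closedB (fun Bp => disjAB Ap Bp).
    by exists (U, V) => // z zUV; right; exact: UV zUV.
  have [[U V] /= [Up V0] UV] := loc A closedA nAp.
  by exists (U, V) => // z zUV; left; exact: UV zUV.
have H := (iffLR (compact_near_coveringP _) cK) R (0^'+) P (at_right_proper_filter 0) locP.
have H0 : \forall d \near 0^'+, 0 < d :> R by exact: nbhs_right_gt.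
have FR : ProperFilter (0 : R)^'+ by exact: at_right_proper_filter.
have [d [dh d0]] := @filter_ex _ _ FR _ (@filterI _ _ FR _ _ H H0).
by exists d => // p p1 p2; apply: dh; split.
Qed.

(** A discrete Stokes argument. On a cell missing [A] all values of [chi] vanish, on a cell missing
    [B] they are differences of signs; either way they sum to zero around the cell. Over the whole
    grid only the boundary remains, where three sides contribute nothing and the right side its sign
    change. *)
Lemma square_crossing :
  (forall t, 0 <= t <= 1 -> ~ A (t, 0)) -> (forall t, 0 <= t <= 1 -> ~ A (t, 1)) ->
  (forall t, 0 <= t <= 1 -> ~ A (0, t)) -> (forall t, 0 <= t <= 1 -> ~ B (1, t)) ->
  ~ (G (1, 0) < 0 < G (1, 1)).
Proof.
move=> bottom top left right /andP[G10 G11].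
have [d d0 leb] := square_lebesgue.
pose N := (Num.bound d^-1).+1.
have N0 : 0 < N%:R :> R by rewrite ltr0n.
have Nd : N%:R^-1 < d.
  rewrite invf_plt ?posrE//; have := archi_boundP (ltW (_ : 0 < d^-1)).
  rewrite invr_gt0 => /(_ d0) /lt_trans; apply; by rewrite ltr_nat.
pose pt (i j : nat) : R * R := (i%:R / N%:R, j%:R / N%:R).
have pt01 (i : nat) : (i <= N)%N -> 0 <= (i%:R / N%:R : R) <= 1.
  by move=> iN; apply/andP; split; [rewrite divr_ge0|rewrite ler_pdivrMr// mul1r ler_nat].
have segh i j t : seg (pt i j) (pt i.+1 j) t = ((i%:R + t) / N%:R, j%:R / N%:R).
  by rewrite /seg/= subrr mulr0 addr0 -[i.+1]addn1 natrD -mulrBl addrAC subrr add0r mul1r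
    -mulrDl.
have segv i j t : seg (pt i j) (pt i j.+1) t = (i%:R / N%:R, (j%:R + t) / N%:R).
  by rewrite /seg/= subrr mulr0 addr0 -[j.+1]addn1 natrD -mulrBl addrAC subrr add0r mul1r
    -mulrDl.
have step (i : nat) (t : R) : (i < N)%N -> 0 <= t <= 1 -> 0 <= (i%:R + t) / N%:R <= 1.
  move=> iN /andP[t0 t1]; apply/andP; split; first by rewrite divr_ge0 ?ler0n// addr_ge0.
  rewrite ler_pdivrMr// mul1r; by rewrite (le_trans (lerD (lexx _) t1))// natr1 ler_nat.
have inball i j (x y : R) : 0 <= x <= 1 -> 0 <= y <= 1 ->
    ball (pt i j) d ((i%:R + x) / N%:R, (j%:R + y) / N%:R).
  have key (k z : R) : 0 <= z <= 1 -> ball (k / N%:R) d ((k + z) / N%:R).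
    move=> /andP[z0 z1]; rewrite -ball_normE/= -mulrBl opprD addrA subrr sub0r.
    rewrite normrM normrN !ger0_norm ?invr_ge0 ?ler0n//.
    by rewrite (le_lt_trans _ Nd)// ler_piMl// invr_ge0.
  by move=> x01 y01; split; apply: key.
have s01 : 0 <= (0 : R) <= 1 by rewrite lexx ler01.
have s11 : 0 <= (1 : R) <= 1 by rewrite lexx ler01.
have cell i j : (i < N)%N -> (j < N)%N ->
    chi (pt i j) (pt i.+1 j) - chi (pt i j.+1) (pt i.+1 j.+1) +
    (chi (pt i.+1 j) (pt i.+1 j.+1) - chi (pt i j) (pt i j.+1)) = 0.
  move=> iN jN.
  have bh t : 0 <= t <= 1 -> ball (pt i j) d (seg (pt i j) (pt i.+1 j) t).
    by move=> t01; rewrite segh; have := inball i j _ _ t01 s01; rewrite addr0.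
  have bh' t : 0 <= t <= 1 -> ball (pt i j) d (seg (pt i j.+1) (pt i.+1 j.+1) t).
    by move=> t01; rewrite segh; have := inball i j _ _ t01 s11; rewrite natr1.
  have bv t : 0 <= t <= 1 -> ball (pt i j) d (seg (pt i j) (pt i j.+1) t).
    by move=> t01; rewrite segv; have := inball i j _ _ s01 t01; rewrite addr0.
  have bv' t : 0 <= t <= 1 -> ball (pt i j) d (seg (pt i.+1 j) (pt i.+1 j.+1) t).
    by move=> t01; rewrite segv; have := inball i j _ _ s11 t01; rewrite natr1.
  have [nA|nB] := leb (pt i j) (pt01 _ (ltnW iN)) (pt01 _ (ltnW jN)).
    by rewrite !chi_eq0 ?subrr ?addr0// => t t01; apply: nA;
      [exact: bv|exact: bv'|exact: bh'|exact: bh].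
  rewrite !chi_sign; first by ring.
  - by move=> t t01; apply: nB; exact: bv.
  - by move=> t t01; apply: nB; exact: bv'.
  - by move=> t t01; apply: nB; exact: bh'.
  - by move=> t t01; apply: nB; exact: bh.
have sumcell : \sum_(0 <= i < N) \sum_(0 <= j < N)
    (chi (pt i j) (pt i.+1 j) - chi (pt i j.+1) (pt i.+1 j.+1) +
    (chi (pt i.+1 j) (pt i.+1 j.+1) - chi (pt i j) (pt i j.+1))) = 0.
  rewrite big_nat big1// => i /andP[_ iN]; rewrite big_nat big1// => j /andP[_ jN].
  exact: cell.
have tele (h : nat -> int) : \sum_(0 <= j < N) (h j - h j.+1) = h 0%N - h N.
  rewrite -[RHS]opprB -(telescope_sumr _ (leq0n N)) -sumrN.
  by apply: eq_bigr => j _; rewrite opprB.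
have : \sum_(0 <= i < N) (chi (pt i 0%N) (pt i.+1 0%N) - chi (pt i N) (pt i.+1 N)) +
    \sum_(0 <= j < N) (chi (pt N j) (pt N j.+1) - chi (pt 0%N j) (pt 0%N j.+1)) = 0.
  rewrite -[RHS]sumcell; under [RHS]eq_bigr do rewrite big_split/=.
  rewrite [RHS]big_split/=; congr (_ + _).
    by apply: eq_bigr => i _; rewrite (tele (fun j => chi (pt i j) (pt i.+1 j))).
  rewrite [RHS]exchange_big/=; apply: eq_bigr => j _.
  by rewrite (telescope_sumr (fun i => chi (pt i j) (pt i j.+1))).
have NN : N%:R / N%:R = 1 :> R by rewrite divff// gt_eqF.
rewrite big_nat [X in X + _]big1 ?add0r; last first.
  move=> i /andP[_ iN]; rewrite !chi_eq0 ?subrr// => t t01; rewrite segh ?NN ?mul0r.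
    by apply: top; exact: step.
  by apply: bottom; exact: step.
have -> : \sum_(0 <= j < N) (chi (pt N j) (pt N j.+1) - chi (pt 0%N j) (pt 0%N j.+1)) =
    \sum_(0 <= j < N) (sg (pt N j.+1) - sg (pt N j)).
  rewrite !big_nat; apply: eq_bigr => j /andP[_ jN].
  rewrite (@chi_eq0 (pt 0%N j)) ?subr0; last first.
    by move=> t t01; rewrite segv mul0r; apply: left; exact: step.
  by rewrite chi_sign// => t t01; rewrite segv NN; apply: right; exact: step.
(* What remains is the sign at (1, 1) minus the sign at (1, 0), which is 1 and should be 0. *)
rewrite telescope_sumr// /sg /pt NN mul0r (ltW G11) leNgt G10/=.
by [].
Qed.

End SquareCrossing.

(** * Planar curves *)

Section ExponentialSums.
Context {R : realType}.
Implicit Types (l : seq (R * R)) (rs : seq R).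

Lemma rolle_path (h dh : R -> R) (x : R) rs :
  (forall z : R, is_derive z 1 h (dh z)) ->
  path <%R x rs -> h x = 0 -> (forall r, r \in rs -> h r = 0) ->
  exists rs', [/\ path <%R x rs', size rs' = size rs & forall r, r \in rs' -> dh r = 0].
Proof.
move=> dhP; elim: rs x => [|y rs IH] x; first by exists [::].
move=> /= /andP[xy yrs] hx hrs.
have hy : h y = 0 by apply: hrs; rewrite mem_head.
have [|rs' [yrs' srs' drs']] := IH y yrs hy.
  by move=> r rrs; apply: hrs; rewrite inE rrs orbT.
have drv z : derivable h z 1 by have [] := dhP z.
have cts : {within `[x, y], continuous h}.
  apply: continuous_subspaceT => z; apply: differentiable_continuous.
  exact/derivable1_diffP.
have [c] := Rolle xy (fun z _ => drv z) cts (etrans hx (esym hy)).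
rewrite in_itv/= => /andP[xc cy] [_ dc].
exists (c :: rs'); split => /=; rewrite ?srs'//.
  rewrite xc/=; case: rs' yrs' {srs' drs'} => //= z rs' /andP[yz ->].
  by rewrite (lt_trans cy yz).
move=> r; rewrite inE => /orP[/eqP ->|/drs'//].
by have [_ e] := dhP c; rewrite -e dc.
Qed.

Definition expsum1 l (s : R) : R := \sum_(p <- l) p.1 * expR (p.2 * s).

Lemma is_derive_expsum1 l (s : R) :
  is_derive s 1 (expsum1 l) (expsum1 [seq (p.1 * p.2, p.2) | p <- l] s).
Proof.
rewrite /expsum1 big_map; elim: l => [|p l IH].
  rewrite big_nil (_ : (fun _ => _) = cst 0); first exact: is_derive_cst.
  by apply/funext => t; rewrite big_nil.
rewrite big_cons (_ : (fun _ => _) =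
   (fun t => p.1 * expR (p.2 * t)) \+ (fun t => \sum_(q <- l) q.1 * expR (q.2 * t)));
     last first.
  by apply/funext => t; rewrite big_cons.
apply: is_deriveD.
have lin : is_derive s 1 (fun t : R => p.2 * t) p.2.
  rewrite -[X in is_derive _ _ _ X]mulr1.
  exact: (@is_deriveZ R _ _ (@id R) p.2 s 1 1 (is_derive_id _ _)).
have comp := @is_derive1_comp R _ _ _ _ _ (is_derive_expR _) lin.
rewrite /= (_ : p.1 * p.2 * _ = p.1 * (expR (p.2 * s) * p.2)); last by ring.
exact: (@is_deriveZ R _ _ _ p.1 s 1 _ comp).
Qed.

(* Descartes' bound: differentiating after division by one term removes it. *)
Lemma expsum1_roots l rs : l != [::] -> uniq (map snd l) ->
  (forall p, p \in l -> p.1 != 0) -> uniq rs ->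
  (forall r, r \in rs -> expsum1 l r = 0) -> (size rs < size l)%N.
Proof.
have [m] := ubnP (size l); elim: m l rs => // m IH [//|[c b] l] rs.
rewrite ltnS => lm _ /= /andP[bl ul] nz urs zrs.
have c0 : c != 0 by apply: (nz (c, b)); rewrite mem_head.
pose l1 := [seq (p.1, p.2 - b) | p <- (c, b) :: l].
have zl1 r : r \in rs -> expsum1 l1 r = 0.
  move=> /zrs zr; rewrite -[RHS](mulr0 (expR (- (b * r)))) -zr /expsum1 big_map mulr_sumr.
  by apply: eq_bigr => p _; rewrite /= mulrBl expRD; ring.
pose l2 := [seq (p.1 * (p.2 - b), p.2 - b) | p <- l].
have dl1 (s : R) : is_derive s 1 (expsum1 l1) (expsum1 l2 s).
  have := is_derive_expsum1 l1 s.
  rewrite /l1 -map_comp /= {2}/expsum1 big_cons /= subrr mulr0 mul0r add0r.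
  by rewrite /expsum1 !big_map.
pose srs := sort <=%R rs.
have lt_srs : sorted <%R srs.
  by rewrite lt_sorted_uniq_le sort_uniq urs sort_le_sorted.
have zsrs r : r \in srs -> expsum1 l1 r = 0 by rewrite mem_sort; exact: zl1.
rewrite -(size_sort <=%R rs) -/srs.
case: srs lt_srs zsrs => [//|x xs] /= pxs zxs.
have [|rs' [prs' srs' drs']] := rolle_path dl1 pxs (zxs x (mem_head _ _)).
  by move=> r rxs; apply: zxs; rewrite inE rxs orbT.
have [l0|l0] := eqVneq l [::].
  have := zxs x (mem_head _ _).
  by rewrite /l1 l0 /expsum1 /= big_seq1/= subrr mul0r expR0 mulr1 => /eqP; rewrite (negPf c0).
rewrite ltnS -srs' -(size_map (fun p : R * R => (p.1 * (p.2 - b), p.2 - b)) l).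
apply: IH => //.
- by rewrite size_map.
- by case: l l0 {lm bl ul nz zrs zl1 l1 l2 dl1 zxs drs'}.
- rewrite -map_comp (map_comp (fun x => x - b) snd) map_inj_uniq//.
  exact: addIr.
- move=> _ /mapP[p pl ->]; rewrite mulf_neq0 ?nz ?inE ?pl ?orbT// subr_eq0.
  by apply: contraNneq bl => <-; exact: map_f.
- by apply: (sorted_uniq lt_trans); [exact: ltxx|exact: path_sorted prs'].
Qed.

End ExponentialSums.

(** However short, a step from [a] in direction [- w] leaves the half-space containing the
    polytope. *)
Lemma face_boundary (R : realType) (n : nat) (f : fewnomial R n) w a :
  w != 0 -> face (supp f) w a -> boundary (newton f) a.
Proof.
move=> w0 [fa wa]; split; first by apply: subset_closure; exact: supp_newton.
move=> /nbhs_ballP[r /= r0 ar].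
pose k := r / 2 / (`|w| + 1).
have w1 : 0 < `|w| + 1 by rewrite ltr_wpDl.
have k0 : 0 < k by rewrite !divr_gt0.
have : newton f (a - k *: w).
  apply: ar; rewrite -ball_normE/= opprB addrC subrK normrZ gtr0_norm//.
  rewrite (@le_lt_trans _ _ (k * (`|w| + 1)))//; first by rewrite ler_wpM2l ?(ltW k0)// lerDl.
  by rewrite /k divfK ?gt_eqF// ltr_pdivrMr// mulr_natr mulr2n ltrDl.
move=> /(newton_halfspace wa); rewrite dotBr dotZr lerBrDl -lerBrDr subrr leNgt.
by rewrite mulr_gt0// dot_gt0.
Qed.

(** * Edges of the Newton polygon and their ends *)

Section Plane.
Context {R : realType}.
Implicit Types (w x y z : 'rV[R]_2).

Definition rot w : 'rV[R]_2 := \row_j (if j == 0 then - w 0 1 else w 0 0).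

Lemma dot2 x y : dot x y = x 0 0 * y 0 0 + x 0 1 * y 0 1.
Proof.
rewrite /dot big_ord_recl big_ord1; congr (_ + x 0 _ * y 0 _); exact: val_inj.
Qed.

Lemma dot_rot w x : dot w (rot x) = - dot (rot w) x.
Proof. by rewrite !dot2 !mxE/=; ring. Qed.

Lemma dot_rot_self w : dot w (rot w) = 0.
Proof. by rewrite !dot2 !mxE/=; ring. Qed.

Lemma dot_rot_rot w : dot (rot w) (rot w) = dot w w.
Proof. by rewrite !dot2 !mxE/=; ring. Qed.

Lemma row2P x y : x 0 0 = y 0 0 -> x 0 1 = y 0 1 -> x = y.
Proof.
move=> e0 e1; apply/rowP => i.
by have [->|->] : i = 0 \/ i = 1; [case: i => [[|[|]]]// ?; [left|right]; exact: val_inj| |].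
Qed.

Lemma rot_decomp w x : dot w w = 1 ->
  x = dot w x *: w + dot (rot w) x *: rot w.
Proof.
rewrite !dot2 => w1; apply: row2P; rewrite !mxE/=.
  by rewrite -[LHS]mulr1 -w1; ring.
by rewrite -[LHS]mulr1 -w1; ring.
Qed.

Lemma orth_unique w x d : dot w w = 1 -> d != 0 -> dot w d = 0 -> dot x d = 0 ->
  x = dot w x *: w.
Proof.
move=> w1 d0 wd xd; rewrite [LHS](rot_decomp x w1).
have dE := rot_decomp d w1; rewrite wd scale0r add0r in dE.
have rd : dot (rot w) d != 0 by apply: contraNneq d0 => rd; rewrite dE rd scale0r.
have : dot (rot w) d * dot x (rot w) = 0 by rewrite -dotZr -dE.
by move/eqP; rewrite mulf_eq0 (negPf rd)/= dotC => /eqP ->; rewrite scale0r addr0.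
Qed.

End Plane.

Section PlanarEnds.
Context {R : realType}.
Variable f : fewnomial R 2.
Implicit Types (a b u v w x y p q : 'rV[R]_2) (C : set 'rV[R]_2) (t : R).

Local Notation S := (finsupp f).
Local Notation initsum w := (expsum (finsupp f) (initc f w)).

Lemma initsum_shift w q t : initsum w (q + t *: w) = 0 <-> initsum w q = 0.
Proof.
have [h hP] : exists h, forall a, face (supp f) w a -> dot w a = h.
  have [[a0 wa0]|nf] := pselect (exists a, face (supp f) w a).
    by exists (dot w a0) => a wa; exact: face_val wa wa0.
  by exists 0 => a wa; case: nf; exists a.
have -> : initsum w (q + t *: w) = expR (t * h) * initsum w q.
  rewrite expsumD -expsumZ; apply: eq_expsum => a _; rewrite /initc.
  by case: asboolP => [wa|]; rewrite ?mul0r ?mulr0// mulrC dotZr dotC hP.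
split => [/eqP|->]; last by rewrite mulr0.
by rewrite mulf_eq0 gt_eqF ?expR_gt0// => /eqP.
Qed.

Lemma attached_shift C w q t : attached C w q -> attached C w (q + t *: w).
Proof.
move=> aC r T r0; have [x [s [xr Ts Cx]]] := aC r (T - t) r0.
exists (x + t *: w), (s + t); split.
- by rewrite opprD addrACA subrr addr0.
- by rewrite -lerBlDr.
- by rewrite scalerDl opprD [- _ + - _]addrC addrA addrK.
Qed.

(** The zeros of the initial form are lines parallel to [w]; [s] locates such a line by its foot on
    the orthogonal line through the origin. *)
Definition edge_root w (s : R) : Prop := initsum w (s *: rot w) = 0.

(* Dropping the first support point of each edge, in counterclockwise order,
   makes the edges disjoint. *)
Definition edge_tail w : seq 'rV[R]_2 :=
  [seq a <- S | `[< face (supp f) w a >] &&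
     has (fun b => `[< face (supp f) w b >] && (dot (rot w) b < dot (rot w) a)) S].

Lemma edge_tail_uniq w : uniq (edge_tail w).
Proof. exact/filter_uniq/fset_uniq. Qed.

Lemma edge_tailP w a : a \in edge_tail w -> face (supp f) w a /\
  exists2 b, face (supp f) w b & dot (rot w) b < dot (rot w) a.
Proof.
rewrite mem_filter => /andP[/andP[/asboolP wa /hasP[b _ /andP[/asboolP wb ba]]] _].
by split => //; exists b.
Qed.

(** A common point [a] has predecessors [b] and [b'] on the two edges. Minimality of [w] tested on
    [b'] and of [w'] tested on [b] bounds one determinant from both sides, so [w'] is [w] or [- w];
    the latter would make [w] constant on the support. *)
Lemma edge_tail_disjoint w w' a : spanning f -> dot w w = 1 -> dot w' w' = 1 ->
  a \in edge_tail w -> a \in edge_tail w' -> w = w'.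
Proof.
move=> [_ sp] w1 w'1 /edge_tailP[wa [b wb ba]] /edge_tailP[wa' [b' wb' ba']].
have bE : b - a = - (dot (rot w) a - dot (rot w) b) *: rot w.
  rewrite [LHS](rot_decomp _ w1) dotBr (face_val wb wa) subrr scale0r add0r.
  by rewrite dotBr opprB.
have bE' : b' - a = - (dot (rot w') a - dot (rot w') b') *: rot w'.
  rewrite [LHS](rot_decomp _ w'1) dotBr (face_val wb' wa') subrr scale0r add0r.
  by rewrite dotBr opprB.
rewrite -subr_gt0 in ba; rewrite -subr_gt0 in ba'.
have h1 : dot w (rot w') <= 0.
  have := proj2 wa _ (face_supp wb'); rewrite -subr_ge0 -dotBr bE' dotZr mulNr oppr_ge0.
  by rewrite pmulr_rle0.
have h2 : dot w' (rot w) <= 0.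
  have := proj2 wa' _ (face_supp wb); rewrite -subr_ge0 -dotBr bE dotZr mulNr oppr_ge0.
  by rewrite pmulr_rle0.
have h0 : dot (rot w) w' = 0.
  apply/eqP; rewrite eq_le; apply/andP; split; first by rewrite dotC.
  by move: h1; rewrite dot_rot oppr_le0.
have wE : w' = dot w w' *: w by rewrite [LHS](rot_decomp _ w1) h0 scale0r addr0.
have : dot w w' ^+ 2 = 1 by move: w'1; rewrite {1}wE dotZl -expr2.
move=> /eqP; rewrite sqrf_eq1 => /orP[/eqP k1|/eqP k1]; first by rewrite wE k1 scale1r.
suff w0 : w = 0 by move: w1; rewrite w0 dot0l => /eqP; rewrite eq_sym oner_eq0.
have const c : c \in S -> dot w c = dot w a.
  move=> fc; apply/eqP; rewrite eq_le (proj2 wa)// andbT.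
  by have := proj2 wa' _ fc; rewrite wE k1 scaleN1r !dotNl lerN2.
by apply: sp => c d fc fd; rewrite !const.
Qed.

(** On the line of [rot w] the initial form is a sum of exponentials in one variable, with a term
    for each support point of the edge. Descartes' bound is one less, and [edge_tail] omits only the
    minimal point [m]. *)
Lemma edge_roots_le w (rs : seq R) : dot w w = 1 -> (exists a, a \in S) ->
  uniq rs -> (forall s, s \in rs -> edge_root w s) -> (size rs <= size (edge_tail w))%N.
Proof.
move=> w1 f0 urs zrs; have [a0 wa0] := face_exists w f0.
pose F := [seq a <- S | `[< face (supp f) w a >]].
have uF : uniq F by exact/filter_uniq/fset_uniq.
have F0 : a0 \in F by rewrite mem_filter (face_supp wa0) andbT; apply/asboolP.
have FP a : a \in F -> face (supp f) w a by rewrite mem_filter => /andP[/asboolP].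
have [m mF mmin] := @seq_argmin _ _ F (dot (rot w)) (ex_intro _ a0 F0).
have inj : {in F &, injective (dot (rot w))}.
  move=> a b /FP wa /FP wb e; rewrite [LHS](rot_decomp _ w1) [RHS](rot_decomp _ w1).
  by rewrite e (face_val wa wb).
have szF : (size F <= (size (edge_tail w)).+1)%N.
  apply: (@uniq_leq_size _ F (m :: edge_tail w)) => // a aF; rewrite inE.
  have [//|am] := eqVneq a m; have wa := FP _ aF; rewrite mem_filter (face_supp wa) andbT.
  apply/andP; split; first exact/asboolP.
  apply/hasP; exists m; first exact/face_supp/FP.
  apply/andP; split; first exact/asboolP/FP.
  rewrite lt_neqAle mmin// andbT; apply: contra_neq am => /inj e.
  exact/esym/e.
pose l := [seq (f a, dot (rot w) a) | a <- F].
have expl s : expsum1 l s = initsum w (s *: rot w).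
  rewrite /expsum1 big_map big_filter big_mkcond; apply: eq_bigr => a _ /=.
  rewrite /initc; case: asboolP => _; last by rewrite mul0r.
  by rewrite dotZr [dot a _]dotC [s * _]mulrC.
rewrite -ltnS; apply: leq_trans szF; rewrite -(size_map (fun a => (f a, dot (rot w) a)) F).
apply: expsum1_roots => //.
- by rewrite -size_eq0 size_map -lt0n (leq_ltn_trans _ (_ : (index a0 F < _)%N))// index_mem.
- by rewrite -map_comp map_inj_in_uniq.
- by move=> _ /mapP[a /FP/face_supp fa ->] /=; rewrite -mem_finsupp.
- by move=> s /zrs; rewrite expl.
Qed.

(** A list of distinct roots of maximal length contains every root. *)
Lemma edge_roots_enum w : dot w w = 1 -> (exists a, a \in S) ->
  exists rs, [/\ uniq rs, (forall s, edge_root w s -> s \in rs) &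
    (size rs <= size (edge_tail w))%N].
Proof.
move=> w1 f0; pose P rs := `[< uniq rs /\ forall s, s \in rs -> edge_root w s >].
pose Q k := `[< exists2 rs, P rs & size rs = k >].
have Q0 : exists k, Q k by exists 0%N; apply/asboolP; exists [::] => //; apply/asboolP; split.
have Qle k : Q k -> (k <= size (edge_tail w))%N.
  by move=> /asboolP[rs /asboolP[urs zrs] <-]; exact: edge_roots_le.
case: (ex_maxnP Q0 Qle) => k /asboolP[rs /asboolP[urs zrs] srs] kmax.
exists rs; split => //; last exact: edge_roots_le.
move=> s zs; apply: contrapT => /negP nrs.
have := kmax (size (s :: rs)); rewrite /= srs ltnn => /(_ _)/negP; apply; last by [].
apply/asboolP; exists (s :: rs); last by rewrite /= srs.
apply/asboolP; split; first by rewrite /= nrs.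
by move=> r; rewrite inE => /orP[/eqP->//|]; exact: zrs.
Qed.

(* Each end is sent to a support point of its edge, by rank among the roots. *)
Lemma ends_le (L : seq ('rV[R]_2 * R)) : spanning f -> uniq L ->
  (forall e, e \in L -> dot e.1 e.1 = 1 /\ edge_root e.1 e.2) ->
  (size L <= num_support_in f (boundary (newton f)))%N.
Proof.
move=> sp uL LP; have [f0 _] := sp.
have ex w : exists rs, dot w w = 1 -> [/\ uniq rs, (forall s, edge_root w s -> s \in rs) &
    (size rs <= size (edge_tail w))%N].
  have [w1|nw1] := pselect (dot w w = 1); last by exists [::].
  by have [rs h] := edge_roots_enum w1 f0; exists rs.
have [rts rtsP] := choice ex.
pose code e := nth 0 (edge_tail e.1) (index e.2 (rts e.1)).
have idx e : e \in L -> (index e.2 (rts e.1) < size (edge_tail e.1))%N.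
  move=> /LP[w1 z]; have [_ /(_ _ z) rz] := rtsP _ w1.
  by apply: leq_trans; rewrite index_mem.
have codeL e : e \in L -> code e \in edge_tail e.1 by move=> /idx ei; exact: mem_nth.
rewrite -(size_map code L); apply: uniq_leq_size.
  rewrite map_inj_in_uniq// => e e' eL eL' ee.
  have [w1 z] := LP _ eL; have [w1' z'] := LP _ eL'.
  have ww : e.1 = e'.1.
    by apply: (@edge_tail_disjoint _ _ (code e)) => //; [exact: codeL|rewrite ee;
      exact: codeL].
  have [_ mem _] := rtsP _ w1.
  move: (idx _ eL') z' ee; rewrite /code -ww => idx' z' /eqP.
  rewrite (nth_uniq _ (idx _ eL) idx' (edge_tail_uniq _)) => /eqP ii.
  have ss : e.2 = e'.2 by rewrite -(nth_index 0 (mem _ z)) ii nth_index// mem.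
  by case: e e' ww ss {eL eL' w1 z w1' z' idx' ii mem} => [? ?] [? ?] /= -> ->.
move=> _ /mapP[e eL ->]; have [wa _] := edge_tailP (codeL _ eL).
rewrite !inE (face_supp wa); apply/asboolP; apply: face_boundary wa.
by rewrite -dot_eq0 (proj1 (LP _ eL)) oner_eq0.
Qed.

End PlanarEnds.

(** Arithmetic of the trapezoid in [two_ends], of half-length [a] and with half-width decreasing
    from [4 * k + e] at [z = 0] to [e] at [z = 1]. Points with abscissa less than [k] have
    [z <= 3 / 4], where the half-width is still at least [k]; hence the factor 4. *)
Lemma trapezoid_abscissa (R : realFieldType) (z a k : R) : 0 < a -> 2 * k <= a ->
  `|(2 * z - 1) * a| < k -> z <= 3 / 4.
Proof.
move=> a0 ka /(le_lt_trans (ler_norm _)) h; rewrite leNgt; apply/negP => z34.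
have : a / 2 < (2 * z - 1) * a by rewrite mulrC ltr_pM2r//; lra.
by move: h ka; clear; lra.
Qed.

Lemma trapezoid_ordinate (R : realFieldType) (z e k : R) : 0 < e -> 0 < k ->
  z <= 3 / 4 -> k <= (4 * k + e) * (1 - z).
Proof.
move=> e0 k0 z34; rewrite (@le_trans _ _ ((4 * k + e) * (1 / 4)))//; first by lra.
by rewrite ler_pM2l ?addr_gt0 ?mulr_gt0//; lra.
Qed.

Lemma trapezoid_width (R : realFieldType) (t e k : R) : 0 < e -> 0 < k -> 0 <= t <= 1 ->
  let b := (4 * k + e) * (1 - t) + e * t in e <= b /\ (4 * k + e) * (1 - t) <= b.
Proof.
move=> e0 k0 /andP[t0 t1] /=; have : 0 <= k * (1 - t) by rewrite mulr_ge0 ?subr_ge0// ltW.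
have : 0 <= e * t by rewrite mulr_ge0// ltW.
by split; lra.
Qed.

(** * The two ends of a noncompact planar component *)

Section TwoEnds.
Context {R : realType}.
Variable f : fewnomial R 2.
Implicit Types (a b u v w x y p q : 'rV[R]_2) (C : set 'rV[R]_2) (t : R).

Local Notation S := (finsupp f).
Local Notation initsum w := (expsum (finsupp f) (initc f w)).

Hypothesis smooth_init_terms : forall w, w != 0 -> smooth_zeros (init_term w f).
Hypothesis span_f : spanning f.

(** In the plane, a proper face whose initial form has a zero contains two support points, so it is
    an edge and [u y] is a multiple of its normal. Thus the whole ultrafilter follows one ray. *)
Lemma limit_ray (G : set_system 'rV[R]_2) : UltraFilter G ->
  G (logzeros f) -> (forall r : R, G [set y | r < `|y|]) ->
  exists w q, [/\ dot w w = 1, facet_dir f w, initsum w q = 0 &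
    forall r T : R, 0 < r ->
      G [set y | exists x t, [/\ `|x - q| < r, T <= t & y = x - t *: w]]].
Proof.
move=> UG GZ Gunb.
have [w0 [p [u [a0 [[w00 wa0] p0 ucvg ueq uinf]]]]] := limit_face span_f UG GZ Gunb.
have [b wb ba0] : exists2 b, face (supp f) w0 b & b != a0.
  apply: contrapT => nb; move: p0; rewrite /expsum (big_rem a0 (face_supp wa0))/=.
  rewrite big1_seq ?addr0 => [|b /andP[_]].
    rewrite /initc asboolT// => /eqP; rewrite mulf_eq0 (gt_eqF (expR_gt0 _)) orbF.
    by apply/negP; rewrite -mem_finsupp; exact: face_supp wa0.
  rewrite (mem_rem_uniq _ (fset_uniq _)) inE => /andP[ba _].
  rewrite /initc asboolF ?mul0r// => wb; apply: nb; by exists b.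
have d0 : b - a0 != 0 by rewrite subr_eq0.
pose k0 := Num.sqrt (dot w0 w0).
have k0_gt0 : 0 < k0 by rewrite sqrtr_gt0 dot_gt0.
pose w := k0^-1 *: w0.
have w1 : dot w w = 1.
  rewrite dotZl dotZr mulrA -expr2 exprVn sqr_sqrtr ?dot_ge0//.
  by rewrite mulVf// dot_eq0.
have fwE : face (supp f) w = face (supp f) w0 by rewrite face_scale// invr_gt0.
have wd : dot w (b - a0) = 0.
  by apply/eqP; rewrite dotBr subr_eq0; apply/eqP/(face_val (f := f)); rewrite fwE.
(* The gap at one support point off the edge converts the growth of [u y] into growth of the
   parameter along the ray. *)
have [c fc nwc] : exists2 c, c \in S & ~ face (supp f) w c.
  apply: contrapT => nc; have [_ sp] := span_f.
  have w_0 : w = 0.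
    apply: sp => a c fa fc; have all e : e \in S -> face (supp f) w e.
      by move=> fe; apply: contrapT => ne; apply: nc; exists e.
    by rewrite (face_val (all _ fa) (all _ fc)).
  by move: w1; rewrite w_0 dot0l => /eqP; rewrite eq_sym oner_eq0.
have wa : face (supp f) w a0 by rewrite fwE.
have gap : 0 < dot w c - dot w a0.
  rewrite subr_gt0 lt_neqAle (proj2 wa)// andbT; apply/eqP => e; apply: nwc.
  by split => // e' fe'; rewrite -e (proj2 wa).
have uE y : u y = dot w (u y) *: w.
  by apply: (orth_unique w1 d0 wd); rewrite dotBr (ueq y b wb) subrr.
exists w, p; split => //.
- move=> v vc; exists (dot w v); apply: (orth_unique w1 d0 wd).
  by rewrite dotBr (vc b a0) ?subrr// fwE.
- have -> // : initsum w p = initsum w0 p.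
  by apply: eq_expsum => a _; rewrite /initc fwE.
move=> r T r0.
have G1 : \forall y \near G, `|p - (y + u y)| < r by move/cvgrPdist_lt : ucvg; apply.
have G2 : G [set y | T * (dot w c - dot w a0) <= dot (u y) c - dot (u y) a0].
  by apply: uinf => //; rewrite -fwE.
apply: filterS2 G1 G2 => y yr; rewrite /= => yT.
exists (y + u y), (dot w (u y)); split; first by rewrite distrC.
  have uc z : dot (u y) z = dot w (u y) * dot w z by rewrite {1}uE dotZl.
  by move: yT; rewrite !uc -mulrBr ler_pM2r.
by rewrite -uE addrK.
Qed.

(** Here smoothness of [f] itself enters: around a point of [C] all zeros lie on one connected
    graph, so [C] is open in the zero set. *)
Lemma rest_closed C : smooth_zeros f -> components (logzeros f) C ->
  closed (logzeros f `\` C).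
Proof.
move=> sm cC y cly.
have zy : logzeros f y.
  rewrite (closure_id (logzeros f)).1; last exact: expzeros_closed.
  by apply: closure_subset cly => z [].
split => // Cy; have [v v0] := smooth_expdir sm zy.
have [e [r [eta [/andP[e0 _] r0 eta0 cr]]]] := local_graph zy v0 ltr01.
have [|Gr [cGr GrZ Grz _]] := zero_graph_connected e0 (tube_connected (p := y) (w := 0)
  (r := r) (T := 0)) (c := f) (S := S) (v := v).
  move=> _ [x [t [xr _ ->]]]; rewrite scaler0 subr0; apply: cr => //.
  by move=> a _; rewrite subrr normr0 ltW.
have inGr z : logzeros f z -> `|z - y| <= r -> Gr z.
  move=> zz zr; have := Grz z 0; rewrite scale0r addr0 normr0; apply => //.
    by exists z, 0; rewrite scaler0 subr0.
  exact: ltW.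
have GrC : Gr `<=` C.
  apply: (component_max cC Cy) => //; apply: inGr => //.
  by rewrite subrr normr0 ltW.
have [z [[zz nCz] yz]] := cly _ (nbhsx_ballx y r r0).
apply: nCz; apply: GrC; apply: inGr => //.
by move: yz; rewrite -ball_normE/= distrC => /ltW.
Qed.

(** At a zero, the derivative of the initial form along [w] is [h] times its value, hence zero.
    Smoothness leaves a nonzero derivative along [rot w], and [v] is [rot w] up to sign. *)
Lemma expdir_edge w p : dot w w = 1 -> initsum w p = 0 ->
  exists v, [/\ dot v v = 1, dot w v = 0 & 0 < expdir S (initc f w) v p].
Proof.
move=> w1 p0; have w0 : w != 0 by rewrite -dot_eq0 w1 oner_eq0.
have [z z0] := smooth_init (smooth_init_terms w0) p0.
have [h hP] : exists h, forall a, face (supp f) w a -> dot w a = h.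
  have [[a0 wa0]|nf] := pselect (exists a, face (supp f) w a).
    by exists (dot w a0) => a wa; exact: face_val wa wa0.
  by exists 0 => a wa; case: nf; exists a.
have zE : expdir S (initc f w) z p = dot (rot w) z * expdir S (initc f w) (rot w) p.
  transitivity (dot w z * (h * initsum w p) +
    dot (rot w) z * expdir S (initc f w) (rot w) p).
    rewrite -expsumZ -!expsumZ -big_split; apply: eq_bigr => a _ /=.
    rewrite /initc; case: asboolP => wa; last by rewrite !(mul0r, mulr0) addr0.
    rewrite {1}(rot_decomp z w1) dotDr !dotZr -(hP _ wa) (dotC a w); ring.
  by rewrite p0 !mulr0 add0r.
have [s0|s0] := ltP 0 (expdir S (initc f w) (rot w) p).
  by exists (rot w); rewrite dot_rot_rot dot_rot_self.
exists (- rot w); rewrite !dotNr dotNl opprK dot_rot_rot dot_rot_self oppr0; split => //.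
have -> : expdir S (initc f w) (- rot w) p = - expdir S (initc f w) (rot w) p.
  by rewrite -mulN1r -expsumZ; apply: eq_expsum => a _; rewrite dotNr mulN1r mulrN.
rewrite oppr_gt0 lt_neqAle s0 andbT; apply/eqP => s00.
by move: z0; rewrite zE s00 mulr0 ltxx.
Qed.

Lemma orth_frame w v x : dot w w = 1 -> dot v v = 1 -> dot w v = 0 ->
  x = dot w x *: w + dot v x *: v.
Proof.
move=> w1 v1 wv; have vE := rot_decomp v w1; rewrite wv scale0r add0r in vE.
have k2 : dot (rot w) v ^+ 2 = 1.
  have := congr1 (fun z => dot z z) vE.
  by rewrite v1 dotZl dotZr dot_rot_rot w1 mulr1 -expr2 => <-.
rewrite {1}(rot_decomp x w1); congr (_ + _).
by rewrite [in RHS]vE dotZl scalerA mulrAC -expr2 k2 mul1r.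
Qed.

Lemma two_ends C : smooth_zeros f -> components (logzeros f) C -> ~ compact C ->
  exists e1 e2 : 'rV[R]_2 * R, e1 != e2 /\
    forall e, e \in [:: e1; e2] ->
      [/\ unit_facet_normal (newton f) e.1, edge_root f e.1 e.2 &
        attached C e.1 (e.2 *: rot e.1)].
Proof.
move=> sm cC ncC; have [f0 _] := span_f.
pose good (e : 'rV[R]_2 * R) := [/\ unit_facet_normal (newton f) e.1, edge_root f e.1 e.2 &
        attached C e.1 (e.2 *: rot e.1)].
have normalize w q : dot w w = 1 -> facet_dir f w -> initsum w q = 0 ->
    attached C w q -> good (w, dot (rot w) q).
  move=> w1 fw q0 aq; have qE := rot_decomp q w1.
  have qE' : dot (rot w) q *: rot w = q + - dot w q *: w.
    by rewrite {2}qE scaleNr addrAC subrr add0r.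
  split => /=; first exact: facet_dir_unit.
    by rewrite /edge_root qE'; apply/initsum_shift.
  by rewrite qE'; exact: attached_shift.
have [w [q [w1 fw q0 aq]]] := attach_facet smooth_init_terms span_f cC ncC.
have good1 := normalize w q w1 fw q0 aq.
apply: contrapT => no2.
have uniq_end e : good e -> e = (w, dot (rot w) q).
  move=> ge; apply: contrapT => ne; apply: no2; exists e, (w, dot (rot w) q).
  split; first exact/eqP.
  by move=> e'; rewrite !inE => /orP[/eqP->|/eqP->].
pose p := dot (rot w) q *: rot w.
have [_ p0 ap] := good1; rewrite /= -/p in p0 ap.
have w0 : w != 0 by rewrite -dot_eq0 w1 oner_eq0.
have [v [v1 wv v0]] := expdir_edge w1 p0.
have [e [r [T [/andP[e0 _] r0 cr]]]] := tube_crossing w0 f0 p0 v0 ltr01.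
have [Gr [cGr GrZ Grz _]] := zero_graph_connected e0 (@tube_connected _ _ p w r T) cr.
have GrC : Gr `<=` C.
  have [x [t [xr Tt Cx]]] := ap r T r0.
  apply: (component_max cC Cx) => //.
  have := Grz (x - t *: w) 0; rewrite scale0r addr0 normr0; apply.
  - by exists x, t; rewrite ltW.
  - exact: ltW.
  - exact: (component_sub cC Cx).
pose Phi (t s : R) := p - t *: w + s *: v.
have tubePhi t : T <= t -> tube p w r T (p - t *: w).
  by move=> Tt; exists p, t; rewrite subrr normr0 (ltW r0).
have zPhi t s : T <= t -> `|s| <= e -> expsum S f (Phi t s) = 0 -> C (Phi t s).
  by move=> Tt se zs; apply: GrC; apply: Grz => //; exact: tubePhi.
pose Kw := \sum_(i < 2) `|w 0 i|; pose Kv := \sum_(i < 2) `|v 0 i|.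
pose K := Kw + Kv + 1.
have Kw0 : 0 <= Kw by apply: sumr_ge0. have Kv0 : 0 <= Kv by apply: sumr_ge0.
have K0 : 0 < K by rewrite ltr_wpDl// addr_ge0.
have dotwK z : `|dot w z| <= K * `|z|.
  by rewrite (le_trans (norm_dot_le _ _))// ler_wpM2r// /K -addrA lerDl addr_ge0.
have dotvK z : `|dot v z| <= K * `|z|.
  by rewrite (le_trans (norm_dot_le _ _))// ler_wpM2r// /K addrAC lerDr addr_ge0.
(* Otherwise points of [C] outside the tube escape to infinity along some ray; as there is only one
   end, it is the same ray, and they are in the tube after all. *)
have [rho rhoP] : exists rho : R, forall y, C y -> rho < `|y| ->
    exists t s, [/\ T <= t, `|s| < e & y = Phi t s].
  apply: contrapT => /forallNP unb.
  pose A := C `\` [set y | exists t s, [/\ T <= t, `|s| < e & y = Phi t s]].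
  have unbA (rho : R) : exists2 y, A y & rho < `|y|.
    apply: contrapT => nA; apply: (unb rho) => y Cy ry.
    by apply: contrapT => nt; apply: nA; exists y.
  have [G [UG GA Gunb]] := unbounded_ultra unbA.
  have GC : G C by apply: filterS GA => y [].
  have GZ : G (logzeros f) by apply: filterS GC; exact: component_sub.
  have [w' [q' [w'1 fw' q'0 ray]]] := limit_ray UG GZ Gunb.
  have aq' : attached C w' q'.
    move=> r2 T2 r20.
    have [y [[x [t [xr Tt ->]]] Cy]] := filter_ex (filterI (ray r2 T2 r20) GC).
    by exists x, t.
  have [ww' sE] := uniq_end _ (normalize w' q' w'1 fw' q'0 aq'); subst w'.
  have q'E : q' = p + dot w q' *: w by rewrite {1}(rot_decomp q' w1) sE addrC.
  (* Distance [e / K] keeps both coordinates of [x - q'] below [e], and the threshold makes up for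
     the shifts along [w]. *)
  have [y [[x [t [xr Tt yE]]] [_ nA]]] :=
    filter_ex (filterI (ray (e / K) (T + `|dot w q'| + e) (divr_gt0 e0 K0)) GA).
  apply: nA; exists (t - dot w q' - dot w (x - q')), (dot v (x - q')).
  have xK : K * `|x - q'| < e by rewrite mulrC -ltr_pdivlMr.
  split.
  - have h1 : dot w (x - q') <= e by rewrite (le_trans (ler_norm _))//
      (le_trans (dotwK _))// ltW.
    have h2 : dot w q' <= `|dot w q'| by exact: ler_norm.
    by move: h1 h2 Tt; clear; lra.
  - exact: le_lt_trans (dotvK _) xK.
  - have xE : x = dot w (x - q') *: w + dot v (x - q') *: v + (p + dot w q' *: w).
      by rewrite -orth_frame// -q'E subrK.
    rewrite yE /Phi {1}xE.
    move: (dot w (x - q')) (dot v (x - q')) (dot w q') => k1 k2 k3.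
    by apply/rowP => i; rewrite !mxE; ring.
(* Bounds both frame coordinates of the points of [C] of norm at most [rho]. *)
pose rho' := K * (`|rho| + `|p|) + 1.
have rho'0 : 0 < rho' by rewrite ltr_wpDl// mulr_ge0 ?addr_ge0// ltW.
have PhiE t s : dot w (p - Phi t s) = t /\ dot v (Phi t s - p) = s.
  have -> : p - Phi t s = t *: w - s *: v by apply/rowP => i; rewrite !mxE; ring.
  have -> : Phi t s - p = s *: v - t *: w by apply/rowP => i; rewrite !mxE; ring.
  by rewrite !dotBr !dotZr w1 v1 (dotC v w) wv !mulr0 !mulr1 !subr0.
have CPhi t s : C (Phi t s) -> (`|t| < rho' /\ `|s| < rho') \/ (T <= t /\ `|s| < e).
  move=> Cts; have [small|/(rhoP _ Cts)[t' [s' [Tt' se' E]]]] := leP `|Phi t s| rho.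
    have bd : `|Phi t s - p| <= `|rho| + `|p|.
      by rewrite (le_trans (ler_normB _ _))// lerD2r (le_trans small)// ler_norm.
    have bdK : K * `|Phi t s - p| < rho'.
      by rewrite (@le_lt_trans _ _ (K * (`|rho| + `|p|)))// ?ltrDl// ler_pM2l.
    left; have [tE sE] := PhiE t s; split.
      by rewrite -tE (le_lt_trans (dotwK _))// distrC.
    by rewrite -sE (le_lt_trans (dotvK _)).
  have [tE sE] := PhiE t s; have [tE' sE'] := PhiE t' s'; right.
  have -> : t = t' by rewrite -tE' -E.
  by have -> : s = s' by rewrite -sE' -E.
(* So large that the side [t = T1] lies in the tube and the side [t = - T1] misses [C]; [M] is the
   half-width of the latter. *)
pose T1 := `|T| + 2 * rho' + 1; pose M := 4 * rho' + e.
have T1T : T <= T1.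
  by rewrite /T1 -addrA (le_trans (ler_norm T))// lerDl addr_ge0// ltW// mulr_gt0.
have T1rho : 2 * rho' <= T1.
  by rewrite /T1 -addrA addrC -addrA lerDl addr_ge0.
have T1N : - T1 < T.
  have := ler_norm (- T); rewrite normrN /T1; move: rho'0; clear; lra.
(* The square is mapped to a trapezoid: the side across the tube has half-width [e], since there
   zeros are known to lie on [C], while the bounded part of [C] calls for a much wider opposite
   side. *)
pose tt (z : R * R) := (2 * z.1 - 1) * T1.
pose ss (z : R * R) := (2 * z.2 - 1) * (M * (1 - z.1) + e * z.1).
pose H z := Phi (tt z) (ss z).
have side z : 0 <= z.1 <= 1 -> e <= `|ss z| -> M * (1 - z.1) <= `|ss z| -> ~ C (H z).
  move=> /andP[z0 z1] es Ms /CPhi[[t1 s1]|[_ s1]]; last by rewrite ltNge es in s1.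
  have : M * (1 - z.1) < rho' by exact: le_lt_trans Ms s1.
  apply/negP; rewrite -leNgt.
  have z34 : z.1 <= 3 / 4.
    by apply: (trapezoid_abscissa _ T1rho t1); rewrite (lt_le_trans _ T1rho)// mulr_gt0.
  exact: (trapezoid_ordinate e0 rho'0 z34).
have two1 : 2 - 1 = 1 :> R by rewrite -[2]/(1 + 1) addrK.
have ss_side (t b : R) : 0 <= t <= 1 -> (b == 0) || (b == 1) -> ~ C (H (t, b)).
  move=> t01 b01; have [w_e w_M] := trapezoid_width e0 rho'0 t01.
  have ssE : `|ss (t, b)| = M * (1 - t) + e * t.
    have b0 : 0 <= M * (1 - t) + e * t by rewrite (le_trans (ltW e0)).
    rewrite normrM (ger0_norm b0); suff -> : `|2 * b - 1| = 1 by rewrite mul1r.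
    case/orP: b01 => /eqP -> /=; first by rewrite mulr0 sub0r normrN1.
    by rewrite mulr1 two1 normr1.
  by apply: side => //; rewrite ssE.
have cH : continuous H.
  have c1 : continuous (fst : R * R -> R) by move=> z; exact: cvg_fst.
  have c2 : continuous (snd : R * R -> R) by move=> z; exact: cvg_snd.
  have ctt : continuous tt.
    move=> z; apply: cvgM; last exact: cvg_cst.
    by apply: cvgB; [apply: cvgM; [exact: cvg_cst|exact: c1]|exact: cvg_cst].
  have css : continuous ss.
    move=> z; apply: cvgM.
      by apply: cvgB; [apply: cvgM; [exact: cvg_cst|exact: c2]|exact: cvg_cst].
    apply: cvgD; last by apply: cvgM; [exact: cvg_cst|exact: c1].
    by apply: cvgM; [exact: cvg_cst|apply: cvgB; [exact: cvg_cst|exact: c1]].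
  move=> z; apply: cvgD; last by apply: cvgZr_tmp; exact: css.
  by apply: cvgB; [exact: cvg_cst|apply: cvgZr_tmp; exact: ctt].
have tt1 t : tt (1, t) = T1 by rewrite /tt/= mulr1 two1 mul1r.
have ss1 t : ss (1, t) = (2 * t - 1) * e by rewrite /ss/= subrr mulr0 add0r mulr1.
apply: (@square_crossing R (fun z => expsum S f (H z)) (H @^-1` C)
  (H @^-1` (logzeros f `\` C))).
- by move=> z; apply: (@continuous_comp _ _ _ H (expsum S f));
    [exact: cH|exact: expsum_continuous].
- by apply: closed_comp => [z _|]; [exact: cH|exact: component_logzeros_closed cC].
- by apply: closed_comp => [z _|]; [exact: cH|exact: rest_closed].
- by move=> z Az [].
- by move=> z zz; have [Cz|nCz] := pselect (C (H z)); [left|right; split].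
- by move=> t t01; apply: ss_side => //; rewrite eqxx.
- by move=> t t01; apply: ss_side => //; rewrite eqxx orbT.
- move=> t t01; rewrite /preimage/= => /CPhi.
  have -> : tt (0, t) = - T1 by rewrite /tt/= mulr0 sub0r mulN1r.
  rewrite normrN => -[[+ _]|[+ _]]; apply/negP; last by rewrite -ltNge.
  rewrite -leNgt (le_trans _ (ler_norm _))// (le_trans _ T1rho)//.
  by rewrite mulr_natl mulr2n lerDl ltW.
- move=> t /andP[t0 t1] [zz]; apply; move: zz; rewrite /H tt1 ss1; apply: zPhi => //.
  rewrite normrM (gtr0_norm e0) ler_piMl ?(ltW e0)// ler_norml.
  by apply/andP; split; lra.
(* The crossing at [p - T1 *: w] is the sign change that has been excluded. *)
rewrite /H !tt1 !ss1 mulr0 sub0r mulN1r mulr1 two1 mul1r /Phi scaleNr.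
by have [-> -> _] := cr _ (tubePhi _ T1T).
Qed.

End TwoEnds.

(** An end determines its component, so the ends of a list of distinct components are distinct and
    twice as many as the list. *)
Lemma num_noncompact_planar_le (R : realType) (f : fewnomial R 2) :
  (forall w, w != 0 -> smooth_zeros (init_term w f)) -> spanning f -> smooth_zeros f ->
  (num_noncompact_components f <=
   ((num_support_in f (boundary (newton f)))./2)%:R%:E)%E.
Proof.
move=> smi sp sm; rewrite num_noncompact_componentsE.
have [f0 _] := sp.
pose good C (e : 'rV[R]_2 * R) := [/\ unit_facet_normal (newton f) e.1,
  edge_root f e.1 e.2 & attached C e.1 (e.2 *: rot e.1)].
have ex C : exists ee : ('rV[R]_2 * R) * ('rV[R]_2 * R),
    noncompact_components (logzeros f) C ->
    [/\ ee.1 != ee.2, good C ee.1 & good C ee.2].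
  have [[cC ncC]|nC] := pselect (noncompact_components (logzeros f) C); last first.
    by exists ((0, 0), (0, 0)) => /nC.
  have [e1 [e2 [e12 ge]]] := two_ends smi sp sm cC ncC.
  exists (e1, e2) => _; split => //; first by apply: ge; rewrite mem_head.
  by apply: ge; rewrite !inE eqxx orbT.
have [ee eeP] := choice ex.
have inj C C' e e' : noncompact_components (logzeros f) C ->
    noncompact_components (logzeros f) C' ->
    good C e -> good C' e' -> e = e' -> C = C'.
  move=> [cC _] [cC' _] [u z aC] [_ _ aC'] eE; rewrite -eE in aC'.
  have w0 : e.1 != 0 by rewrite -dot_eq0 (proj1 u) oner_eq0.
  exact: (attached_unique w0 f0 (smi _ w0) z cC cC' aC aC').
apply: counting_le => s us sNC.
rewrite geq_half_double.
pose L := [seq (ee C).1 | C <- s] ++ [seq (ee C).2 | C <- s].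
have <- : size L = (size s).*2 by rewrite size_cat !size_map addnn.
apply: ends_le => //.
  rewrite cat_uniq; apply/and3P; split.
  - rewrite map_inj_in_uniq// => C C' /sNC NC /sNC NC'.
    by have [[_ g _] [_ g' _]] := (eeP _ NC, eeP _ NC'); exact: inj.
  - apply/hasPn => _ /mapP[C /sNC NC ->]; apply/mapP => -[C' /sNC NC'] e.
    have [[n g1 g2] [_ g' _]] := (eeP _ NC, eeP _ NC').
    have CC := inj _ _ _ _ NC NC' g2 g' e.
    by move: n; rewrite e CC eqxx.
  - rewrite map_inj_in_uniq// => C C' /sNC NC /sNC NC'.
    by have [[_ _ g] [_ _ g']] := (eeP _ NC, eeP _ NC'); exact: inj.
move=> e; rewrite mem_cat => /orP[] /mapP[C /sNC NC ->];
  have [_ [[w1 _] z _] [[w1' _] z' _]] := eeP _ NC.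
  by split.
by split.
Qed.

(** * Sharpness in the plane *)

Section Sharpness.
Context {R : realType}.
Variable d : nat.
Hypothesis d_gt0 : (0 < d)%N.
Implicit Types (a v w y : 'rV[R]_2) (k : nat).

Definition roots_poly (m : nat) : {poly R} := \prod_(i < m) ('X - i.+1%:R%:P).

Lemma roots_polyS m : roots_poly m.+1 = roots_poly m * ('X - m.+1%:R%:P).
Proof. by rewrite /roots_poly big_ord_recr. Qed.

Lemma size_roots_poly m : size (roots_poly m) = m.+1.
Proof. by rewrite /roots_poly size_prod_XsubC /index_enum -enumT size_enum_ord. Qed.

(** All roots are positive, so the coefficients alternate in sign; in particular none vanishes and
    every base point is in the support. *)
Lemma roots_poly_coef m k : (k <= m)%N -> 0 < (-1) ^+ (m - k) * (roots_poly m)`_k.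
Proof.
elim: m k => [|m IH] k.
  by rewrite leqn0 => /eqP ->; rewrite /roots_poly big_ord0 coef1 mulr1.
rewrite roots_polyS mulrBr coefB coefMX coefMC; case: k => [_|k].
  rewrite /= sub0r subn0 exprS mulN1r mulrNN mulrA mulr_gt0//.
  by have := IH 0%N; rewrite subn0; apply.
rewrite ltnS subSS /= => km; rewrite mulrBr subr_gt0.
apply: (@le_lt_trans _ _ 0); last exact: IH.
have [mk|mk] := leqP m k.
  by rewrite nth_default ?size_roots_poly ?ltnS// mul0r mulr0.
rewrite -(subnSK mk) exprS mulN1r mulNr mulrA oppr_le0 mulr_ge0// ltW// IH//.
Qed.

Lemma roots_poly_horner m (x : R) : (roots_poly m).[x] = \prod_(i < m) (x - i.+1%:R).
Proof. by rewrite /roots_poly horner_prod; apply: eq_bigr => i _; rewrite !hornerE. Qed.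

Lemma roots_poly_root m k : (0 < k <= m)%N -> (roots_poly m).[k%:R] = 0.
Proof.
case: k => //= k km; rewrite roots_poly_horner (bigD1 (Ordinal km))//=.
by rewrite subrr mul0r.
Qed.

(** Exactly [m - k] of the factors are negative at [x]. *)
Lemma roots_poly_sign m k (x : R) : (k <= m)%N -> k%:R < x ->
  k = m \/ x < k.+1%:R -> 0 < (-1) ^+ (m - k) * (roots_poly m).[x].
Proof.
elim: m => [|m IH]; first by rewrite roots_poly_horner big_ord0 mulr1.
rewrite leq_eqVlt => /orP[/eqP -> kx _|km kx h].
  rewrite subnn mul1r roots_poly_horner prodr_gt0// => i _.
  by rewrite subr_gt0 (le_lt_trans _ kx)// ler_nat.
have xk : x < k.+1%:R by case: h => // e; rewrite e ltnn in km.
rewrite roots_polyS hornerM subSn// exprS mulN1r mulNr mulrA -mulrN.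
rewrite mulr_gt0 ?IH//; first by right.
by rewrite !hornerE oppr_gt0 subr_lt0 (lt_le_trans xk)// ler_nat.
Qed.

Lemma roots_poly_simple m (x : R) : (roots_poly m).[x] = 0 -> (roots_poly m)^`().[x] != 0.
Proof.
have sep : separable_poly (roots_poly m).
  rewrite /roots_poly -(big_mkord xpredT (fun i => 'X - i.+1%:R%:P)) -(big_map (fun i =>
    i.+1%:R) xpredT (fun c => 'X - c%:P)).
  rewrite separable_prod_XsubC map_inj_uniq ?iota_uniq// => i j /eqP.
  by rewrite eqr_nat => /eqP[].
move: sep; rewrite separable_poly.unlock => cop px.
by apply: (coprimep_root cop); apply/rootP.
Qed.

End Sharpness.

(** * The extremal polynomial in two variables *)

Section SharpNomial.
Context {R : realType}.
Variable d : nat.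
Hypothesis d_gt0 : (0 < d)%N.
Implicit Types (a v w y : 'rV[R]_2) (k : nat).

Local Notation p := (roots_poly d : {poly R}).

Definition base_point k : 'rV[R]_2 := k%:R *: delta_mx 0 0.
Definition apex : 'rV[R]_2 := delta_mx 0 1.

Definition sharp_support : seq 'rV[R]_2 := apex :: [seq base_point k | k <- iota 0 d.+1].

Definition sharp_coef a : R :=
  if a 0 1 == 0 then - p`_(Num.truncn (a 0 0)) else 1.

(* The polynomial y - (x - 1) ... (x - d): its zero set is the part of the graph
   of the product where the latter is positive. *)
Definition sharp_nomial : fewnomial R 2 :=
  [fsfun a in [fset a in sharp_support]%fset => sharp_coef a].

Lemma base_point0 k : base_point k 0 0 = k%:R.
Proof. by rewrite !mxE eqxx mulr1. Qed.

Lemma base_point1 k : base_point k 0 1 = 0.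
Proof. by rewrite !mxE/= mulr0. Qed.

Lemma sharp_coef_base k : sharp_coef (base_point k) = - p`_k.
Proof. by rewrite /sharp_coef base_point1 eqxx base_point0 natrK. Qed.

Lemma sharp_coef_apex : sharp_coef apex = 1.
Proof. by rewrite /sharp_coef /apex mxE/= oner_eq0. Qed.

Lemma p_coef_neq0 k : (k <= d)%N -> p`_k != 0.
Proof.
by move=> /(@roots_poly_coef R) kd; apply: contraTneq kd => ->; rewrite mulr0 ltxx.
Qed.

Lemma sharp_support_uniq : uniq sharp_support.
Proof.
rewrite cons_uniq map_inj_uniq ?iota_uniq ?andbT.
  apply/mapP => -[k _ /(congr1 (fun a : 'rV[R]_2 => a 0 1))].
  by rewrite base_point1 /apex mxE/= => /eqP; rewrite oner_eq0.
move=> k k' /(congr1 (fun a : 'rV[R]_2 => a 0 0)); rewrite !base_point0 => /eqP.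
by rewrite eqr_nat => /eqP.
Qed.

Lemma sharp_nomialE a : a \in sharp_support -> sharp_nomial a = sharp_coef a.
Proof. by move=> aS; rewrite fsfunE !inE; move: aS; rewrite inE => ->. Qed.

Lemma finsupp_sharp a : (a \in finsupp sharp_nomial) = (a \in sharp_support).
Proof.
apply/idP/idP => [|aS]; rewrite mem_finsupp.
  by rewrite fsfunE; case: ifPn; rewrite ?eqxx// !inE.
rewrite sharp_nomialE//; move: aS; rewrite inE => /orP[/eqP->|/mapP[k kd ->]].
  by rewrite sharp_coef_apex oner_eq0.
rewrite sharp_coef_base oppr_eq0 p_coef_neq0//.
by move: kd; rewrite mem_iota add0n ltnS.
Qed.

Lemma sum_sharp (g : 'rV[R]_2 -> R) :
  \sum_(a <- finsupp sharp_nomial) g a = g apex + \sum_(k < d.+1) g (base_point k).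
Proof.
rewrite (perm_big sharp_support)/=; last first.
  apply: uniq_perm; [exact: fset_uniq|exact: sharp_support_uniq|].
  by move=> a; rewrite finsupp_sharp.
by rewrite big_cons big_map -[iota 0 d.+1]/(index_iota 0 d.+1) big_mkord.
Qed.

Lemma mem_base k : (k <= d)%N -> base_point k \in finsupp sharp_nomial.
Proof.
by move=> kd; rewrite finsupp_sharp inE map_f ?orbT// mem_iota add0n ltnS.
Qed.

Lemma mem_apex : apex \in finsupp sharp_nomial.
Proof. by rewrite finsupp_sharp mem_head. Qed.

Lemma sharp_base k : (k <= d)%N -> sharp_nomial (base_point k) = - p`_k.
Proof. by move=> kd; rewrite sharp_nomialE ?sharp_coef_base// -finsupp_sharp mem_base. Qed.

Lemma sharp_apex : sharp_nomial apex = 1.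
Proof. by rewrite sharp_nomialE ?sharp_coef_apex// mem_head. Qed.

Lemma dot_base k y : dot (base_point k) y = k%:R * y 0 0.
Proof. by rewrite dot2 base_point0 base_point1 mul0r addr0. Qed.

Lemma dot_apex y : dot apex y = y 0 1.
Proof. by rewrite dotC dot_delta. Qed.

Lemma expsum_sharp y :
  expsum (finsupp sharp_nomial) sharp_nomial y = expR (y 0 1) - p.[expR (y 0 0)].
Proof.
rewrite /expsum sum_sharp sharp_apex mul1r dot_apex; congr (_ + _).
rewrite horner_coef size_roots_poly -sumrN; apply: eq_bigr => k _.
by rewrite sharp_base -1?ltnS// dot_base expRM_natl mulNr.
Qed.

Lemma sharp_spanning_dot v : (forall a b, a \in finsupp sharp_nomial ->
  b \in finsupp sharp_nomial -> dot v a = dot v b) -> v = 0.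
Proof.
move=> vc; have b0 : dot v (base_point 0) = 0 by rewrite dotC dot_base mul0r.
have e1 := vc _ _ mem_apex (mem_base (leq0n d)).
have e0 := vc _ _ (mem_base d_gt0) (mem_base (leq0n d)).
rewrite dotC dot_apex b0 in e1; rewrite dotC dot_base mul1r b0 in e0.
by apply: row2P; rewrite mxE.
Qed.

Lemma sharp_has_dim : has_dim (newton sharp_nomial) 2.
Proof.
exists 0, fullv; split; last by rewrite dimvf; exact: mul1n.
apply/seteqP; split => [x _|x _]; first by exists x; rewrite /= ?memvf ?add0r.
apply: (@affine_hull_orth _ _ _ (finsupp sharp_nomial) (base_point 0)).
- by apply: supp_newton; exact: mem_base.
- by move=> b fb; exact: supp_newton.
move=> v orth; suff -> : v = 0 by rewrite dot0l.
apply: sharp_spanning_dot => a b fa fb.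
have := orth _ fa; have := orth _ fb.
by rewrite !dotBr => /eqP; rewrite subr_eq0 => /eqP-> /eqP; rewrite subr_eq0 => /eqP->.
Qed.

(** The Newton polygon is a triangle with [d.+1] support points on its base, the face of normal
    [apex], and one at the opposite vertex, the face of normal [- apex]. *)
Lemma sharp_num_boundary :
  num_support_in sharp_nomial (boundary (newton sharp_nomial)) = d.+2.
Proof.
rewrite /num_support_in (_ : [fset a in _ | _]%fset = finsupp sharp_nomial).
  transitivity (size sharp_support); last by rewrite /= size_map size_iota.
  apply: perm_size; apply: uniq_perm; [exact: fset_uniq|exact: sharp_support_uniq|].
  by move=> a; rewrite finsupp_sharp.
apply/fsetP => a; rewrite !inE; apply/andP/idP => [[]//|fa]; split => //.
have apex0 : apex != 0.
  by apply/eqP => /(congr1 (fun a : 'rV[R]_2 => a 0 1)) /eqP; rewrite !mxE/= oner_eq0.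
apply/asboolP; move: (fa); rewrite finsupp_sharp inE => /orP[/eqP aE|/mapP[k kd aE]].
  apply: (@face_boundary _ _ _ (- apex)); first by rewrite oppr_eq0.
  split => // b; rewrite /supp/= finsupp_sharp inE aE !dotNl !dot_apex lerN2.
  move=> /orP[/eqP->//|/mapP[j _ ->]]; rewrite base_point1 /apex mxE/=; exact: ler01.
apply: (@face_boundary _ _ _ apex) => //; split => // b.
rewrite /supp/= finsupp_sharp inE aE !dot_apex base_point1.
by move=> /orP[/eqP->|/mapP[j _ ->]]; rewrite ?base_point1// /apex mxE/= ler01.
Qed.

Lemma expdir_smooth (g : fewnomial R 2) :
  (forall y, logzeros g y -> exists i, expdir (finsupp g) g (delta_mx 0 i) y != 0) ->
  smooth_zeros g.
Proof.
move=> h x; rewrite pos_zerosE => -[y zy <-]; have [i di] := h _ zy.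
apply/rV0Pn; exists i; rewrite gradient_expm mulf_neq0// invr_eq0.
by rewrite gt_eqF ?expR_gt0.
Qed.

Lemma sharp_smooth : smooth_zeros sharp_nomial.
Proof.
apply: expdir_smooth => y zy; exists 1.
rewrite /expdir /expsum sum_sharp big1 ?addr0.
  by rewrite sharp_apex dot_delta !mxE/= !mul1r gt_eqF ?expR_gt0.
by move=> k _; rewrite dot_delta base_point1 mulr0 mul0r.
Qed.

(** Three kinds of faces. If the apex is on the face, the derivative in the second variable is a
    single exponential. If the face is the whole base, the initial form is [- p], with simple roots.
    Otherwise it is one monomial and has no zero. *)
Lemma sharp_smooth_init w : w != 0 -> smooth_zeros (init_term w sharp_nomial).
Proof.
move=> w0; apply: expdir_smooth => y; rewrite logzeros_init => zy.
have [wa|nwa] := pselect (face (supp sharp_nomial) w apex).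
  exists 1; rewrite /expdir expsum_init /expsum sum_sharp big1 ?addr0.
    by rewrite /initc asboolT//= sharp_apex dot_delta !mxE/= !mul1r gt_eqF ?expR_gt0.
  by move=> k _; rewrite dot_delta base_point1 mulr0 mul0r.
have ic0 : initc sharp_nomial w apex = 0 by rewrite /initc asboolF.
have [a wa] : exists a, face (supp sharp_nomial) w a by apply: face_exists; exists apex;
  exact: mem_apex.
have [j jd aE] : exists2 j, (j <= d)%N & a = base_point j.
  move: (face_supp wa); rewrite finsupp_sharp inE => /orP[/eqP e|/mapP[j jd ->]].
    by case: nwa; rewrite -e.
  by exists j => //; move: jd; rewrite mem_iota add0n ltnS.
rewrite {}aE in wa.
move: zy; rewrite /expzeros/= /expsum sum_sharp ic0 mul0r add0r.
have [w00|w00] := eqVneq (w 0 0) 0.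
  have allf k : (k <= d)%N -> face (supp sharp_nomial) w (base_point k).
    move=> kd; split; first exact: mem_base.
    move=> b fb; rewrite dotC dot_base w00 mulr0.
    by have := proj2 wa _ fb; rewrite dotC dot_base w00 mulr0.
  have icE (k : 'I_d.+1) : initc sharp_nomial w (base_point k) = - p`_k.
    by rewrite /initc asboolT ?sharp_base -1?ltnS//; apply: allf; rewrite -ltnS.
  rewrite (eq_bigr (fun k : 'I_d.+1 => - (p`_k * expR (y 0 0) ^+ k))); last first.
    by move=> k _; rewrite icE dot_base expRM_natl mulNr.
  rewrite sumrN => /eqP; rewrite oppr_eq0 => /eqP pz.
  have : p.[expR (y 0 0)] = 0 by rewrite horner_coef size_roots_poly.
  move=> /roots_poly_simple dp; exists 0.
  rewrite /expdir expsum_init /expsum sum_sharp ic0 !mul0r add0r.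
  rewrite (eq_bigr (fun k : 'I_d.+1 => - (p`_k *+ k * expR (y 0 0) ^+ k))); last first.
    by move=> k _; rewrite icE dot_delta base_point0 dot_base expRM_natl -(mulr_natr
      p`_k) !mulNr.
  rewrite sumrN oppr_eq0 (_ : \sum_(k < d.+1) _ = expR (y 0 0) * p^`().[expR (y 0 0)]).
    by rewrite mulf_neq0// gt_eqF// expR_gt0.
  rewrite big_ord_recl mulr0n mul0r add0r.
  rewrite (horner_coef_wide _ (_ : (size p^`() <= d)%N)); last first.
    by rewrite -ltnS -[d.+1](@size_roots_poly R d) lt_size_deriv//
      -size_poly_eq0 size_roots_poly.
  by rewrite mulr_sumr; apply: eq_bigr => k _; rewrite lift0 coef_deriv exprS; ring.
rewrite (bigD1 (Ordinal (jd : (j < d.+1)%N)))//= big1 ?addr0.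
  rewrite /initc asboolT// sharp_base// => /eqP.
  by rewrite mulf_eq0 oppr_eq0 (negPf (p_coef_neq0 jd)) gt_eqF ?expR_gt0.
move=> k kj; rewrite /initc asboolF ?mul0r// => wk.
have := face_val wk wa; rewrite ![dot w _]dotC !dot_base => /(mulIf w00)/eqP.
by rewrite eqr_nat => /eqP e; move/eqP: kj; apply; exact: val_inj.
Qed.

(** Between [x] and the root [r], [p] is positive and tends to zero at [r], so the second
    logarithmic coordinate goes to minus infinity within [C]. The root may lie on either side of
    [x]. *)
Lemma sharp_noncompact (r x : R) C : 0 < r -> 0 < x -> p.[r] = 0 ->
  (forall t, 0 < t <= 1 -> 0 < r + t * (x - r) /\ 0 < p.[r + t * (x - r)]) ->
  components (logzeros sharp_nomial) C ->
  C (\row_j if j == 0 then ln x else ln p.[x]) -> ~ compact C.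
Proof.
move=> r0 x0 pr pos cC Cx cptC.
pose z t := r + t * (x - r).
pose g t : 'rV[R]_2 := \row_j if j == 0 then ln (z t) else ln p.[z t].
have cz : continuous z.
  move=> t; apply: (@cvgD _ _ _ (nbhs t)); first exact: cvg_cst.
  by apply: cvgM; [exact: cvg_id|exact: cvg_cst].
have cpz : continuous (fun t => p.[z t]).
  by move=> t; apply: continuous_comp; [exact: cz|exact: continuous_horner].
have gC t : 0 < t <= 1 -> C (g t).
  move=> t01.
  have conn : connected (g @` `]0, 1]).
    apply: connected_continuous_connected.
      apply/connected_intervalP => a b;
        rewrite /= !in_itv/= => /andP[a0 _] /andP[_ b1] c /andP[ac cb].
      by rewrite in_itv/= (lt_le_trans a0 ac) (le_trans cb b1).
    apply/subspace_continuousP => s; rewrite /= in_itv/= => s01.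
    apply: cvg_within_filter; apply: (@cvg_row _ _ _ (nbhs s)) => i.
    have [z0 p0] := pos _ s01.
    have [-> |i1] := eqVneq i 0.
      rewrite (_ : (fun _ => _) = @ln R \o z); last by apply/funext => u; rewrite !mxE eqxx.
      rewrite !mxE eqxx; apply: continuous_comp; [exact: cz|exact: continuous_ln].
    rewrite (_ : (fun _ => _) = @ln R \o (fun t => p.[z t])); last first.
      by apply/funext => u; rewrite !mxE (negPf i1).
    by rewrite !mxE (negPf i1); apply: continuous_comp; [exact: cpz|exact: continuous_ln].
  apply: (component_max cC Cx (G := g @` `]0, 1])).
  - exists 1; first by rewrite /= in_itv/= ltr01 lexx.
    by rewrite /g /z mul1r addrC subrK.
  - exact: conn.
  - move=> _ [s + <-]; rewrite /= in_itv/= => /pos[z0 p0].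
    by rewrite /logzeros /expzeros/= expsum_sharp !mxE/= !lnK ?posrE// subrr.
  - by exists t => //; rewrite /= in_itv.
have [M [Mr MC]] := compact_bounded cptC.
pose K := `|M| + 1.
have KM : M < K by rewrite (le_lt_trans (ler_norm M))// ltrDl.
have : \forall t \near 0^'+, p.[z t] < expR (- (K + 1)).
  apply: (cvgr_lt p.[z 0]); last by rewrite /z mul0r addr0 pr expR_gt0.
  exact: (cvg_at_right_filter (cpz 0)).
move=> small; have H0 : \forall t \near (0 : R)^'+, 0 < t by exact: nbhs_right_gt.
have H1 : \forall t \near (0 : R)^'+, t <= 1 by exact: nbhs_right_le.
have [t [[tsmall t0] t1]] := filter_ex (filterI (filterI small H0) H1).
have t01 : 0 < t <= 1 by rewrite t0 t1.
have [_ pz0] := pos t t01.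
have := MC K KM _ (gC _ t01); apply/negP; rewrite -ltNge.
rewrite (lt_le_trans _ (coord_le_norm (g t) 1))// mxE/=.
have : ln p.[z t] < - (K + 1).
  by rewrite -ltr_expR lnK.
rewrite -[X in _ -> _ < X]normrN => h.
by rewrite (lt_le_trans _ (ler_norm _))// ltrNr (lt_trans h)// ltrN2 ltrDl.
Qed.

(** [p] is positive beyond [d] and between [d - 2j] and [d - 2j + 1] for the other [j]; one point is
    taken for each [j] from 0 to [d./2], which makes [d.+2./2] of them. *)
Definition sharp_abscissa (j : nat) : R := (d - j.*2)%:R + 2^-1.

Definition sharp_point (j : nat) : 'rV[R]_2 :=
  \row_i if i == 0 then ln (sharp_abscissa j) else ln p.[sharp_abscissa j].

Lemma p_pos j (x : R) : (j <= d./2)%N -> (d - j.*2)%:R < x ->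
  j = 0%N \/ x < (d - j.*2).+1%:R -> 0 < p.[x].
Proof.
move=> jd dx h; have jd2 : (j.*2 <= d)%N by rewrite -geq_half_double.
have := @roots_poly_sign R d (d - j.*2) x (leq_subr _ _) dx.
rewrite subKn// -muln2 mulnC exprM sqrrN !expr1n mul1r; apply.
by case: h => [->|h]; [left; rewrite muln0 subn0|right; rewrite mulnC muln2].
Qed.

Lemma sharp_abscissa_gt j : (d - j.*2)%:R < sharp_abscissa j.
Proof. by rewrite ltrDl invr_gt0. Qed.

Lemma sharp_abscissa_lt j : sharp_abscissa j < (d - j.*2).+1%:R.
Proof. by rewrite -natr1 ltrD2l invf_lt1// ltr1n. Qed.

Lemma sharp_abscissa_gt0 j : 0 < sharp_abscissa j.
Proof. by rewrite ltr_wpDl// invr_gt0. Qed.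

Lemma sharp_point_zero j : (j <= d./2)%N -> logzeros sharp_nomial (sharp_point j).
Proof.
move=> jd; rewrite /logzeros /expzeros/= expsum_sharp !mxE/= !lnK ?subrr//.
  by rewrite posrE sharp_abscissa_gt0.
rewrite posrE (p_pos jd)//; first exact: sharp_abscissa_gt.
by right; exact: sharp_abscissa_lt.
Qed.

Lemma sharp_component_noncompact j C : (j <= d./2)%N ->
  components (logzeros sharp_nomial) C -> C (sharp_point j) -> ~ compact C.
Proof.
move=> jd cC Cj; have jd2 : (j.*2 <= d)%N by rewrite -geq_half_double.
case: j jd jd2 Cj => [_ _|j jd jd2] Cj.
  apply: (@sharp_noncompact d%:R (sharp_abscissa 0)) cC Cj => //.
  - by rewrite ltr0n.
  - exact: sharp_abscissa_gt0.
  - by apply: roots_poly_root; rewrite d_gt0 leqnn.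
  move=> t /andP[t0 t1].
  have dz : d%:R < d%:R + t * (sharp_abscissa 0 - d%:R).
    have := sharp_abscissa_gt 0; rewrite double0 subn0 => h.
    by rewrite ltrDl mulr_gt0// subr_gt0.
  split; first by rewrite (lt_trans _ dz)// ltr0n.
  by apply: (@p_pos 0) => //; [rewrite subn0|left].
(* The root is the right end of the interval, as the left end is 0 and no root when
   [d = j.+1.*2]. *)
have r0 : 0 < (d - j.+1.*2).+1%:R :> R by rewrite ltr0n.
apply: (@sharp_noncompact (d - j.+1.*2).+1%:R (sharp_abscissa j.+1)) cC Cj => //.
- exact: sharp_abscissa_gt0.
- by apply: roots_poly_root; rewrite ltn0Sn/= ltn_subrL d_gt0.
move=> t /andP[t0 t1].
have zE : (d - j.+1.*2).+1%:R + t * (sharp_abscissa j.+1 - (d - j.+1.*2).+1%:R) =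
    (d - j.+1.*2)%:R + (1 - t / 2).
  by rewrite /sharp_abscissa -natr1; field.
have z0 : (d - j.+1.*2)%:R < (d - j.+1.*2).+1%:R + t * (sharp_abscissa j.+1 - (d -
  j.+1.*2).+1%:R).
  by rewrite zE ltrDl; lra.
split; first exact: le_lt_trans z0.
apply: (p_pos jd) => //; right.
by rewrite zE -[X in _ < X]natr1 ltrD2l; lra.
Qed.

(** The first coordinate maps a connected set onto an interval, which would contain the logarithm of
    the root [d - 2j]; there the equation reads [expR (y 0 1) = 0]. *)
Lemma sharp_component_inj j j' : (j < j')%N -> (j' <= d./2)%N ->
  ~ connected_component (logzeros sharp_nomial) (sharp_point j) (sharp_point j').
Proof.
move=> jj jd [B [Bj BZ cB] Bj'].
have jd2 : (j'.*2 <= d)%N by rewrite -geq_half_double.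
have jj2 : (j.*2 < d)%N by rewrite (leq_trans _ jd2)// ltn_double.
have r0 : 0 < (d - j.*2)%:R :> R by rewrite ltr0n subn_gt0.
have cI : connected ((fun y : 'rV[R]_2 => y 0 0) @` B).
  apply: connected_continuous_connected => //.
  by apply: continuous_subspaceT; exact: coord_continuous.
have [] : ((fun y : 'rV[R]_2 => y 0 0) @` B) (ln (d - j.*2)%:R).
  move/connected_intervalP : cI; apply.
  - by exists (sharp_point j').
  - by exists (sharp_point j).
  rewrite !mxE/= !ler_ln ?posrE ?sharp_abscissa_gt0// (ltW (sharp_abscissa_gt j)) andbT.
  rewrite (le_trans (ltW (sharp_abscissa_lt _)))// ler_nat.
  by rewrite ltn_sub2l// ltn_double.
move=> y /BZ + y0; rewrite /logzeros /expzeros/= expsum_sharp y0 lnK ?posrE//.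
rewrite roots_poly_root; last by rewrite subn_gt0 jj2 leq_subr.
by move/eqP; rewrite subr0 gt_eqF// expR_gt0.
Qed.

Lemma sharp_num_noncompact :
  num_noncompact_components sharp_nomial = (d.+2./2)%:R%:E.
Proof.
apply/eqP; rewrite eq_le; apply/andP; split.
  rewrite -sharp_num_boundary; apply: num_noncompact_planar_le.
  - exact: sharp_smooth_init.
  - exact/has_dim_spanning/sharp_has_dim.
  - exact: sharp_smooth.
rewrite num_noncompact_componentsE.
pose s := [seq connected_component (logzeros sharp_nomial) (sharp_point j) | j <- iota 0
  (d./2).+1].
have sj j : j \in iota 0 (d./2).+1 -> (j <= d./2)%N by rewrite mem_iota add0n ltnS.
have -> : d.+2./2 = size s by rewrite size_map size_iota.
apply: counting_ge.
  rewrite map_inj_in_uniq ?iota_uniq// => j j' /sj jd /sj jd' e.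
  have cjj' : connected_component (logzeros sharp_nomial) (sharp_point j) (sharp_point j').
    by rewrite e; apply: connected_component_refl; exact: sharp_point_zero.
  have [jj|jj|//] := ltngtP j j'; first by case: (sharp_component_inj jj jd' cjj').
  by case: (sharp_component_inj jj jd (connected_component_sym cjj')).
move=> _ /mapP[j /sj jd ->].
have cC : components (logzeros sharp_nomial)
    (connected_component (logzeros sharp_nomial) (sharp_point j)).
  by exists (sharp_point j) => //; exact: sharp_point_zero.
split => //; apply: (sharp_component_noncompact jd cC).
by apply: connected_component_refl; exact: sharp_point_zero.
Qed.

End SharpNomial.

Theorem theorem3 (R : realType) :
  (forall (n m : nat) (f : fewnomial R n),
     nomial m f ->
     has_dim (newton f) n ->
     (forall w : 'rV[R]_n, w != 0 -> smooth_zeros (init_term w f)) ->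
     [/\ (num_noncompact_components f <=
          \esum_(w in unit_facet_normal (newton f)) num_components (init_term w f))%E,
         (2 <= n)%N ->
         (\esum_(w in unit_facet_normal (newton f)) num_components (init_term w f) <=
          \esum_(Q in is_facet (newton f))
             max_num_components R n.-1 (num_support_in f Q))%E
       & n = 2%N -> smooth_zeros f ->
         (num_noncompact_components f <=
          ((num_support_in f (boundary (newton f)))./2)%:R%:E)%E])
  /\
  (forall m' : nat, (3 <= m')%N ->
     exists f : fewnomial R 2,
       [/\ has_dim (newton f) 2,
           (forall w : 'rV[R]_2, w != 0 -> smooth_zeros (init_term w f)),
           smooth_zeros f,
           num_support_in f (boundary (newton f)) = m'
         & num_noncompact_components f = (m'./2)%:R%:E]).
Proof.
split=> [n m f _ /has_dim_spanning sp smi|[|[|d]]// d0].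
  split; [exact: num_noncompact_le|by move=> _; exact: esum_facets_le|].
  by move=> n2; subst n => sm; exact: num_noncompact_planar_le.
(* Here [m' = d.+2], for [d.+1] points on the base and the apex, and [3 <= m'] says that [0 < d]. *)
exists (sharp_nomial d); split.
- exact: sharp_has_dim.
- exact: sharp_smooth_init.
- exact: sharp_smooth.
- exact: sharp_num_boundary.
- exact: sharp_num_noncompact.
Qed.
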